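(* For $\mu\in\mathscr P_{\mathcal A/\mathcal B,m}$ and $\nu\in\mathscr P_{\mathcal A/\mathcal B,n}$ there exists a bijection $$\rho_{\mathcal A/\mathcal B}:\ SST_{\mathcal A/\mathcal B}(\mu)\times SST_{\mathcal A/\mathcal B}(\nu)\longrightarrow\bigsqcup_{\lambda\in\mathscr P_{\mathcal A/\mathcal B,m+n}}SST_{\mathcal A/\mathcal B}(\lambda)\times\mathbf{LR}^{\lambda}_{\mu\,\nu}.$$ In terms of characters, $$S^{\mathcal A/\mathcal B}_{\mu}\,S^{\mathcal A/\mathcal B}_{\nu}=\sum_{\lambda\in\mathscr P_{\mathcal A/\mathcal B,m+n}}\hat c^{\lambda}_{\mu\,\nu}\,S^{\mathcal A/\mathcal B}_{\lambda}.$$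
   Context: $\mathcal A=\mathcal A_0\sqcup\mathcal A_1$ and $\mathcal B=\mathcal B_0\sqcup\mathcal B_1$ are at most countable, linearly ordered, $\mathbb Z_2$-graded sets; $m,n\ge1$. $\mathbb N=\{1<2<\dots\}$ with all elements of degree $0$. $\mathscr P$ is the set of partitions, $\mathscr P_n$ those of length at most $n$, identified with Young diagrams; $\lambda'$ is the conjugate; $(d^n)=(d,\dots,d)$ ($n$ entries). For a skew Young diagram $\lambda/\mu$, $SST_{\mathcal A}(\lambda/\mu)$ is the set of $\mathcal A$-semistandard tableaux: fillings with entries in $\mathcal A$, weakly increasing along rows (left to right) and columns (top to bottom), with entries of $\mathcal A_0$ strictly increasing in each column and entries of $\mathcal A_1$ strictly increasing in each row. The empty shape has exactly one tableau $\emptyset$. $\mathbb Z_+^n=\{\lambda\in\mathbb Z^n: \lambda_1\geq\dots\geq\lambda_n\}$ (generalized partitions of level $n$), with componentwise addition. For $\lambda\in\mathbb Z_+^n$, $SST_{\mathcal A/\mathcal B}(\lambda)$ is the set of pairs $(T^+,T^-)$ with $T^+\in SST_{\mathcal A}((\lambda+(d^n))/\mu)$ and $T^-\in SST_{\mathcal B}((d^n)/\mu)$ for some integer $d\ge 0$ and $\mu\in\mathscr P_n$ such that $\lambda+(d^n)\in\mathscr P_n$, $\mu\subset(d^n)$ and $\mu\subset\lambda+(d^n)$. Diagrams are placed in $n$ rows with column positions measured from a vertical line after column $d$, so that pairs arising from $(d,\mu)$ and from $(d+1,\mu+(1^n))$ with the same fillings are identified. $\mathscr P_{\mathcal A/\mathcal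 B,n}=\{\lambda\in\mathbb Z_+^n: SST_{\mathcal A/\mathcal B}(\lambda)\neq\emptyset\}$. The character is $S^{\mathcal A/\mathcal B}_\lambda=\sum_{(T^+,T^-)}\mathbf x_{\mathcal A}^{T^+}(\mathbf x_{\mathcal B}^{T^-})^{-1}\in\mathbb Z[[\mathbf x_{\mathcal A},\mathbf x_{\mathcal B}^{-1}]]$, sum over $SST_{\mathcal A/\mathcal B}(\lambda)$, where $\mathbf x^T=\prod_a x_a^{m_a}$, $m_a$ = number of occurrences of $a$ in $T$. Littlewood-Richardson tableaux: for partitions $\mu\subset\lambda$, $\nu$ with $|\lambda|=|\mu|+|\nu|$, $LR^{\lambda}_{\mu\,\nu}$ is the set of $T\in SST_{\mathbb N}(\lambda/\mu)$ in which $k$ occurs $\nu_k$ times for all $k$ and whose word, read column by column from right to left and top to bottom in each column, is a lattice permutation (in every initial segment, $k$ occurs at least as often as $k+1$). Otherwise $LR^\lambda_{\mu\,\nu}=\emptyset$. $N^\lambda_{\mu\,\nu}=|LR^\lambda_{\mu\,\nu}|$. Now let $\lambda\in\mathbb Z_+^{m+n}$, $\mu\in\mathbb Z_+^m$, $\nu\in\mathbb Z_+^n$. Put $\hat c^{\lambda}_{\mu\,\nu}=N^{\lambda+(p^{m+n})}_{\mu+(p^m)\,\nu+(p^n)}$ for all sufficiently large $p$. When $\lambda,\mu,\nu$ are partitions and $\ell\ge0$, there is a bijection $\pi^{m,n}_\ell: LR^{(\lambda+(\ell^{m+n}))'}_{(\mu+(\ell^m))'\,(\nu+(\ell^n))'}\to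 LR^{\lambda'}_{\mu'\,\nu'}$ that removes the first $\ell$ rows of a tableau and subtracts $\ell$ from every remaining entry. In general let $d$ be the smallest non-negative integer such that $\lambda+(d^{m+n}),\mu+(d^m),\nu+(d^n)$ are partitions, and set $\mathbf{LR}^{\lambda}_{\mu\,\nu}=\{[Q]: Q\in LR^{(\lambda+(d^{m+n}))'}_{(\mu+(d^m))'\,(\nu+(d^n))'}\}$, where $[Q]=\{(\pi^{m,n}_\ell)^{-1}(Q):\ell\ge0\}$. *)

(* Defs.v *)
From HB Require Import structures.
From mathcomp Require Import all_boot all_order all_algebra.
From mathcomp Require Import finmap multiset.
From mathcomp Require Import boolp classical_sets functions cardinality fsbigop.

Set Implicit Arguments.
Unset Strict Implicit.
Unset Printing Implicit Defensive.

Import Order.TTheory GRing.Theory Num.Theory.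

Local Open Scope classical_set_scope.
Local Open Scope nat_scope.

(* Partitions are weakly decreasing sequences of naturals.  Trailing zeros are
   allowed: they do not change the diagram, and a partition in P_n is written
   with exactly n entries. Rows and columns are numbered from 0. *)
Definition is_part (la : seq nat) : bool := sorted geq la.

Definition part_sub (mu la : seq nat) : Prop :=
  forall i, nth 0 mu i <= nth 0 la i.

Definition conj_part (la : seq nat) : seq nat :=
  mkseq (fun j => count (fun x => j < x) la) (head 0 la).

Section Tableaux.
Context {d : Order.disp_t} {A : orderType d}.
Implicit Types (la mu : seq nat) (T : seq (seq A)).

(* A filling of la / mu is the list of its rows, one (possibly empty) row per
   entry of la. Row i occupies the columns mu_i <= j < la_i. *)
Definition entry mu T (i j : nat) : option A :=
  if nth 0 mu i <= j then onth (nth [::] T i) (j - nth 0 mu i) else None.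

Definition column mu T (j : nat) : seq A :=
  pmap (fun i => entry mu T i j) (iota 0 (size T)).

(* [odd_deg a] means that a has degree 1. *)
Definition row_ok (odd_deg : A -> bool) (r : seq A) : bool :=
  sorted <=%O r && sorted <%O [seq a <- r | odd_deg a].

Definition column_ok (odd_deg : A -> bool) (c : seq A) : bool :=
  sorted <=%O c && sorted <%O [seq a <- c | ~~ odd_deg a].

Definition SST (odd_deg : A -> bool) la mu : set (seq (seq A)) :=
  [set T | [/\ shape T = mkseq (fun i => nth 0 la i - nth 0 mu i) (size la),
               all (row_ok odd_deg) T
             & forall j, column_ok odd_deg (column mu T j)]].

End Tableaux.

(* The letter k of the alphabet {1 < 2 < ...} is represented by k - 1 : nat. *)

Definition LR_word (la mu : seq nat) (T : seq (seq nat)) : seq nat :=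
  flatten [seq column mu T j | j <- rev (iota 0 (head 0 la))].

Definition lattice_permutation (w : seq nat) : Prop :=
  forall i k, count_mem k.+1 (take i w) <= count_mem k (take i w).

Definition LR (la mu nu : seq nat) : set (seq (seq nat)) :=
  [set T | [/\ is_part la, is_part mu & is_part nu]
        /\ [/\ part_sub mu la, sumn la = sumn mu + sumn nu,
               SST (fun=> false) la mu T,
               forall k, count_mem k (flatten T) = nth 0 nu k
             & lattice_permutation (LR_word la mu T)]].

Definition LR_number (la mu nu : seq nat) : nat :=
  #|` fset_set (LR la mu nu)|%fset.

Definition gen_part (n : nat) (la : n.-tuple int) : bool :=
  sorted (fun x y : int => (y <= x)%R) la.

(* la + (p^n); meaningful as a sequence of naturals only under [shiftable]. *)
Definition shift_part (n : nat) (p : nat) (la : n.-tuple int) : seq nat :=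
  [seq `|(x + p%:Z)%R|%N | x <- la].

Definition shiftable (n : nat) (p : nat) (la : n.-tuple int) : bool :=
  all (fun x : int => (0 <= x + p%:Z)%R) la.

Section LRClasses.
Variables (m n : nat).
Implicit Types (la : (m + n).-tuple int) (mu : m.-tuple int)
  (nu : n.-tuple int).

(* The eventual value of p |-> N^{la + (p^(m+n))}_{mu + (p^m), nu + (p^n)}. *)
Definition hatc la mu nu : nat :=
  xget 0 [set c | exists p0, forall p, p0 <= p ->
                  LR_number (shift_part p la) (shift_part p mu) (shift_part p nu) = c].

Definition LR_conj la mu nu (p : nat) : set (seq (seq nat)) :=
  LR (conj_part (shift_part p la)) (conj_part (shift_part p mu))
     (conj_part (shift_part p nu)).

Definition LR_pi (l : nat) (T : seq (seq nat)) : seq (seq nat) :=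
  [seq [seq x - l | x <- r] | r <- drop l T].

Definition LR_class la mu nu (p : nat) (Q : seq (seq nat)) :
    set (seq (seq nat)) :=
  [set R | exists l, LR_conj la mu nu (p + l) R /\ LR_pi l R = Q].

Definition minimal_shift la mu nu (p : nat) : Prop :=
  [/\ shiftable p la, shiftable p mu, shiftable p nu
    & forall q, [&& shiftable q la, shiftable q mu & shiftable q nu] ->
                p <= q].

Definition LR_classes la mu nu : set (set (seq (seq nat))) :=
  [set C | exists p, minimal_shift la mu nu p /\
           exists2 Q, LR_conj la mu nu p Q & C = LR_class la mu nu p Q].

End LRClasses.

Section Rational.
Context {dA dB : Order.disp_t} {A : orderType dA} {B : orderType dB}.
Variables (oddA : A -> bool) (oddB : B -> bool).

(* Rows are stored without their column positions. The row lengths of the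
   second component are p - mu_i, so two choices (p, mu) and (p', mu') produce
   the same pair of row lists exactly when they differ by a simultaneous shift
   of p and mu and the fillings agree; this realises the identification. *)
Definition ratSST (n : nat) (la : n.-tuple int) :
    set (seq (seq A) * seq (seq B)) :=
  [set T | gen_part la /\
     exists (p : nat) (mu : n.-tuple nat),
       [/\ shiftable p la, is_part mu, part_sub mu (nseq n p)
         & part_sub mu (shift_part p la)] /\
       SST oddA (shift_part p la) mu T.1 /\ SST oddB (nseq n p) mu T.2].

Definition ratParts (n : nat) : set (n.-tuple int) :=
  [set la | gen_part la /\ ratSST la !=set0].

(* The monomial x_A^M (x_B^N)^-1 is represented by the pair of multisets
   (M, N), and a series in Z[[x_A, x_B^-1]] by its coefficient function. *)
Definition monom : Type := ({mset A}%mset * {mset B}%mset)%type.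
Definition fseries : Type := monom -> int.

Definition monom_mul (u v : monom) : monom :=
  (u.1 `+` v.1, u.2 `+` v.2)%mset.

Definition weight (T : seq (seq A) * seq (seq B)) : monom :=
  (seq_mset (flatten T.1), seq_mset (flatten T.2)).

(* The sums over sets below are finite-support sums: a monomial has finitely
   many factorisations and is the weight of finitely many tableau pairs. *)
Definition series_mul (f g : fseries) : fseries := fun w =>
  (\sum_(uv \in [set uv : monom * monom | monom_mul uv.1 uv.2 = w])
      (f uv.1 * g uv.2))%R.

Definition ratS (n : nat) (la : n.-tuple int) : fseries := fun w =>
  (\sum_(T \in ratSST la) ((weight T == w)%:R : int))%R.

End Rational.

(* Main.v *)
(* For a fixed monomial w, both sides of the bijection have finitely many
   elements of weight w; a bijection exists as soon as these numbers agree, and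
   the same numbers are the coefficients in the character identity.

   By the Pieri rule, the number of elements of SST_{A/B}(la) of weight w is the
   coefficient of s_la in a product G_w of functions h_k and e_k in m+n variables,
   with the letters of B taken at the inverse variables. Separating the first m
   variables from the last n splits G_w into products G_u G_v with uv = w. The
   coefficient of s_mu s_nu in this restriction therefore counts the left-hand
   pairs; expanding G_w in Schur functions first gives the right-hand count, the
   branching coefficients being Littlewood-Richardson numbers. The latter are
   identified by Stembridge's sign-reversing involution, and transposed by
   comparing products of h_k with products of e_k. *)
Require Import Defs.
From HB Require Import structures.
From mathcomp Require Import all_boot all_order all_algebra all_fingroup.
From mathcomp Require Import finmap multiset.
From mathcomp Require Import boolp classical_sets functions cardinality fsbigop.
From mathcomp Require Import zify ring.

Set Implicit Arguments.
Unset Strict Implicit.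
Unset Printing Implicit Defensive.

Import Order.TTheory GRing.Theory Num.Theory.

Local Open Scope nat_scope.

Notation vec n := {ffun 'I_n -> int}.
Notation shp n D := {ffun 'I_n -> 'I_D.+1}.
Notation shps r n D := {ffun 'I_r -> shp n D}.

(** No ring of symmetric functions is built. A Laurent polynomial is the function of its
    coefficients on integer vectors, and its coefficient on a Schur function is a signed sum of
    these values over permutations: Weyl's character formula with the denominator cleared. Every
    comparison of Schur expansions thus becomes an identity between finite sums of integers.
    Finiteness shapes the proof. Diagrams and exponents are confined to n rows with entries at most
    D, so that all sums run over finite types. The bound D, and the level p of the rectangle in a
    rational tableau, are chosen anew for each monomial w, large enough that nothing of weight w is
    lost. Negative rows disappear after adding (p^n): the Schur function of (p^n) is the p-th power
    of the product of the variables, so changing the level merely translates exponents. The same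
    translation makes the Littlewood-Richardson numbers independent of p, so that [hatc] and the
    number of elements of [LR_classes] can be computed at one level. *)

Lemma sum_sign_reversing (I : finType) (P : pred I) (F : I -> int) (phi : I -> I) :
    (forall x, P x -> P (phi x)) -> (forall x, P x -> phi (phi x) = x) ->
    (forall x, P x -> F (phi x) = - F x)%R ->
  (\sum_(x | P x) F x = 0)%R.
Proof.
move=> phiP phiK Fphi.
have phi_inj : {in P &, injective phi}.
  by move=> x y Px Py e; rewrite -(phiK x) // e phiK.
have e : (\sum_(x | P x) F x = \sum_(x | P x) F (phi x))%R.
  rewrite [LHS](reindex_onto phi phi) //=; apply: eq_big => // x.
  apply/andP/idP => [[Ppx /eqP <-]|Px]; first exact: phiP.
  by rewrite phiP ?phiK.
move: e; under [X in _ = X]eq_bigr => x Px do rewrite Fphi //.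
by rewrite sumrN => /eqP; rewrite -subr_eq0 opprK -mulr2n mulrn_eq0 => /eqP.
Qed.

(** * Symmetric functions through alternating sums *)

Section Vectors.
Variable n : nat.
Implicit Types (g a : vec n) (F : vec n -> int) (s : {perm 'I_n}).

Definition pact s g : vec n := [ffun i => g (s i)].

Lemma pactB s g a : pact s (g - a)%R = (pact s g - pact s a)%R.
Proof. by apply/ffunP => i; rewrite !ffunE. Qed.

Lemma pactD s g a : pact s (g + a)%R = (pact s g + pact s a)%R.
Proof. by apply/ffunP => i; rewrite !ffunE. Qed.

Lemma pactN s g : pact s (- g)%R = (- pact s g)%R.
Proof. by apply/ffunP => i; rewrite !ffunE. Qed.

Lemma pact1 g : pact 1 g = g.
Proof. by apply/ffunP => i; rewrite ffunE perm1. Qed.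

Lemma pactM s s' g : pact (s * s')%g g = pact s (pact s' g).
Proof. by apply/ffunP => i; rewrite !ffunE permM. Qed.

Lemma pactK s : cancel (pact s) (pact s^-1%g).
Proof. by move=> g; rewrite -pactM mulVg pact1. Qed.

Lemma pactVK s : cancel (pact s^-1%g) (pact s).
Proof. by move=> g; rewrite -pactM mulgV pact1. Qed.

Definition antisymmetric_fun F :=
  forall s g, F (pact s g) = ((-1) ^+ s * F g)%R.

Definition symmetric_fun F := forall s g, F (pact s g) = F g.

Lemma antisym_eq0 F g i j : antisymmetric_fun F -> i != j -> g i = g j -> F g = 0%R.
Proof.
move=> aF ij gij; have := aF (tperm i j) g; rewrite odd_tperm ij expr1.
suff -> : pact (tperm i j) g = g by rewrite mulN1r => e; lia.
by apply/ffunP => x; rewrite ffunE; case: tpermP => // ->.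
Qed.

Definition delta : vec n := [ffun i : 'I_n => Posz (n - i.+1)].

Definition dirac a g : int := (g == a)%:R%R.

(** The coefficient of x^g in det(x_i^(a_j)); for a = mu + delta this determinant is the numerator
    of the Schur function s_mu. *)
Definition alternant a g : int := (\sum_(s : {perm 'I_n}) (-1) ^+ s * (g == pact s a)%:R)%R.

Lemma sum_perm_sign (f : {perm 'I_n} -> int) :
  (\sum_(s : {perm 'I_n}) (-1) ^+ s * f s = \sum_(s : {perm 'I_n}) (-1) ^+ s * f s^-1%g)%R.
Proof.
rewrite [LHS](reindex_inj invg_inj); apply: eq_bigr => s _.
by rewrite odd_permV.
Qed.

Lemma alternant_antisym a : antisymmetric_fun (alternant a).
Proof.
move=> s g; rewrite /alternant mulr_sumr [LHS](reindex_inj (mulgI s)).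
apply: eq_bigr => s' _; rewrite odd_permM signr_addb -mulrA.
by rewrite pactM (can_eq (pactK s)).
Qed.

(* When f lists the coefficients of a symmetric Laurent polynomial in n
   variables, [hat f la] is its coefficient on the Schur function s_la, and
   [bracket f la mu] the coefficient of s_la in its product by s_mu. *)
Definition hat (f : vec n -> int) (la : vec n) : int :=
  (\sum_(s : {perm 'I_n}) (-1) ^+ s * f (la + delta - pact s delta))%R.

Definition bracket (f : vec n -> int) (la mu : vec n) : int :=
  (\sum_(s : {perm 'I_n}) (-1) ^+ s * f (la + delta - pact s (mu + delta)))%R.

(** Multiplication by f is adjoint to multiplication by f at the inverse variables: replace s by its
    inverse, then let s act on the whole argument of f. *)
Lemma bracket_adj f la mu : symmetric_fun f ->
  bracket f la mu = bracket (fun g => f (- g)%R) mu la.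
Proof.
move=> sf; rewrite /bracket [RHS]sum_perm_sign; apply: eq_bigr => s _.
congr (_ * _)%R; rewrite -[RHS](sf s) pactN pactB pactVK opprB //.
Qed.

Definition strict_dec g := forall i j : 'I_n, i < j -> (g j < g i)%R.

Lemma increasing_perm1 s : (forall i j : 'I_n, i < j -> s i < s j) -> s = 1%g.
Proof.
move=> incr; suff h : forall k (i : 'I_n), i = k :> nat -> s i = i.
  by apply/permP => i; rewrite perm1; exact: (h i).
elim/ltn_ind => k IH i ik; apply: contrapT => sii.
have [lt|ge] := ltnP (s i) i.
  have e : s (s i) = s i by apply: (IH (s i)); rewrite // -ik.
  by apply: sii; apply: (@perm_inj _ s).
have gt : i < s i by rewrite ltn_neqAle ge andbT eq_sym; apply/negP => /eqP/val_inj.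
pose j := (s^-1)%g i; have sj : s j = i by rewrite permKV.
case: (ltngtP i j) => [ij|ji|/val_inj ij].
- by have := incr _ _ ij; rewrite sj; lia.
- have := IH j _ j erefl; rewrite -ik => /(_ ji) sjj; move: ji.
  by rewrite -{1}sjj sj ltnn.
- by apply: sii; rewrite {1}ij sj.
Qed.

(** An orbit contains at most one strictly decreasing vector, and an increasing permutation is the
    identity, so only s = 1 contributes. *)
Lemma alternant_dec a g : strict_dec a -> strict_dec g ->
  alternant a g = (g == a)%:R%R.
Proof.
move=> da dg; rewrite /alternant (bigD1 1%g) //= odd_perm1 mul1r pact1.
rewrite big1 ?addr0 // => s sn1.
case: eqP => [e|]; last by rewrite mulr0.
case/negP: sn1; apply/eqP/increasing_perm1 => i j ij.
have := dg _ _ ij; rewrite e !ffunE.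
case: (ltngtP (s i) (s j)) => // [/da h1 h2|/val_inj/perm_inj ij']; first by lia.
by move: ij; rewrite ij' ltnn.
Qed.

End Vectors.

(** * The Pieri rule *)

Section Shapes.
Variables n D : nat.
Implicit Types (e : shp n D).

(** Reading 0 below the last row lets rows i and i+1 be compared without ordinals. The type [shp]
    serves both for exponent vectors, in any order, and for diagrams, which are its [dominant]
    elements. *)
Definition ent e (i : nat) : nat := oapp (fun j => e j : nat) 0 (insub i).

Lemma entE e (i : 'I_n) : ent e i = e i.
Proof. by rewrite /ent valK. Qed.

Lemma ent_ge e i : n <= i -> ent e i = 0.
Proof. by move=> h; rewrite /ent insubN // -leqNgt. Qed.

Lemma ent_le e i : ent e i <= D.
Proof. by rewrite /ent; case: insubP => //= j _ _; rewrite -ltnS. Qed.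

Lemma shp_ext e e' : (forall i, i < n -> ent e i = ent e' i) -> e = e'.
Proof.
by move=> h; apply/ffunP => i; apply: val_inj; rewrite /= -!entE; apply: h.
Qed.

Definition mkshp (f : nat -> nat) : shp n D := [ffun i : 'I_n => inord (f i)].

Lemma ent_mkshp f i : f i <= D -> i < n -> ent (mkshp f) i = f i.
Proof.
by move=> fi lt; rewrite -[i]/(val (Ordinal lt)) entE ffunE inordK.
Qed.

Definition weigh e : nat := \sum_(i < n) ent e i.

Definition tovec e : vec n := [ffun i => Posz (e i)].

Lemma tovecE e (i : 'I_n) : tovec e i = ent e i.
Proof. by rewrite ffunE entE. Qed.

Lemma tovec_inj : injective tovec.
Proof. by move=> e e' /ffunP h; apply/ffunP => i; apply/val_inj; case: (h i); rewrite !ffunE => -[]. Qed.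

Definition dominant e := [forall i : 'I_n, ent e i.+1 <= ent e i].

Lemma dominantP e : reflect (forall i, ent e i.+1 <= ent e i) (dominant e).
Proof.
apply: (iffP forallP) => h i; last exact: h.
by have [lt|ge] := ltnP i n; [exact: (h (Ordinal lt))|rewrite !ent_ge // leqW].
Qed.

Lemma dominant_le e i j : dominant e -> i <= j -> ent e j <= ent e i.
Proof.
move=> /dominantP de ij; rewrite -(subnKC ij); elim: (j - i) => [|k IH].
  by rewrite addn0.
by rewrite addnS (leq_trans (de _)).
Qed.

Lemma dominant_strict e : dominant e -> strict_dec (tovec e + @delta n)%R.
Proof.
move=> de i j ij; rewrite !ffunE -!entE.
have := dominant_le de (ltnW ij); have := ltn_ord i; have := ltn_ord j; lia.
Qed.

(* Removing the strip leaves [ka]: a horizontal strip for an even letter, a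
   vertical one for an odd letter. *)
Definition strip (odd : bool) (la ka : shp n D) : bool :=
  [forall i : 'I_n, (ent ka i <= ent la i) &&
     (if odd then (ent la i <= (ent ka i).+1) && (ent ka i.+1 <= ent ka i)
      else ent la i.+1 <= ent ka i)].

Lemma stripP odd la ka :
  reflect (forall i, (ent ka i <= ent la i) &&
     (if odd then (ent la i <= (ent ka i).+1) && (ent ka i.+1 <= ent ka i)
      else ent la i.+1 <= ent ka i)) (strip odd la ka).
Proof.
apply: (iffP forallP) => h i; last exact: h.
have [lt|ge] := ltnP i n; first exact: (h (Ordinal lt)).
by rewrite !ent_ge ?(leqW ge) //; case: odd {h}.
Qed.

Lemma strip_dominant odd la ka : dominant la -> strip odd la ka -> dominant ka.
Proof.
move=> /dominantP dl /stripP h; apply/dominantP => i.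
have := h i; have := h i.+1; case: odd {h} => /andP[h1 h2] /andP[h3 h4].
  by case/andP: h4.
exact: leq_trans h1 h4.
Qed.

Lemma strip_weigh odd la ka : strip odd la ka -> weigh ka <= weigh la.
Proof. by move=> /stripP h; apply: leq_sum => i _; case/andP: (h i). Qed.

(** A horizontal strip has at most one cell per column: row i+1 of la fits into row i of ka, which
    leaves only the top row of la, of length at most D. *)
Lemma hstrip_le la ka : strip false la ka -> weigh la <= weigh ka + D.
Proof.
move=> /stripP h; have -> : weigh la = \sum_(0 <= i < n) ent la i by rewrite big_mkord.
case: (posnP n) => [n0|n0]; first by rewrite big_geq ?n0.
rewrite big_ltn // addnC leq_add ?ent_le //.
rewrite [X in _ <= X](_ : _ = \sum_(0 <= i < n) ent ka i); last by rewrite big_mkord.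
rewrite -{2}(prednK n0) big_nat_recr //= -{1}(prednK n0) big_add1 /=.
rewrite (leq_trans _ (leq_addr _ _)) //; apply: leq_sum => i _.
by case/andP: (h i).
Qed.

End Shapes.

Definition letter : Type := (bool * bool * nat)%type.

Definition sgv n (neg : bool) (v : vec n) : vec n := if neg then (- v)%R else v.

Section Operators.
Variables D n : nat.
Implicit Types (g : vec n) (F : vec n -> int) (l : letter) (w : seq letter).

(** The exponents of the monomials of h_k, or of e_k when [odd]. Entries stop at D, so the
    hypothesis k <= D of the Pieri rule guarantees that no monomial is missing. *)
Definition incr (odd : bool) (k : nat) (e : shp n D) : bool :=
  (weigh e == k) && (odd ==> [forall i, e i <= 1]).

(* The letter [(neg, odd, k)] stands for multiplication of Laurent series in n
   variables by h_k or e_k, at the inverted variables when [neg]. *)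
Definition xop l F g : int :=
  (\sum_(e : shp n D | incr l.1.2 l.2 e) F (g - sgv l.1.1 (tovec e)))%R.

Definition Xop w F : vec n -> int := foldr xop F w.
#[local] Arguments Xop : simpl never.

Lemma Xop_cons l w F : Xop (l :: w) F = xop l (Xop w F).
Proof. by []. Qed.

Lemma Xop_cat w w' F : Xop (w ++ w') F = Xop w (Xop w' F).
Proof. by rewrite /Xop foldr_cat. Qed.

Lemma Xop_ind (P : (vec n -> int) -> Prop) w F :
  (forall l F', l \in w -> P F' -> P (xop l F')) -> P F -> P (Xop w F).
Proof.
move=> h PF; elim: w h => // l w IH h; rewrite Xop_cons.
apply: (h l); first exact: mem_head.
by apply: IH => l1 F1 lw; apply: h; rewrite inE lw orbT.
Qed.

Lemma xop_perm l F s g :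
  xop l F (pact s g) = xop l (fun g' => F (pact s g')) g.
Proof.
rewrite /xop; pose h (t : {perm 'I_n}) (e : shp n D) : shp n D := [ffun i => e (t i)].
rewrite [LHS](reindex_onto (h s) (h s^-1%g)); last first.
  by move=> e _; apply/ffunP => i; rewrite !ffunE permK.
apply: eq_big => [e|e _].
  have -> : h s^-1%g (h s e) == e.
    by apply/eqP/ffunP => i; rewrite !ffunE permKV.
  rewrite andbT /incr; congr (_ && (_ ==> _)).
    rewrite /weigh; congr (_ == _); rewrite [RHS](reindex_inj (@perm_inj _ s)).
    by apply: eq_bigr => i _; rewrite !entE ffunE.
  apply/forallP/forallP => H i; last by rewrite ffunE.
  by have := H (s^-1%g i); rewrite ffunE permKV.
congr F; apply/ffunP => i; rewrite /sgv; case: l.1.1; by rewrite !ffunE.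
Qed.

Lemma Xop_perm w F s g :
  Xop w F (pact s g) = Xop w (fun g' => F (pact s g')) g.
Proof.
elim: w g => // l w IH g; rewrite !Xop_cons; rewrite xop_perm.
by apply: eq_bigr => e _; rewrite IH.
Qed.

Lemma Xop_ext w F F' : F =1 F' -> Xop w F =1 Xop w F'.
Proof. by move=> e; elim: w => // l w IH g; rewrite !Xop_cons; apply: eq_bigr => x _; apply: IH. Qed.

Lemma Xop_lin (I : Type) (r : seq I) (c : I -> int) (Fs : I -> vec n -> int) w g :
  Xop w (fun g' => \sum_(i <- r) c i * Fs i g')%R g =
  (\sum_(i <- r) c i * Xop w (Fs i) g)%R.
Proof.
elim: w g => // l w IH g; rewrite !Xop_cons {1}/xop.
under eq_bigr => e _ do rewrite IH.
by rewrite exchange_big /=; apply: eq_bigr => i _; rewrite mulr_sumr.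
Qed.

Lemma Xop_scale c w F g : Xop w (fun g' => c * F g')%R g = (c * Xop w F g)%R.
Proof.
have := Xop_lin [:: tt] (fun=> c) (fun=> F) w g; rewrite big_seq1 => <-.
by apply: Xop_ext => g'; rewrite big_seq1.
Qed.

Lemma Xop_shift w F a g : Xop w (fun g' => F (g' - a)%R) g = Xop w F (g - a)%R.
Proof.
elim: w g => // l w IH g; rewrite !Xop_cons; apply: eq_bigr => e _; rewrite IH; congr Xop.
by rewrite addrAC.
Qed.

Lemma Xop_antisym w F : antisymmetric_fun F -> antisymmetric_fun (Xop w F).
Proof.
move=> aF s g; rewrite Xop_perm -Xop_scale; apply: Xop_ext => g'.
exact: aF.
Qed.

Lemma Xop_sym w F : symmetric_fun F -> symmetric_fun (Xop w F).
Proof.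
move=> sF s g; rewrite Xop_perm; apply: Xop_ext => g'; exact: sF.
Qed.

Lemma xopC l l' F g : xop l (xop l' F) g = xop l' (xop l F) g.
Proof.
rewrite /xop exchange_big; apply: eq_bigr => e _; apply: eq_bigr => e' _.
by rewrite addrAC.
Qed.

Lemma Xop_perm_eq w w' F : perm_eq w w' -> Xop w F =1 Xop w' F.
Proof.
have cons1 : forall l w1 w2 g, Xop (w1 ++ l :: w2) F g = Xop (l :: w1 ++ w2) F g.
  move=> l; elim=> // l' w1 IH w2 g; rewrite /= Xop_cons [RHS]xopC.
  by apply: eq_bigr => e _; rewrite IH.
elim: w w' => [|l w IH] w' h g; first by move: h; rewrite perm_sym => /perm_nilP ->.
have lw : l \in w' by rewrite -(perm_mem h) mem_head.
case/splitPr: lw h => w1 w2 h; rewrite cons1 !Xop_cons.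
have /IH e : perm_eq w (w1 ++ w2).
  by rewrite -(perm_cons l) (permPl h) (perm_catCA w1 [:: l] w2).
by apply: eq_bigr => x _; rewrite e.
Qed.

Definition flip l : letter := (~~ l.1.1, l.1.2, l.2).

Lemma Xop_flip w F g :
  Xop (map flip w) (fun g' => F (- g')%R) g = Xop w F (- g)%R.
Proof.
elim: w g => // -[[neg o] k] w IH g; rewrite /= !Xop_cons; apply: eq_bigr => e _; rewrite IH.
congr Xop; rewrite /= /sgv; case: neg => /=; rewrite opprD ?opprK //.
Qed.

(** Applied to the constant 1, the operators leave the coefficients of the Laurent polynomial that w
    encodes. *)
Definition kernel w : vec n -> int := Xop w (dirac 0%R).

Lemma kernel_shift w a g : Xop w (dirac a) g = kernel w (g - a)%R.
Proof.
rewrite /kernel -Xop_shift; apply: Xop_ext => g'.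
by rewrite /dirac subr_eq0.
Qed.

Lemma kernel_sym w : symmetric_fun (kernel w).
Proof.
apply: Xop_sym => s g; rewrite /dirac; congr (nat_of_bool _)%:R%R.
rewrite -[X in pact s g == X](_ : pact s 0%R = 0%R) ?(can_eq (pactK s)) //.
by apply/ffunP => i; rewrite !ffunE.
Qed.

Lemma kernel_flip w g : kernel (map flip w) g = kernel w (- g)%R.
Proof.
rewrite /kernel -Xop_flip; apply: Xop_ext => g'; rewrite /dirac.
by rewrite eqr_oppLR oppr0.
Qed.

(** By linearity the signed sum moves onto the starting function, where it becomes an alternant. *)
Lemma bracket_kernel w la mu :
  bracket (kernel w) la mu = Xop w (alternant (mu + @delta n)%R) (la + @delta n)%R.
Proof.
rewrite /alternant Xop_lin; apply: eq_bigr => s _.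
by rewrite kernel_shift.
Qed.

Lemma bracket_flip w la mu :
  bracket (kernel (map flip w)) la mu = bracket (kernel w) mu la.
Proof.
rewrite bracket_adj; last exact: kernel_sym.
by apply: eq_bigr => s _; rewrite kernel_flip opprK.
Qed.

(** A lower bound on all exponents. With c = 0 it kills the terms of the Pieri rule that remove too
    much from the bottom row. *)
Definition vanish_below (c : int) F := forall g i, (g i < c)%R -> F g = 0%R.

Lemma xop_vanish_pos o k F c : vanish_below c F -> vanish_below c (xop (false, o, k) F).
Proof.
move=> vF g i gi; apply: big1 => e _; apply: (vF _ i); rewrite !ffunE /=; lia.
Qed.

Lemma xop_vanish_neg o k F c :
  vanish_below c F -> vanish_below (c - Posz k)%R (xop (true, o, k) F).
Proof.
move=> vF g i gi; apply: big1 => e /andP[/eqP /= we _]; apply: (vF _ i).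
rewrite !ffunE /= opprK -entE.
have : ent e i <= weigh e by rewrite /weigh (bigD1 i) //= leq_addr.
by rewrite we; lia.
Qed.

End Operators.

Lemma find_iota (p : pred nat) n i :
  i < n -> p i -> (forall j, j < i -> ~~ p j) -> find p (iota 0 n) = i.
Proof.
move=> lt pi h.
have hasp : has p (iota 0 n) by apply/hasP; exists i; rewrite // mem_iota.
have fn : find p (iota 0 n) < n by rewrite has_find size_iota in hasp.
have := nth_find 0 hasp; rewrite nth_iota // add0n => pf.
case: (ltngtP (find p (iota 0 n)) i) => // [/h|lt']; first by rewrite pf.
by have := before_find 0 lt'; rewrite nth_iota ?add0n ?pi.
Qed.

Lemma find_iotaP (p : pred nat) n : (exists2 i, i < n & p i) ->
  let i := find p (iota 0 n) in [/\ i < n, p i & forall j, j < i -> ~~ p j].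
Proof.
case=> i0 lt0 p0 i.
have hasp : has p (iota 0 n) by apply/hasP; exists i0; rewrite // mem_iota.
have fn : i < n by rewrite has_find size_iota in hasp.
split=> //; first by have := nth_find 0 hasp; rewrite nth_iota // add0n.
move=> j ji; have := before_find 0 ji.
by rewrite nth_iota ?add0n => [->//|]; apply: ltn_trans fn.
Qed.

Lemma sum_swap2 n i (f h : nat -> nat) : i.+1 < n ->
    (forall j, j != i -> j != i.+1 -> f j = h j) -> f i + f i.+1 = h i + h i.+1 ->
  \sum_(j < n) f j = \sum_(j < n) h j.
Proof.
move=> lt e1 e2.
have eq a : \sum_(j < n) (a : nat -> nat) j = a i + a i.+1 +
    \sum_(j < n | (j != i :> nat) && (j != i.+1 :> nat)) a j.
  rewrite (bigD1 (Ordinal (ltnW lt))) //= (bigD1 (Ordinal lt)) /=; last first.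
    by rewrite -val_eqE /=; lia.
  by rewrite addnA.
rewrite !eq e2; congr (_ + _); apply: eq_bigr => j /andP[]; exact: e1.
Qed.

Section Pieri.
Variables n D : nat.
Implicit Types (e la ka mu : shp n D) (F : vec n -> int).

Lemma vecE la e (i : 'I_n) :
  (tovec la + @delta n - tovec e)%R i = (Posz (ent la i + (n - i.+1)) - Posz (ent e i))%R.
Proof. by rewrite !ffunE -!entE PoszD. Qed.

(** Row i of la - e is shorter than row i+1 of la, so e is not the size vector of a horizontal
    strip. The condition involves e only through its i-th entry. *)
Definition crossing la e i := (i.+1 < n) && (ent la i < ent la i.+1 + ent e i).

(** Here [gap] is the difference of the entries i and i+1 of la + delta; the two new entries are
    those for which la + delta - e has these positions exchanged. *)
Definition uncross la e : shp n D :=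
  let i := find (crossing la e) (iota 0 n) in
  let gap := (ent la i - ent la i.+1).+1 in
  mkshp n D (fun j => if j == i then gap + ent e i.+1
                      else if j == i.+1 then ent e i - gap else ent e j).

(* The crossing terms cancel in pairs: at the first crossing, exchange the
   entries in positions i and i+1 of la + delta - e. *)
Lemma crossing_sum0 k F la : antisymmetric_fun F -> dominant la -> k <= D ->
  (\sum_(e | (weigh e == k) && [exists i : 'I_n, crossing la e i])
     F (tovec la + @delta n - tovec e) = 0)%R.
Proof.
move=> aF /dominantP dla kD.
have key e : (weigh e == k) && [exists i : 'I_n, crossing la e i] ->
  let i := find (crossing la e) (iota 0 n) in
  let gap := (ent la i - ent la i.+1).+1 in
  [/\ i.+1 < n, gap <= ent e i, weigh (uncross la e) = k,
      forall j, ent (uncross la e) j =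
        if j == i then gap + ent e i.+1 else if j == i.+1 then ent e i - gap else ent e j
    & find (crossing la (uncross la e)) (iota 0 n) = i].
  case/andP=> /eqP we /existsP[i0 ci0] i gap.
  have [] := @find_iotaP (crossing la e) n; first by exists i0.
  rewrite -/i => iltn /andP[i1 ci] before; have di := dla i.
  have le : gap <= ent e i by rewrite /gap; lia.
  (* The larger new entry is at most this sum, so k <= D keeps [uncross] inside the box. *)
  have le2 : ent e i + ent e i.+1 <= k.
    rewrite -we /weigh (bigD1 (Ordinal iltn)) //= leq_add2l.
    by rewrite (bigD1 (Ordinal i1)) ?leq_addr //= -val_eqE /=; lia.
  have E j : ent (uncross la e) j =
      if j == i then gap + ent e i.+1 else if j == i.+1 then ent e i - gap else ent e j.
    have [jn|nj] := ltnP j n; last first.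
      by rewrite !(ent_ge _ nj) !ifF //; apply/negP => /eqP; lia.
    rewrite ent_mkshp -/i -/gap //; have := ent_le e j.
    by case: eqP => [_|_]; [lia|case: eqP => [_|_]; lia].
  split=> //.
    rewrite -we; apply: (@sum_swap2 n i) => //.
      by move=> j /negPf ji /negPf j1; rewrite E ji j1.
    rewrite !E !eqxx; case: eqP; lia.
  (* The new i-th entry is at least [gap], so the crossing at i persists, and the entries before i
     have not changed. *)
  apply: find_iota => // [|j ji].
    by rewrite /crossing i1 E eqxx /=; lia.
  have := before j ji; rewrite /crossing E.
  by case: eqP; [lia|move=> _; case: eqP; [lia|]].
have unc e : (weigh e == k) && [exists i : 'I_n, crossing la e i] ->
    (weigh (uncross la e) == k) && [exists i : 'I_n, crossing la (uncross la e) i].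
  move=> /key; set i := find _ _ => -[i1 gl wk E fE].
  rewrite wk eqxx /=; apply/existsP; exists (Ordinal (ltnW i1)).
  by rewrite /crossing i1 /= E eqxx; have := dla i; lia.
apply: (sum_sign_reversing (phi := uncross la)) => e Pe; have [i1 gl wk E fE] := key e Pe.
- exact: unc.
- apply: shp_ext => j jn.
  have [_ _ _ E' _] := key _ (unc e Pe); rewrite E' fE !E !eqxx.
  case: eqP => [->|_]; first by case: eqP; lia.
  by case: eqP => [->|_] //; lia.
- set i := find (crossing la e) (iota 0 n) in i1 gl E fE.
  pose oi := Ordinal (ltnW i1); pose oj := Ordinal i1.
  have ij : oi != oj by rewrite -val_eqE /=; lia.
  have := aF (tperm oi oj) (tovec la + @delta n - tovec e)%R.
  rewrite odd_tperm ij expr1 mulN1r => <-; congr F; apply/ffunP => x.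
  rewrite [RHS]ffunE !vecE E; have := dla i.
  case: tpermP => [->|->|]; rewrite /= ?eqxx; [lia|case: eqP; lia|].
  move=> /eqP; rewrite -val_eqE /= => /negPf ->.
  by move=> /eqP; rewrite -val_eqE /= => /negPf ->.
Qed.

(** Removals e that do not leave a strip contribute nothing. For e_k a failure makes two adjacent
    coordinates equal or the last one negative; for h_k the crossing terms cancel in pairs and the
    others have a negative last coordinate. *)
Lemma pieri_step o k F la :
    antisymmetric_fun F -> vanish_below 0 F -> dominant la -> k <= D ->
  xop D (false, o, k) F (tovec la + @delta n)%R =
  (\sum_(ka | strip o la ka && (weigh ka + k == weigh la)%N) F (tovec ka + @delta n))%R.
Proof.
move=> aF vF dla kD; have dlaP := dominantP _ dla.
pose sub (e : shp n D) := mkshp n D (fun i => ent la i - ent e i).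
have subE e i : ent (sub e) i = ent la i - ent e i.
  have [lt|ge] := ltnP i n; last by rewrite !ent_ge.
  by rewrite ent_mkshp // (leq_trans (leq_subr _ _)) ?ent_le.
have subK e : (forall i, ent e i <= ent la i) -> sub (sub e) = e.
  by move=> h; apply: shp_ext => i _; rewrite !subE subKn.
pose good e := [forall i : 'I_n, ent e i <= ent la i] && strip o la (sub e).
have goodle e : good e -> forall i, ent e i <= ent la i.
  rewrite /good => /andP[/forallP h _] i; have [lt|ge] := ltnP i n; last by rewrite !ent_ge.
  exact: (h (Ordinal lt)).
have wsub e : (forall i, ent e i <= ent la i) -> weigh (sub e) + weigh e = weigh la.
  by move=> h; rewrite /weigh -big_split /=; apply: eq_bigr => i _; rewrite subE subnK.
rewrite /xop /= (bigID good) /= [X in (_ + X)%R](_ : _ = 0%R) ?addr0; last first.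
  (* In the last row delta is 0, so removing more than la has there gives a negative exponent. *)
  have last_neg e i : i.+1 = n -> ent la i < ent e i ->
      F (tovec la + @delta n - tovec e)%R = 0%R.
    move=> iN lt; have ii : i < n by rewrite -iN.
    by apply: (vF _ (Ordinal ii)); rewrite vecE /= iN subnn; lia.
  case: o @good goodle => good goodle.
    apply: big1 => e; rewrite /incr /= => /andP[/andP[we /forallP e1] ngood].
    have e1' i : ent e i <= 1.
      by have [lt|ge] := ltnP i n; [have := e1 (Ordinal lt); rewrite -entE|rewrite ent_ge].
    have [/existsP[i /andP[i1 ci]]|none] := boolP [exists i : 'I_n,
        (i.+1 < n) && (ent la i + ent e i.+1 < ent la i.+1 + ent e i)].
      (* As e has entries 0 and 1, the failure forces equal rows i and i+1 of la, with a cell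
         removed only from row i; the step of delta then makes the two coordinates equal. *)
      apply: (@antisym_eq0 _ _ _ i (Ordinal i1) aF); first by rewrite -val_eqE /=; lia.
      by rewrite !vecE /=; have := e1' i; have := dlaP i; lia.
    have none' i : i.+1 < n -> ent la i.+1 + ent e i <= ent la i + ent e i.+1.
      move=> i1; move: none; rewrite negb_exists => /forallP/(_ (Ordinal (ltnW i1))).
      by rewrite /= i1 /= -leqNgt.
    have [n0|n0] := posnP n.
      by case/negP: ngood; apply/andP; split; apply/forallP => -[i lti]; exfalso; lia.
    have nn : n.-1.+1 = n by lia.
    have [lt|le] := ltnP (ent la n.-1) (ent e n.-1); first exact: (last_neg e n.-1).
    (* From the last row upwards: if e exceeded la in row i, row i+1 would inherit the excess. *)
    have els d : forall i, i + d = n.-1 -> ent e i <= ent la i.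
      elim: d => [|d IH] i id; first by rewrite -(addn0 i) id.
      have := IH i.+1; rewrite addSnnS => /(_ id).
      have := none' i; have := e1' i; have := e1' i.+1; have := dlaP i; lia.
    have el i : ent e i <= ent la i.
      have [lt|ge] := ltnP i n; last by rewrite !ent_ge.
      by apply: (els (n.-1 - i)); lia.
    case/negP: ngood; rewrite /good; apply/andP; split; first by apply/forallP.
    apply/stripP => i; rewrite !subE leq_subr /=; have := e1' i; have := el i.
    have [lt|ge] := ltnP i.+1 n; first by have := none' i lt; have := el i.+1; lia.
    by rewrite (ent_ge e ge) (ent_ge la ge); lia.
  rewrite (bigID (fun e => [exists i : 'I_n, crossing la e i])) /=.
  rewrite [X in (_ + X)%R](_ : _ = 0%R) ?addr0; last first.
    apply: big1 => e /andP[/andP[we ngood]]; rewrite negb_exists => /forallP nc.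
    have nc' i : i.+1 < n -> ent la i.+1 + ent e i <= ent la i.
      by move=> i1; have := nc (Ordinal (ltnW i1)); rewrite /crossing i1 /= -leqNgt.
    have [/existsP[i lt]|] := boolP [exists i : 'I_n, ent la i < ent e i].
      have := ltn_ord i; rewrite leq_eqVlt => /orP[/eqP iN|/nc'].
        exact: (last_neg e i).
      by have := lt; lia.
    rewrite negb_exists => /forallP el; case/negP: ngood.
    have el' i : ent e i <= ent la i.
      have [ltn|ge] := ltnP i n; last by rewrite !ent_ge.
      by have := el (Ordinal ltn); rewrite -leqNgt.
    rewrite /good; apply/andP; split; first by apply/forallP.
    apply/stripP => i; rewrite !subE leq_subr /=; have := el' i.
    have [lt|ge] := ltnP i.+1 n; first by have := nc' i lt; lia.
    by rewrite (ent_ge la ge).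
  rewrite -[RHS](@crossing_sum0 k F la aF dla kD); apply: eq_bigl => e.
  rewrite /incr /= andbT -andbA; congr (_ && _); apply/andP/idP => [[]//|ex]; split=> //.
  apply/negP => gd; case/existsP: ex => i /andP[i1 ci].
  move: (gd); rewrite /good => /andP[_ /stripP/(_ i)/andP[_]]; rewrite subE.
  by have := goodle e gd i; lia.
(* On vectors below la the map e -> la - e is an involution, so the sum can run over what
   remains. *)
rewrite (reindex_onto sub sub) /=; last by move=> e /andP[_ /goodle]; apply: subK.
apply: eq_big => [ka|ka].
  apply/idP/idP => [/andP[/andP[/andP[/eqP we _] gd] /eqP <-]|/andP[st /eqP we]].
    have le := goodle _ gd; move: gd; rewrite /good => /andP[_ ->].
    by move: we => /= <-; rewrite wsub ?eqxx.
  have le i : ent ka i <= ent la i by case/andP: (stripP _ _ _ st i).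
  rewrite subK // eqxx andbT /good subK // st andbT; apply/andP; split; last first.
    by apply/forallP => i; rewrite subE leq_subr.
  rewrite /incr -(eqn_add2l (weigh ka)) we addnC wsub // eqxx /=; apply/implyP => o1.
  apply/forallP => i; rewrite -entE subE; move/stripP: st => /(_ i).
  by rewrite o1; lia.
case/andP=> _ /eqP sk; congr F; apply/ffunP => i; rewrite vecE !ffunE -!entE.
have : ent ka i <= ent la i by rewrite -sk subE leq_subr.
by rewrite subE; lia.
Qed.

Fixpoint chains (w : seq (bool * nat)) (F : shp n D -> int) la : int :=
  if w is l :: w' then
    (\sum_(ka | strip l.1 la ka && (weigh ka + l.2 == weigh la)%N) chains w' F ka)%R
  else F la.

Definition poslet (w : seq (bool * nat)) : seq letter :=
  [seq (false, l.1, l.2) | l <- w].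

Lemma pieri w F la :
    antisymmetric_fun F -> vanish_below 0 F -> dominant la ->
    all (fun l => l.2 <= D) w ->
  Xop D (poslet w) F (tovec la + @delta n)%R =
  chains w (fun ka => F (tovec ka + @delta n)%R) la.
Proof.
move=> aF vF; elim: w la => //= -[o k] w IH la dla /andP[kD wD].
rewrite -[LHS]/(xop D _ (Xop D (poslet w) F) _) pieri_step //.
- by apply: eq_bigr => ka /andP[st _]; apply: IH => //; apply: strip_dominant st.
- exact: Xop_antisym.
- apply: (Xop_ind _ vF) => -[[neg o'] k'] F' /mapP[x _ [-> _ _]].
  exact: xop_vanish_pos.
Qed.

Lemma chains_ext w (F F' : shp n D -> int) la : dominant la ->
  (forall ka, dominant ka -> F ka = F' ka) -> chains w F la = chains w F' la.
Proof.
move=> dla h; elim: w la dla => [|l w IH] la dla /=; first exact: h.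
by apply: eq_bigr => ka /andP[st _]; apply: IH; apply: strip_dominant st.
Qed.

Lemma chains_lin (I : Type) (r : seq I) (c : I -> int) (Fs : I -> shp n D -> int) w la :
  chains w (fun ka => \sum_(i <- r) c i * Fs i ka)%R la =
  (\sum_(i <- r) c i * chains w (Fs i) la)%R.
Proof.
elim: w la => //= l w IH la; under eq_bigr => e _ do rewrite IH.
by rewrite exchange_big /=; apply: eq_bigr => i _; rewrite mulr_sumr.
Qed.

Lemma chains_cat w w' (F : shp n D -> int) la : chains (w ++ w') F la = chains w (chains w' F) la.
Proof. by elim: w la => //= l w IH la; apply: eq_bigr => ka _; apply: IH. Qed.

Definition single mu ka : int := (ka == mu)%:R%R.

Lemma alternant_shp mu ka : dominant mu -> dominant ka ->
  alternant (tovec mu + @delta n)%R (tovec ka + @delta n)%R = single mu ka.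
Proof.
move=> dm dk; rewrite alternant_dec; try exact: dominant_strict.
rewrite /single; congr (nat_of_bool _)%:R%R; apply/eqP/eqP => [/addIr/tovec_inj|->//].
by [].
Qed.

Lemma alternant_vanish mu : vanish_below 0 (alternant (tovec mu + @delta n)%R).
Proof.
move=> g i gi; apply: big1 => s _; case: eqP => [e|_]; last by rewrite mulr0.
by move: gi; rewrite e !ffunE.
Qed.

(** On dominant shapes the alternant of mu + delta is the indicator of mu, so the iterated Pieri
    rule counts the chains of strips from la down to mu. *)
Lemma chains_bracket w la mu : dominant la -> dominant mu ->
    all (fun l => l.2 <= D) w ->
  bracket (kernel D (poslet w)) (tovec la) (tovec mu) = chains w (single mu) la.
Proof.
move=> dla dmu wD; rewrite bracket_kernel pieri //.
- by apply: chains_ext => // ka dka; apply: alternant_shp.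
- exact: alternant_antisym.
- exact: alternant_vanish.
Qed.

End Pieri.

Definition psum (f : nat -> nat) (i : nat) : nat := \sum_(j < i) f j.

Lemma psumS f i : psum f i.+1 = psum f i + f i.
Proof. by rewrite /psum big_ord_recr. Qed.

Lemma psum_eq f h i : (forall j, j < i -> f j = h j) -> psum f i = psum h i.
Proof. by move=> e; apply: eq_bigr => j _; apply: e. Qed.

Lemma weighE n D (e : shp n D) : weigh e = psum (ent e) n.
Proof. by []. Qed.

(* [B], [X], [T] are three consecutive shapes of a chain of horizontal strips,
   adding first the letters k and then the letters k+1. *)
(** * The Littlewood-Richardson rule *)

Section Toggle.
Variables (B T : nat -> nat) (i : nat).
Implicit Types (X : nat -> nat).

(** In the row reading word, from right to left in each row, the letters k+1 of row j come before
    its letters k. The worst moment is just after them: the letters k+1 in rows up to j outnumber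
    the letters k in rows before j. The inequality says this without subtraction. *)
Definition is_bad X j := psum X j.+1 + psum X j < psum T j.+1 + psum B j.

Definition tog_lo j := maxn (T j.+1) (B j).

Definition tog_hi X j :=
  if j == i then T i - (psum X i + psum X i - psum B i - psum T i).+1
  else minn (T j) (B j.-1).

(* The Bender-Knuth involution on the part of the row reading word that follows
   the first violation of the lattice condition, which is in row i. *)
Definition tog X j := if j < i then X j else tog_lo j + tog_hi X j - X j.

Variable X : nat -> nat.
Hypothesis TX : forall j, (X j <= T j) && (T j.+1 <= X j).
Hypothesis XB : forall j, (B j <= X j) && (X j.+1 <= B j).
Hypothesis badi : is_bad X i.
Hypothesis goodlt : forall j, j < i -> ~~ is_bad X j.

(** Row i-1 is good and its letters k are read after its letters k+1, so when row i begins the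
    surplus of k is at least the number of letters k in row i-1. This is what keeps [tog_hi] within
    row i-1 of B, so that toggling preserves horizontal strips. *)
Let psum_le : psum B i + psum T i + (if i == 0 then 0 else X i.-1 - B i.-1) <= psum X i + psum X i.
Proof.
case: eqP => [->|/eqP i0]; first by rewrite /psum !big_ord0.
have := goodlt (j := i.-1); rewrite ltn_predL lt0n => /(_ i0).
rewrite /is_bad -leqNgt prednK ?lt0n // => h.
have := psumS X i.-1; have := psumS B i.-1; rewrite prednK ?lt0n //.
by have := XB i.-1; lia.
Qed.

Let lo_le j : tog_lo j <= X j.
Proof. by have := XB j; have := TX j; rewrite /tog_lo; lia. Qed.

Let le_hi j : i <= j -> X j <= tog_hi X j.
Proof.
move=> ij; rewrite /tog_hi; case: eqP => [->|ne].
  by move: badi psum_le; rewrite /is_bad !psumS; case: eqP; lia.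
by have := TX j; have := XB j.-1; rewrite prednK; lia.
Qed.

Let hi_le j : i <= j -> (tog_hi X j <= T j) && ((0 < j) ==> (tog_hi X j <= B j.-1)).
Proof.
move=> ij; rewrite /tog_hi; case: eqP => [->|ne]; last by rewrite geq_minl geq_minr implybT.
rewrite leq_subr /=; apply/implyP => i0; have := psum_le; case: eqP => [|_]; first by lia.
by have := TX i.-1; rewrite prednK //; lia.
Qed.

Lemma tog_lt j : j < i -> tog X j = X j.
Proof. by rewrite /tog => ->. Qed.

Lemma tog_psum j : j <= i -> psum (tog X) j = psum X j.
Proof. by move=> ji; apply: psum_eq => x xj; rewrite tog_lt //; apply: leq_trans ji. Qed.

Lemma tog_between j : i <= j -> tog_lo j <= tog X j <= tog_hi X j.
Proof. by move=> ij; rewrite /tog ltnNge ij /=; have := lo_le j; have := le_hi ij; lia. Qed.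

Lemma tog_top j : (tog X j <= T j) && (T j.+1 <= tog X j).
Proof.
have [ji|ij] := ltnP j i; first by rewrite tog_lt.
by have := tog_between ij; have := hi_le ij; rewrite /tog_lo; lia.
Qed.

Lemma tog_bot j : (B j <= tog X j) && (tog X j.+1 <= B j).
Proof.
apply/andP; split.
  have [ji|ij] := ltnP j i; first by rewrite tog_lt //; case/andP: (XB j).
  by have := tog_between ij; rewrite /tog_lo; lia.
have [ji|ij] := ltnP j.+1 i; first by rewrite tog_lt //; case/andP: (XB j).
by have := tog_between ij; have := hi_le ij => /=; lia.
Qed.

Lemma tog_bad : is_bad (tog X) i.
Proof.
rewrite /is_bad !psumS tog_psum //; have := tog_between (leqnn i).
have := badi; rewrite /is_bad !psumS /tog_hi eqxx; move: psum_le; case: eqP; lia.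
Qed.

Lemma togK : tog (tog X) =1 X.
Proof.
move=> j; rewrite {1}/tog; case: ifP => ji; first by rewrite tog_lt.
have ij : i <= j by lia.
have -> : tog_hi (tog X) j = tog_hi X j by rewrite /tog_hi tog_psum.
by rewrite /tog ji; have := lo_le j; have := le_hi ij; lia.
Qed.

(** The new number of letters k is the old number of letters k+1 less the violating one. On content
    + delta this is the exchange of two adjacent entries. *)
Lemma tog_weight n : i < n -> T n = 0 ->
  psum (tog X) n + psum X n + 1 = psum T n + psum B n.
Proof.
(* Beyond row i each row contributes [tog_lo] + [tog_hi], and the sums telescope because the maximum
   in row j and the minimum in row j+1 add up to T (j+1) + B j. The two extra terms are the unpaired
   boundary. *)
move=> i_lt Tn; suff h N : i < N ->
    psum (tog X) N + psum X N + 1 + B N.-1 = psum T N + psum B N + tog_lo N.-1.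
  by have := h n i_lt; rewrite /tog_lo prednK ?(leq_trans _ i_lt) // Tn max0n; lia.
elim: N => // N IH; rewrite ltnS leq_eqVlt => /orP[/eqP <-|iN].
  rewrite !psumS tog_psum //= /tog ltnn /tog_hi eqxx.
  have := lo_le i; have := le_hi (leqnn i); rewrite /tog_hi eqxx.
  by move: badi psum_le; rewrite /is_bad !psumS; case: eqP; lia.
have := IH iN; rewrite !psumS /= [tog X N]/tog ltnNge (ltnW iN) /=.
have := le_hi (ltnW iN); have := lo_le N; rewrite /tog_hi gtn_eqF //.
have -> : tog_lo N.-1 = maxn (T N) (B N.-1) by rewrite /tog_lo prednK //; lia.
lia.
Qed.

End Toggle.

Section Layers.
Variables n D : nat.
Implicit Types (la ka mu : shp n D).

(* A chain of shapes below [la] = [layer la c r]; the cells of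
   [layer la c t.+1] outside [layer la c t] carry the letter t. *)
Definition layer r la (c : shps r n D) (t : nat) : shp n D :=
  oapp c la (insub t).

Definition chain_ok (o : nat -> bool) r la (c : shps r n D) : bool :=
  [forall t : 'I_r, strip (o t) (layer la c t.+1) (layer la c t)].

Definition content r la (c : shps r n D) : vec r :=
  [ffun t : 'I_r => Posz (weigh (layer la c t.+1)) - Posz (weigh (layer la c t))]%R.

Lemma layer_ord r la c (t : 'I_r) : layer la c t = c t.
Proof. by rewrite /layer valK. Qed.

Lemma layer_ge r la (c : shps r n D) t : r <= t -> layer la c t = la.
Proof. by move=> h; rewrite /layer insubN // -leqNgt. Qed.

Lemma chain_okP o r la (c : shps r n D) :
  reflect (forall t, t < r -> strip (o t) (layer la c t.+1) (layer la c t))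
          (chain_ok o la c).
Proof.
apply: (iffP forallP) => [h t lt|h t]; last exact: h.
exact: (h (Ordinal lt)).
Qed.

Lemma layer_dominant o r la (c : shps r n D) t :
  dominant la -> chain_ok o la c -> dominant (layer la c t).
Proof.
move=> dla /chain_okP ok.
have h d : forall t', r <= t' + d -> dominant (layer la c t').
  elim: d => [|d IH] t' le; first by rewrite layer_ge // -(addn0 t').
  have [lt|ge] := ltnP t' r; last by rewrite layer_ge.
  by apply: (strip_dominant _ (ok _ lt)); apply: IH; rewrite addSnnS.
by apply: (h r); rewrite leq_addl.
Qed.

Lemma layer_le o r la (c : shps r n D) t u i :
  chain_ok o la c -> t <= u -> ent (layer la c t) i <= ent (layer la c u) i.
Proof.
move=> /chain_okP ok tu; rewrite -(subnKC tu); elim: (u - t) => [|k IH]; rewrite ?addn0 // addnS.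
apply: leq_trans IH _; have [lt|ge] := ltnP (t + k) r.
  by have /andP[] := stripP _ _ _ (ok _ lt) i.
by rewrite !layer_ge // leqW.
Qed.

(** [chains] peels strips from the outside, so the largest letter must come first; hence the
    reversal. *)
Definition word (o : nat -> bool) (a : nat -> nat) (r : nat) : seq (bool * nat) :=
  rev (mkseq (fun t => (o t, a t)) r).

Lemma wordS o a r : word o a r.+1 = (o r, a r) :: word o a r.
Proof. by rewrite /word mkseqS rev_rcons. Qed.

Lemma word_all o a r k : (forall t, t < r -> a t <= k) ->
  all (fun l => l.2 <= k) (word o a r).
Proof.
move=> h; rewrite /word all_rev; apply/allP => _ /mapP[t + ->] /=.
by rewrite mem_iota add0n; apply: h.
Qed.

Lemma chains_layers o a r (F : shp n D -> int) la :
  chains (word o a r) F la =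
  (\sum_(c : shps r n D | chain_ok o la c &&
      [forall t : 'I_r, (weigh (layer la c t) + a t == weigh (layer la c t.+1))%N])
     F (layer la c 0))%R.
Proof.
elim: r la => [|r IH] la.
  have u (c : shps 0 n D) : c = [ffun=> la] by apply/ffunP => -[].
  rewrite (bigD1 [ffun=> la]) /=; last first.
    by apply/andP; split; apply/forallP => -[].
  by rewrite layer_ge // big1 ?addr0 // => c; rewrite (u c) eqxx andbF.
rewrite wordS /=; under eq_bigr => ka _ do rewrite IH.
pose ext (x : shp n D * shps r n D) : shps r.+1 n D :=
  [ffun t : 'I_r.+1 => layer x.1 x.2 t].
pose res (c : shps r.+1 n D) : shp n D * shps r n D :=
  (c ord_max, [ffun t : 'I_r => c (widen_ord (leqnSn r) t)]).
have extK x : res (ext x) = x.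
  case: x => ka c; congr (_, _); first by rewrite ffunE /= layer_ge.
  by apply/ffunP => t; rewrite !ffunE /= layer_ord.
have resK c : ext (res c) = c.
  apply/ffunP => t; rewrite ffunE /=; have := ltn_ord t; rewrite ltnS leq_eqVlt.
  case/orP => [/eqP e|lt].
    by rewrite e layer_ge //; congr (c _); apply: val_inj.
  rewrite -[t : nat]/(val (Ordinal lt)) layer_ord ffunE.
  by congr (c _); apply: val_inj.
have layE x t : t <= r -> layer la (ext x) t = layer x.1 x.2 t.
  by rewrite -ltnS => lt; rewrite -[t]/(val (Ordinal lt)) layer_ord ffunE.
rewrite pair_big_dep /= (reindex ext) /=; last first.
  by exists res => x _; [exact: extK|exact: resK].
apply: eq_big => [x|x _]; last by rewrite layE.
have split_last (P : nat -> bool) : [forall t : 'I_r.+1, P t] = P r && [forall t : 'I_r, P t].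
  apply/forallP/andP => [h|[h /forallP h'] t].
    by split; [exact: (h ord_max)|apply/forallP => t; apply: (h (widen_ord (leqnSn r) t))].
  have := ltn_ord t; rewrite ltnS leq_eqVlt => /orP[/eqP ->//|lt].
  exact: (h' (Ordinal lt)).
rewrite /chain_ok (split_last (fun t => strip (o t) (layer la (ext x) t.+1) (layer la (ext x) t))).
rewrite (split_last (fun t => weigh (layer la (ext x) t) + a t == weigh (layer la (ext x) t.+1))).
rewrite [layer la _ r.+1]layer_ge // layE // layer_ge //.
rewrite [X in _ = _ && X && _](_ : _ = chain_ok o x.1 x.2); last first.
  by apply: eq_forallb => t; rewrite !layE // ltnW.
rewrite [X in _ = _ && (_ && X)](_ : _ = [forall t : 'I_r,
    weigh (layer x.1 x.2 t) + a t == weigh (layer x.1 x.2 t.+1)]).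
  by rewrite andbACA.
by apply: eq_forallb => t; rewrite !layE // ltnW.
Qed.

Definition horizontal (t : nat) := false.

(** The coefficient of x^al in the skew Schur function s_(la/mu) of r variables. It is defined on
    all integer vectors so that [hat] applies to it. *)
Definition kostka r la mu (al : vec r) : int :=
  (\sum_(c : shps r n D | chain_ok horizontal la c && (layer la c 0 == mu))
     (content la c == al)%:R)%R.

Lemma kostka_chains r la mu (a : nat -> nat) (al : vec r) :
    (forall t : 'I_r, al t = Posz (a t)) ->
  kostka la mu al = chains (word horizontal a r) (single mu) la.
Proof.
move=> ea; rewrite chains_layers /kostka big_mkcondr [RHS]big_mkcondr.
apply: eq_bigr => c _; rewrite /single.
have -> : (content la c == al) = [forall t : 'I_r, weigh (layer la c t) + a t == weigh (layer la c t.+1)].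
  apply/eqP/forallP => [/ffunP h t|h].
    by have := h t; rewrite ffunE ea; lia.
  by apply/ffunP => t; rewrite ffunE ea; have := h t; lia.
by case: eqP; case: [forall _, _].
Qed.

Lemma kostka_eq0 r la mu (al : vec r) t :
  ~~ ((0 <= al t)%R && (al t <= Posz D)%R) -> kostka la mu al = 0%R.
Proof.
move=> h; apply: big1 => c /andP[/chain_okP ok _]; case: eqP => // e; case/negP: h.
have st := ok t (ltn_ord t).
have := strip_weigh st; have := hstrip_le st.
by rewrite -e ffunE; lia.
Qed.

Lemma kostka_box r la mu (al : vec r) :
  kostka la mu al != 0%R -> exists e : shp r D, al = tovec e.
Proof.
move=> nz; have h t : (0 <= al t)%R && (al t <= Posz D)%R.
  by apply: contraT => /kostka_eq0 e; rewrite e eqxx in nz.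
exists [ffun t => inord `|al t|%N]; apply/ffunP => t.
by rewrite !ffunE inordK; move: (h t); case: (al t) => x; lia.
Qed.

(** Inside the box this number is the bracket of a product of functions h_k, and multiplications
    commute; a vector outside the box gives 0 on both sides. *)
Lemma kostka_perm r la mu : dominant la -> dominant mu ->
  symmetric_fun (@kostka r la mu).
Proof.
move=> dla dmu s al.
have [h|] := boolP [forall t, (0 <= al t)%R && (al t <= Posz D)%R]; last first.
  rewrite negb_forall => /existsP[t ht].
  rewrite [RHS](kostka_eq0 _ _ ht) (@kostka_eq0 _ _ _ _ (s^-1%g t)) //.
  by rewrite ffunE permKV.
pose a (be : vec r) (t : nat) := oapp (fun i => `|be i|%N) 0 (insub t).
have aE be (t : 'I_r) : a be t = `|be t|%N by rewrite /a valK.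
move/forallP: h => h.
rewrite [RHS](@kostka_chains r _ _ (a al)); last by move=> t; rewrite aE; move: (h t); case: (al t) => x; lia.
rewrite (@kostka_chains r _ _ (a (pact s al))); last first.
  by move=> t; rewrite aE ffunE; move: (h (s t)); case: (al (s t)) => x; lia.
have mkE be : word horizontal (a be) r = rev [seq (false, `|be i|%N) | i : 'I_r].
  rewrite /word /mkseq -val_enum_ord -map_comp; congr rev.
  by apply: eq_map => t /=; rewrite aE.
rewrite -!chains_bracket //; last 2 first.
- by apply: word_all => t lt; rewrite -[t]/(val (Ordinal lt)) aE; move: (h (Ordinal lt)); case: (al (Ordinal lt)) => x; lia.
- by apply: word_all => t lt; rewrite -[t]/(val (Ordinal lt)) aE ffunE; move: (h (s (Ordinal lt))); case: (al (s (Ordinal lt))) => x; lia.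
rewrite !bracket_kernel; apply: Xop_perm_eq; apply: perm_map; rewrite !mkE.
rewrite perm_rev perm_sym perm_rev perm_sym.
have -> : [seq (false, `|pact s al i|%N) | i : 'I_r] = [seq (false, `|al i|%N) | i <- map s (enum 'I_r)].
  by rewrite -map_comp; apply: eq_map => i /=; rewrite ffunE.
apply: perm_map; apply: uniq_perm; rewrite ?enum_uniq ?(map_inj_uniq perm_inj) ?enum_uniq //.
move=> i; rewrite mem_enum inE; apply/mapP; exists ((s^-1)%g i); rewrite ?mem_enum ?permKV //.
Qed.

End Layers.

Section LittlewoodRichardson.
Variables n D r : nat.
Implicit Types (la ka mu : shp n D) (c : shps r n D).

Definition violation la c (i k : nat) : bool :=
  (k.+1 < r) && is_bad (ent (layer la c k)) (ent (layer la c k.+2))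
                  (ent (layer la c k.+1)) i.

Definition lattice la c : bool :=
  [forall i : 'I_n, forall k : 'I_r, ~~ violation la c i k].

(** First in the row reading word: the topmost row and, within it, the largest letter k, since
    larger letters are read first. *)
Definition first_violation la c (x : 'I_n * 'I_r) : bool :=
  violation la c x.1 x.2 && [forall y : 'I_n * 'I_r,
    ((y.1 < x.1) || (y.1 == x.1) && (x.2 < y.2)) ==> ~~ violation la c y.1 y.2].

Definition toggle la c : shps r n D :=
  if [pick x | first_violation la c x] is Some x then
    [ffun t : 'I_r => if t == x.2.+1 :> nat then
       mkshp n D (tog (ent (layer la c x.2)) (ent (layer la c x.2.+2)) x.1
                      (ent (layer la c x.2.+1)))
     else c t]
  else c.

Lemma ex_first_violation la c : ~~ lattice la c -> exists x, first_violation la c x.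
Proof.
move=> nl; have [x0 vx0] : exists x : 'I_n * 'I_r, violation la c x.1 x.2.
  apply: contrapT => no; case/negP: nl; apply/forallP => i; apply/forallP => k.
  by apply/negP => v; apply: no; exists (i, k).
(* A number whose minimum selects the smallest row and, within that row, the largest letter. *)
pose m (x : 'I_n * 'I_r) := x.1 * r + (r - x.2).
case: (@arg_minnP _ x0 (fun x => violation la c x.1 x.2) m vx0) => -[i k] vx min.
exists (i, k); rewrite /first_violation vx /=.
apply/forallP => -[j l]; apply/implyP => /= yx.
apply/negP => v; have := min (j, l) v; rewrite leqNgt => /negP; apply; rewrite /m /=.
have := ltn_ord k; have := ltn_ord l.
case/orP: yx => [lt|/andP[/eqP -> lt]]; last by rewrite ltn_add2l; lia.
have : j.+1 * r <= i * r by rewrite leq_mul2r lt orbT.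
by rewrite mulSn; lia.
Qed.

Lemma first_violation_uniq la c x y :
  first_violation la c x -> first_violation la c y -> x = y.
Proof.
case/andP=> vx /forallP hx /andP[vy /forallP hy].
have := hx y; have := hy x; rewrite vx vy !implybF.
case: x y {hx hy vx vy} => [i k] [j l] /=; rewrite -!val_eqE /=.
case: (ltngtP i j) => //= /val_inj ->.
by case: (ltngtP k l) => //= /val_inj ->.
Qed.

Lemma toggleP la c (x : 'I_n * 'I_r) (B := ent (layer la c x.2)) (X := ent (layer la c x.2.+1))
    (T := ent (layer la c x.2.+2)) :
    chain_ok horizontal la c -> first_violation la c x ->
  [/\ x.2.+1 < r,
      forall t, t != x.2.+1 -> layer la (toggle la c) t = layer la c t,
      forall j, ent (layer la (toggle la c) x.2.+1) j = tog B T x.1 X j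
    & forall j, (ent (layer la (toggle la c) x.2.+1) j <= T j)].
Proof.
move=> ok fx; have [/andP[kr badx] /forallP fst] := andP fx.
have eX : [pick x | first_violation la c x] = Some x.
  by case: pickP => [y fy|/(_ x)]; [rewrite (first_violation_uniq fy fx)|rewrite fx].
have TX j : (X j <= T j) && (T j.+1 <= X j) by exact: (stripP _ _ _ (chain_okP _ _ _ ok _ kr) j).
have XB j : (B j <= X j) && (X j.+1 <= B j).
  by apply: (stripP _ _ _ (chain_okP _ _ _ ok x.2 _) j); exact: ltnW.
have gd j : j < x.1 -> ~~ is_bad B T X j.
  move=> jx; have jn : j < n by apply: ltn_trans jx (ltn_ord _).
  by have := fst (Ordinal jn, x.2); rewrite /= jx /violation kr.
have top j := tog_top TX XB badx gd j.
split=> // [t ne|j|j].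
- have [lt|ge] := ltnP t r; last by rewrite !layer_ge.
  by rewrite -[t]/(val (Ordinal lt)) !layer_ord /toggle eX ffunE (negPf ne).
- have -> : layer la (toggle la c) x.2.+1 = mkshp n D (tog B T x.1 X).
    by rewrite -[x.2.+1]/(val (Ordinal kr)) layer_ord /toggle eX ffunE eqxx.
  have [lt|ge] := ltnP j n.
    by have /andP[h _] := top j; rewrite ent_mkshp // (leq_trans h (ent_le _ _)).
  by rewrite ent_ge //; case/andP: (top j); rewrite /T ent_ge // leqn0 => /eqP.
- have -> : layer la (toggle la c) x.2.+1 = mkshp n D (tog B T x.1 X).
    by rewrite -[x.2.+1]/(val (Ordinal kr)) layer_ord /toggle eX ffunE eqxx.
  have [lt|ge] := ltnP j n; last by rewrite ent_ge.
  by have /andP[h _] := top j; rewrite ent_mkshp // (leq_trans h (ent_le _ _)).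
Qed.

(** [toggle] is an involution on the non-lattice chains: it keeps the position of the first
    violation and exchanges two entries of content + delta, which changes the sign of F. *)
Lemma not_lattice_sum0 (F : vec r -> int) la mu : antisymmetric_fun F ->
  (\sum_(c | [&& chain_ok horizontal la c, layer la c 0 == mu & ~~ lattice la c])
     F (content la c + @delta r) = 0)%R.
Proof.
move=> aF; pose P c := [&& chain_ok horizontal la c, layer la c 0 == mu & ~~ lattice la c].
have key c : P c -> exists x, [/\ first_violation la c x, P (toggle la c),
    first_violation la (toggle la c) x, toggle la (toggle la c) = c
    & F (content la (toggle la c) + @delta r)%R = (- F (content la c + @delta r))%R].
  case/and3P=> ok /eqP l0 /ex_first_violation[x fx]; exists x.
  have [kr other Xj _] := toggleP ok fx.
  have [/andP[_ badx] /forallP fst] := andP fx.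
  set B := ent (layer la c x.2) in Xj badx *.
  set T := ent (layer la c x.2.+2) in Xj badx *.
  set X := ent (layer la c x.2.+1) in Xj badx *.
  have TX j : (X j <= T j) && (T j.+1 <= X j) by exact: (stripP _ _ _ (chain_okP _ _ _ ok _ kr) j).
  have XB j : (B j <= X j) && (X j.+1 <= B j).
    by apply: (stripP _ _ _ (chain_okP _ _ _ ok x.2 _) j); exact: ltnW.
  have gd j : j < x.1 -> ~~ is_bad B T X j.
    move=> jx; have jn : j < n by apply: ltn_trans jx (ltn_ord _).
    by have := fst (Ordinal jn, x.2); rewrite /= jx /violation kr.
  have Tn : T n = 0 by rewrite /T ent_ge.
  have kk : x.2.+2 != x.2.+1 by rewrite neq_ltn ltnSn orbT.
  have kk' : x.2 != x.2.+1 :> nat by rewrite neq_ltn ltnSn.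
  have ok' : chain_ok horizontal la (toggle la c).
    apply/chain_okP => t tr; apply/stripP => j; rewrite /horizontal.
    have [e|ne] := eqVneq t x.2.+1.
      by rewrite e (other x.2.+2) // !Xj; exact: (tog_top TX XB badx gd).
    have [e|ne'] := eqVneq t (nat_of_ord x.2).
      by rewrite e (other x.2) // !Xj; exact: (tog_bot TX XB badx gd).
    rewrite (other t) // (other t.+1); last by apply: contra ne' => /eqP[->].
    exact: (stripP _ _ _ (chain_okP _ _ _ ok _ tr) j).
  have l0' : layer la (toggle la c) 0 = mu by rewrite other.
  have pse t j : j <= x.1 -> psum (ent (layer la (toggle la c) t)) j = psum (ent (layer la c t)) j.
    move=> jx; have [->|ne] := eqVneq t x.2.+1; last by rewrite other.
    by apply: psum_eq => j' j'j; rewrite Xj tog_lt // (leq_trans j'j).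
  have badx' : violation la (toggle la c) x.1 x.2.
    rewrite /violation kr /= /is_bad (other x.2) // (other x.2.+2) //.
    have e j : psum (ent (layer la (toggle la c) x.2.+1)) j = psum (tog B T x.1 X) j.
      by apply: psum_eq => j' _.
    by rewrite !e; exact: (tog_bad TX XB badx gd).
  (* An earlier violation sees the changed layer only in rows above x.1: in row x.1 only letters
     above k are earlier, and for k+1 the changed layer is the innermost of the three, which
     [is_bad] sums over the rows before. This is where the choice of the largest k matters. *)
  have fx' : first_violation la (toggle la c) x.
    rewrite /first_violation badx' /=; apply/forallP => -[i k]; apply/implyP => /= ik.
    have := fst (i, k); rewrite /= ik /violation /is_bad; case: (k.+1 < r) => //=.
    case/orP: ik => [lt|/andP[/eqP -> lt]]; first by rewrite !pse // ltnW.
    by rewrite (other k.+2) ?(other k.+1) ?pse // neq_ltn ltnS ?ltnS ?(ltnW lt) ?lt orbT.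
  split=> //.
  - rewrite /P ok' l0' eqxx /=; apply/negP => /forallP/(_ x.1)/forallP/(_ x.2).
    by rewrite badx'.
  - have [_ other' Xj' _] := toggleP ok' fx'.
    apply/ffunP => t; rewrite -!(layer_ord la).
    have [e|ne] := eqVneq (t : nat) x.2.+1; last by rewrite other' ?other.
    apply: shp_ext => j _; rewrite e Xj' (other x.2) // (other x.2.+2) //.
    rewrite -/B -/T -/(X j) -(togK TX XB badx gd).
    have eX : ent (layer la (toggle la c) x.2.+1) =1 tog B T x.1 X by exact: Xj.
    rewrite /tog /tog_hi !eX.
    by rewrite (psum_eq (h := tog B T x.1 X)).
  - pose o1 := Ordinal kr.
    have xo : x.2 != o1 by rewrite -val_eqE /= neq_ltn ltnSn.
    have := aF (tperm x.2 o1) (content la c + @delta r)%R.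
    rewrite odd_tperm xo expr1 mulN1r => <-; congr F.
    have := tog_weight TX XB badx gd (ltn_ord _) Tn.
    rewrite (psum_eq (f := tog B T x.1 X) (h := ent (layer la (toggle la c) x.2.+1))) //.
    rewrite /X /B /T -!weighE => we.
    apply/ffunP => t; rewrite !ffunE; have := ltn_ord x.2.
    case: tpermP => [->|->|/eqP t1 /eqP t2].
    + by rewrite /= (other x.2) //; lia.
    + by rewrite /= (other x.2.+2) //; lia.
    + by rewrite (other t) ?(other t.+1) //; apply: contra t1 => /eqP[e]; apply/eqP/val_inj.
apply: (sum_sign_reversing (P := P) (phi := toggle la)) => c /key[x [_ h1 _ h2 h3]] //.
Qed.

Definition lr_count la mu (nu : vec r) : nat :=
  #|[set c : shps r n D | [&& chain_ok horizontal la c, layer la c 0 == mu,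
       lattice la c & content la c == nu]]|.

(** In the last row the lattice condition compares the total numbers of letters k and k+1. *)
Lemma lattice_dominant la c : chain_ok horizontal la c -> lattice la c ->
  strict_dec (content la c + @delta r)%R.
Proof.
move=> /chain_okP ok /forallP lat.
pose a t := (Posz (weigh (layer la c t.+1)) - Posz (weigh (layer la c t)))%R.
have step k : k.+1 < r -> (a k.+1 <= a k)%R.
  move=> kr; case: (posnP n) => [n0|n0].
    have w0 e : @weigh n D e = 0 by rewrite /weigh big1 // => -[i lt]; exfalso; lia.
    by rewrite /a !w0.
  have nn : n.-1 < n by rewrite prednK.
  have := lat (Ordinal nn) => /forallP/(_ (Ordinal (ltnW kr))).
  rewrite /violation kr /is_bad /= prednK // -leqNgt -!weighE.
  have h e : psum (@ent n D e) n = psum (ent e) n.-1 + ent e n.-1.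
    by have := psumS (ent e) n.-1; rewrite prednK.
  have := stripP _ _ _ (ok k (ltnW kr)) n.-1.
  by rewrite /a !weighE !h; lia.
have mono d k : k + d < r -> (a (k + d)%N <= a k)%R.
  elim: d => [|d IH]; rewrite ?addn0 // addnS => lt.
  exact: le_trans (step _ lt) (IH (ltnW lt)).
move=> i j ij; rewrite !ffunE.
have := mono (j - i) i; rewrite subnKC ?(ltnW ij) // => /(_ (ltn_ord j)).
by rewrite /a; have := ltn_ord j; lia.
Qed.

Lemma sum_alternant_kostka la mu (nu : vec r) : strict_dec (nu + @delta r)%R ->
  (\sum_(c | chain_ok horizontal la c && (layer la c 0%N == mu))
     alternant (nu + @delta r) (content la c + @delta r))%R = Posz (lr_count la mu nu).
Proof.
move=> dnu; rewrite (bigID (lattice la)) /=.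
rewrite [X in (_ + X)%R](_ : _ = 0%R) ?addr0; last first.
  rewrite -[RHS](not_lattice_sum0 la mu (@alternant_antisym r (nu + @delta r)%R)).
  by apply: eq_bigl => c; rewrite andbA.
rewrite /lr_count -sum1_card (big_morph Posz PoszD (erefl 0%R)) /= [RHS]big_mkcond [LHS]big_mkcond.
apply: eq_bigr => c _; rewrite inE !andbA.
case: ifP => //= /andP[/andP[ok _] lat].
rewrite alternant_dec //; last exact: lattice_dominant.
by rewrite (inj_eq (addIr _)); case: eqP.
Qed.

(** The Littlewood-Richardson rule: the multiplicity of s_nu in s_(la/mu). The sum over permutations
    collects alternants at the contents; non-lattice chains cancel, and a lattice chain has
    decreasing content, so it counts exactly when its content is nu. *)
Lemma hat_kostka la mu (nu : vec r) : dominant la -> dominant mu ->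
    strict_dec (nu + @delta r)%R ->
  hat (@kostka n D r la mu) nu = Posz (lr_count la mu nu).
Proof.
move=> dla dmu dnu; rewrite -sum_alternant_kostka // /hat sum_perm_sign.
have e s : kostka la mu (nu + @delta r - pact s^-1%g (@delta r))%R =
    (\sum_(c | chain_ok horizontal la c && (layer la c 0%N == mu))
       (content la c + @delta r == pact s (nu + @delta r))%:R)%R.
  rewrite -(kostka_perm dla dmu s) pactB pactVK; apply: eq_bigr => c _.
  by rewrite eq_sym subr_eq eq_sym.
under eq_bigr => s _ do rewrite e mulr_sumr.
by rewrite exchange_big /=.
Qed.

End LittlewoodRichardson.

(** * Schur functions and Schur expansions *)

Section Straight.
Variables n D : nat.
Implicit Types (la ka mu : shp n D).

Definition empty_shp : shp n D := [ffun=> ord0].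

Lemma ent_empty i : ent empty_shp i = 0.
Proof. by rewrite /ent; case: insubP => //= j _ _; rewrite ffunE. Qed.

Lemma dominant_empty : dominant empty_shp.
Proof. by apply/dominantP => i; rewrite !ent_empty. Qed.

Definition widen r (e : shp r D) : shp n D := mkshp n D (ent e).

Lemma ent_widen r (e : shp r D) i : r <= n -> ent (widen e) i = ent e i.
Proof.
move=> rn; have [lt|ge] := ltnP i n; first by rewrite ent_mkshp // ent_le.
by rewrite !ent_ge // (leq_trans rn).
Qed.

Lemma dominant_widen r (e : shp r D) : r <= n -> dominant e -> dominant (widen e).
Proof. by move=> rn /dominantP de; apply/dominantP => i; rewrite !ent_widen. Qed.

(** The only lattice filling of a straight shape has the letter t throughout row t. With
    [hat_kostka] this makes the functions [kostka] la [empty_shp] a dual family to [hat]. *)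
Lemma lr_count_straight r la (e : shp r D) : r <= n -> dominant la ->
  lr_count la empty_shp (tovec e) = (la == widen e).
Proof.
move=> rn dla; have dlaP := dominantP _ dla.
(* Layer t of the expected chain consists of the first t rows of la. *)
pose c0 : shps r n D :=
  [ffun t : 'I_r => mkshp n D (fun i => if t <= i then 0 else ent la i)].
have c0E : (forall i, r <= i -> ent la i = 0) ->
    forall t i, t <= r -> ent (layer la c0 t) i = if t <= i then 0 else ent la i.
  move=> la0 t i; rewrite leq_eqVlt => /orP[/eqP ->|lt].
    by rewrite layer_ge //; case: ifP => // /la0.
  rewrite -[t]/(val (Ordinal lt)) layer_ord ffunE /=.
  have [iln|nli] := ltnP i n; last by rewrite !ent_ge //; case: ifP.
  by rewrite ent_mkshp //; case: ifP => // _; apply: ent_le.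
have c0w : (forall i, r <= i -> ent la i = 0) -> forall t, t < r ->
    weigh (layer la c0 t.+1) = weigh (layer la c0 t) + ent la t.
  move=> la0 t tr; rewrite !weighE.
  have h N : psum (ent (layer la c0 t.+1)) N =
      psum (ent (layer la c0 t)) N + if t < N then ent la t else 0.
    elim: N => [|N IH]; first by rewrite /psum !big_ord0.
    rewrite !psumS IH !c0E // ?(ltnW tr) // ltnS.
    by case: (ltngtP t N) => [tN|Nt|->]; lia.
  by rewrite h; case: ltnP => // nt; rewrite ent_ge.
have forced c : chain_ok horizontal la c -> layer la c 0 = empty_shp -> lattice la c ->
    (forall i, r <= i -> ent la i = 0) /\ c = c0.
  move=> /chain_okP ok l0 /forallP lat.
  have low t : forall i, t <= r -> t <= i -> ent (layer la c t) i = 0.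
    elim: t => [|t IH] [|i] // tr; rewrite ?l0 ?ent_empty // ltnS => ti.
    have /andP[_] := stripP _ _ _ (ok t tr) i.
    by rewrite IH ?(ltnW tr) //= leqn0 => /eqP.
  have la0 i : r <= i -> ent la i = 0.
    by move=> ri; rewrite -(low r i) // layer_ge.
  (* Row i stops growing after the letter i. By induction the rows above have stopped too, so a
     later letter in row i would have no earlier letters to match it in the rows above. *)
  have stat i : forall t, i < t -> t <= r -> ent (layer la c t) i = ent (layer la c i.+1) i.
    elim/ltn_ind: i => i IH t it tr.
    have [iln|nli] := ltnP i n; last by rewrite !ent_ge.
    rewrite -(subnKC it) in tr *; elim: (t - i.+1) tr => [|d IHd] tr; first by rewrite addn0.
    rewrite -IHd; last by rewrite (leq_trans _ tr) // addnS.
    pose k := i + d; have kr : k.+1 < r by move: tr; rewrite /k addnS addSn.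
    have := lat (Ordinal iln) => /forallP/(_ (Ordinal (ltnW kr))).
    rewrite /violation kr /is_bad /= -leqNgt !psumS.
    have eqp t1 t2 : i <= t1 -> t1 <= r -> i <= t2 -> t2 <= r ->
        psum (ent (layer la c t1)) i = psum (ent (layer la c t2)) i.
      by move=> h1 h2 h3 h4; apply: psum_eq => j ji; rewrite (IH j ji t1) ?(IH j ji t2) //; exact: leq_trans ji _.
    rewrite (eqp k k.+1) ?(eqp k.+2 k.+1) /k; try lia.
    have /andP[+ _] := stripP _ _ _ (ok k.+1 kr) i.
    rewrite !addSn addnS -/k => h1 h2.
    by apply/eqP; rewrite eqn_leq h1 andbT -(leq_add2l (psum (ent (layer la c k.+1)) i)); move: h2; clear; lia.
  split=> //; apply/ffunP => t; rewrite -!(layer_ord la); apply: shp_ext => i _.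
  rewrite c0E ?(ltnW (ltn_ord t)) //; case: leqP => ti; first by rewrite low // ltnW.
  have [ir|ri] := ltnP i r; last by have := ltn_ord t; lia.
  by rewrite stat ?(ltnW (ltn_ord t)) // -(stat i r) // layer_ge.
rewrite /lr_count; case: eqP => [lae|ne].
  have la0 i : r <= i -> ent la i = 0 by move=> ri; rewrite lae ent_widen // ent_ge.
  rewrite (_ : [set c | _] = [set c0]) ?cards1 //; apply/setP => c; rewrite !inE.
  apply/and4P/eqP => [[ok /eqP l0 lat _]|->]; first by case: (forced c ok l0 lat).
  split.
  - apply/chain_okP => t tr; apply/stripP => i; rewrite !c0E // ?(ltnW tr) //= ltnS.
    by have := dlaP i; case: (ltngtP t i) => _ /=; lia.
  - apply/eqP/shp_ext => i _; rewrite c0E // ent_empty //.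
  - apply/forallP => i; apply/forallP => k; rewrite /violation.
    case: ltnP => //= kr; rewrite /is_bad -leqNgt.
    have h N : psum (ent (layer la c0 k.+2)) N.+1 + psum (ent (layer la c0 k)) N +
        (if k < N then ent la k else 0) =
        psum (ent (layer la c0 k.+1)) N.+1 + psum (ent (layer la c0 k.+1)) N +
        (if k < N then ent la k.+1 else 0).
      have kr' := ltn_ord k.
      elim: N => [|N IH]; first by rewrite !psumS /psum !big_ord0 !c0E //; lia.
      move: IH; rewrite !(psumS _ N.+1) !(psumS _ N) !c0E // ?(ltnW kr') // !ltnS.
      by have := dlaP k; case: (ltngtP k N) => [kN|Nk|->] /=; case: (ltngtP k.+1 N) => ? /=; lia.
    by have := h i; have := dlaP k; case: ifP; lia.
  - by apply/eqP/ffunP => t; rewrite ffunE c0w // tovecE lae ent_widen //; lia.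
rewrite (_ : [set c | _] = finset.set0) ?cards0 //; apply/setP => c; rewrite !inE.
apply/negP => /and4P[ok /eqP l0 lat /eqP/ffunP ct]; apply: ne; apply: shp_ext => i lt.
have [la0 cE] := forced c ok l0 lat; rewrite ent_widen //.
have [ir|ri] := ltnP i r; last by rewrite la0 // ent_ge.
have := ct (Ordinal ir); rewrite ffunE cE c0w // tovecE /=; lia.
Qed.

End Straight.
Arguments empty_shp {n D}.


Lemma widen_id n D (e : shp n D) : widen n e = e.
Proof. by apply: shp_ext => i lt; rewrite ent_mkshp // ent_le. Qed.

Section Inversion.
Variables n D : nat.

Lemma hat_lin (I : Type) (s : seq I) (P : pred I) (c : I -> int) (f : I -> vec n -> int) la :
  hat (fun al => \sum_(i <- s | P i) c i * f i al)%R la = (\sum_(i <- s | P i) c i * hat (f i) la)%R.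
Proof.
rewrite /hat; under eq_bigr => t _ do rewrite mulr_sumr.
rewrite exchange_big; apply: eq_bigr => i _; rewrite mulr_sumr.
by apply: eq_bigr => t _; rewrite mulrCA.
Qed.

Definition pairing (v : vec n) : int := (\sum_i v i * @delta n i)%R.

Lemma pairingD v w : pairing (v + w)%R = (pairing v + pairing w)%R.
Proof. by rewrite -big_split; apply: eq_bigr => i _; rewrite ffunE mulrDl. Qed.

(** Twice this pairing is the squared length of delta - s delta, because s preserves the length of
    delta. *)
Lemma pairing_delta_perm (s : {perm 'I_n}) : s != 1%g ->
  (0 < pairing (@delta n - pact s (@delta n)))%R.
Proof.
move=> sn1; set d := @delta n.
suff h : (0 < \sum_i (d i - d (s i)) ^+ 2)%R.
  have dE i : (d - pact s d)%R i = (d i - d (s i))%R by rewrite !ffunE.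
  have e1 : (\sum_i d (s i) ^+ 2 = \sum_i d i ^+ 2)%R.
    by rewrite [RHS](reindex_inj (@perm_inj _ s)).
  have e : (\sum_i (d i - d (s i)) ^+ 2 = (pairing (d - pact s d)%R) *+ 2)%R.
    under eq_bigr => i _ do rewrite sqrrB.
    rewrite big_split /= e1 -big_split -sumrMnl; apply: eq_bigr => i _ /=.
    rewrite dE -/d; ring.
  by move: h; rewrite e pmulrn_lgt0.
have [i si] : exists i, s i != i.
  apply: contrapT => no; case/negP: sn1; apply/eqP/permP => i; rewrite perm1.
  by apply/eqP; apply: contrapT => /negP ne; apply: no; exists i.
rewrite (bigD1 i) //= ltr_pwDl ?sumr_ge0 // => [|j _]; last exact: sqr_ge0.
rewrite exprn_even_gt0 //= subr_eq0 /d !ffunE eqz_nat.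
apply: contra si => /eqP e; apply/eqP/val_inj => /=.
by have := ltn_ord i; have := ltn_ord (s i); lia.
Qed.

(** The difference g of the two sides has all its [hat] values equal to 0 at dominant shapes. Look
    at a point of its support that pairs maximally with delta. *)
Lemma inversion (f : vec n -> int) al :
    symmetric_fun f -> (forall v, f v != 0%R -> exists e : shp n D, v = tovec e) ->
  f al = (\sum_(la : shp n D | dominant la) hat f (tovec la) * kostka la empty_shp al)%R.
Proof.
move=> sf bf; pose g v := (f v - \sum_(la : shp n D | dominant la)
  hat f (tovec la) * kostka la empty_shp v)%R.
have sg : symmetric_fun g.
  move=> s v; rewrite /g sf; congr (_ - _)%R; apply: eq_bigr => la dla.
  by rewrite kostka_perm // dominant_empty.
have bg v : g v != 0%R -> exists e : shp n D, v = tovec e.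
  move=> gv; have [/eqP fv|/bf//] := boolP (f v == 0%R).
  move: gv; rewrite /g fv sub0r oppr_eq0 => /negP nz.
  have [[la [dla]]|no] := pselect (exists la : shp n D, dominant la /\ kostka la empty_shp v != 0%R).
    exact: kostka_box.
  case: nz; rewrite big1 // => la dla; case: (eqVneq (kostka la empty_shp v) 0%R) => [->|nz].
    by rewrite mulr0.
  by case: no; exists la.
have hg (ka : shp n D) : dominant ka -> hat g (tovec ka) = 0%R.
  move=> dka; have key (la : shp n D) : dominant la ->
      hat (kostka la empty_shp) (tovec ka) = (la == ka)%:R%R.
    move=> dla; rewrite hat_kostka ?dominant_empty //; last exact: dominant_strict.
    by rewrite lr_count_straight // widen_id; case: eqP.
  rewrite /g /hat; under eq_bigr => s _ do rewrite mulrBr.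
  rewrite sumrB -/(hat f _) -/(hat (fun v => \sum_(la : shp n D | dominant la)
    hat f (tovec la) * kostka la empty_shp v)%R _).
  rewrite hat_lin; apply/eqP; rewrite subr_eq0 (bigD1 ka) //= big1 ?addr0.
    by rewrite key // eqxx mulr1.
  by move=> la /andP[dla ne]; rewrite key // (negPf ne) mulr0.
suff g0 : forall e : shp n D, g (tovec e) = 0%R.
  apply/eqP; rewrite -subr_eq0 -/(g al); apply: contraT => nz.
  by have [e ale] := bg _ nz; move: nz; rewrite ale g0 eqxx.
move=> e0; apply/eqP; apply: contraT => nz0.
case: (@Order.TotalTheory.arg_maxP _ _ _ e0 (fun e : shp n D => g (tovec e) != 0%R) (fun e => pairing (tovec e)) nz0).
move=> e nz max; have {}max v : g v != 0%R -> (pairing v <= pairing (tovec e))%R.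
  by move=> nzv; have [e' ve] := bg _ nzv; rewrite ve; apply: max; rewrite -ve.
(* Exchanging two adjacent entries in the wrong order would stay in the support and raise the
   pairing. *)
have de : dominant e.
  apply: contraT; rewrite negb_forall => /existsP[i].
  have [i1|ge] := ltnP i.+1 n; last by rewrite ent_ge.
  rewrite -[i.+1]/(val (Ordinal i1)) !entE -ltnNge => lt.
  set j := Ordinal i1 in lt *.
  have ij : i != j by rewrite -val_eqE /= neq_ltn ltnSn.
  have := max (pact (tperm i j) (tovec e)); rewrite sg => /(_ nz).
  rewrite leNgt => /negP[]; rewrite /pairing [ltLHS](bigD1 i) // [ltRHS](bigD1 i) //=.
  rewrite [X in (_ + X < _)%R](bigD1 j) ?[X in (_ < _ + X)%R](bigD1 j) //=; try by rewrite eq_sym.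
  rewrite !addrA; have -> : (\sum_(x | (x != i) && (x != j)) pact (tperm i j) (tovec e) x * @delta n x =
      \sum_(x | (x != i) && (x != j)) tovec e x * @delta n x)%R.
    by apply: eq_bigr => x /andP[xi xj]; rewrite ffunE tpermD // eq_sym.
  rewrite ltrD2r !ffunE tpermL tpermR /=.
  have -> : (n - i.+1 = (n - i.+2).+1)%N by lia.
  by move: (n - i.+2)%N (nat_of_ord (e i)) (nat_of_ord (e j)) lt => a b c; nia.
(* For s different from 1 the argument has larger pairing, so the term vanishes and [hat] g at e
   reduces to g at e. *)
have := hg e de; rewrite /hat (bigD1 1%g) //= odd_perm1 mul1r pact1 addrK big1 ?addr0 => [/eqP|s sn1].
  by rewrite (negPf nz).
case: (eqVneq (g (tovec e + @delta n - pact s (@delta n)))%R 0%R) => [->|/max]; first by rewrite mulr0.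
by rewrite -addrA pairingD leNgt ltrDl pairing_delta_perm.
Qed.

End Inversion.

Lemma chains0 n D w (F : shp n D -> int) la : (forall ka, F ka = 0%R) -> chains w F la = 0%R.
Proof. by move=> F0; elim: w la => //= l w IH la; rewrite big1 // => ka _; apply: IH. Qed.

Lemma kostka_neg n D r (la mu : shp n D) (al : vec r) t :
  ~~ (0 <= al t)%R -> kostka la mu al = 0%R.
Proof. by move=> h; apply: (@kostka_eq0 _ _ _ _ _ _ t); rewrite negb_and h. Qed.

(** * Restriction to two groups of variables *)

Section Branching.
Variables m n D : nat.

Definition catv (a : vec m) (b : vec n) : vec (m + n) :=
  [ffun i : 'I_(m + n) => match fintype.split i with inl j => a j | inr j => b j end].

Lemma catv_l a b (i : 'I_m) : catv a b (lshift n i) = a i.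
Proof. by rewrite ffunE; case: (split_ordP (lshift n i)) => j /eqP; rewrite ?eq_shift // => /eqP->. Qed.

Lemma catv_r a b (i : 'I_n) : catv a b (rshift m i) = b i.
Proof. by rewrite ffunE; case: (split_ordP (rshift m i)) => j /eqP; rewrite ?eq_shift // => /eqP->. Qed.

(** The coefficient of s_mu(x) s_nu(y) when the first m variables x and the last n variables y are
    treated separately. *)
Definition hat2 (f : vec (m + n) -> int) (mu : vec m) (nu : vec n) : int :=
  (\sum_(s : {perm 'I_m}) \sum_(t : {perm 'I_n}) (-1) ^+ s * ((-1) ^+ t *
     f (catv (mu + @delta m - pact s (@delta m)) (nu + @delta n - pact t (@delta n)))))%R.

Let M := m + n.
Implicit Types (la ka : shp M D).

(** The last n letters of a chain, with F on the shape where they begin. The value 0 at negative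
    exponents agrees with [kostka]; without the test, absolute values would give false
    contributions. *)
Definition kostka_op (be : vec n) (F : shp M D -> int) la : int :=
  if [forall t, (0 <= be t)%R]
  then chains (word horizontal (fun t => oapp (fun i => `|be i|%N) 0 (insub t)) n) F la
  else 0%R.

Lemma kostka_opE la mu be : kostka la mu be = kostka_op be (single mu) la.
Proof.
rewrite /kostka_op; case: ifP => [/forallP h|].
  by apply: kostka_chains => t; rewrite valK /=; move: (h t); case: (be t) => x; lia.
move=> /negbT; rewrite negb_forall => /existsP[t ht].
exact: kostka_neg ht.
Qed.

Lemma kostka_catv la mu al be :
  kostka la mu (catv al be) = kostka_op be (fun ka => kostka ka mu al) la.
Proof.
rewrite /kostka_op; case: ifP => [/forallP hb|/negbT]; last first.
  rewrite negb_forall => /existsP[t ht].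
  by apply: (@kostka_neg _ _ _ _ _ _ (rshift m t)); rewrite catv_r.
have [/forallP ha|] := boolP [forall t, (0 <= al t)%R]; last first.
  rewrite negb_forall => /existsP[t ht].
  rewrite (@kostka_neg _ _ _ _ _ _ (lshift n t)) ?catv_l //.
  by rewrite chains0 // => ka; exact: kostka_neg ht.
pose a t := oapp (fun i => `|al i|%N) 0 (insub t).
pose b t := oapp (fun i => `|be i|%N) 0 (insub t).
pose c t := if t < m then a t else b (t - m).
rewrite (@kostka_chains _ _ _ _ _ c (catv al be)); last first.
  move=> t; rewrite /c; case: (split_ordP t) => i ->.
    by rewrite catv_l /= /a valK /=; move: (ha i); case: (al i) => x; lia.
  rewrite catv_r /= addKn /b valK /=.
  by move: (hb i); case: (be i) => x; lia.
have -> : word horizontal c M = word horizontal b n ++ word horizontal a m.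
  rewrite /word /mkseq iotaD map_cat rev_cat add0n; congr (rev _ ++ rev _).
    rewrite -[m in iota m n]addn0 iotaDl -map_comp; apply: eq_map => t /=.
    by rewrite /c ltnNge leq_addr /= addKn.
  by apply/eq_in_map => t; rewrite mem_iota /c => /andP[_ ->].
rewrite chains_cat; congr (chains _ _ _); apply: funext => ka.
rewrite (@kostka_chains _ _ _ _ _ a al) // => t.
by rewrite /a valK /=; move: (ha t); case: (al t) => x; lia.
Qed.

(** Cut a chain from the empty shape to la after its first m letters. The signed sum over
    permutations of the first group forces the shape at the cut to be mu, and the second sum is then
    the Littlewood-Richardson rule for la/mu. *)
Lemma hat2_kostka la (mu : shp m D) (nu : vec n) :
    dominant la -> dominant mu -> strict_dec (nu + @delta n)%R ->
  hat2 (kostka la empty_shp) (tovec mu) nu = Posz (lr_count la (widen M mu) nu).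
Proof.
move=> dla dmu dnu; have dw : dominant (widen M mu) by rewrite dominant_widen // leq_addr.
rewrite -hat_kostka // /hat2 exchange_big; apply: eq_bigr => t _ /=.
rewrite kostka_opE; under eq_bigr => s _ do rewrite kostka_catv mulrCA.
rewrite -mulr_sumr; congr (_ * _)%R; rewrite /kostka_op.
case: ifP => _; last by rewrite big1 // => s _; rewrite mulr0.
rewrite -chains_lin; apply: chains_ext => // ka dka.
rewrite -/(hat (kostka ka empty_shp) _) hat_kostka ?dominant_empty //; last exact: dominant_strict.
by rewrite lr_count_straight ?leq_addr // /single; case: eqP.
Qed.

Lemma hat2_lin (I : Type) (s : seq I) (P : pred I) (c : I -> int) (f : I -> vec M -> int) mu nu :
  hat2 (fun al => \sum_(i <- s | P i) c i * f i al)%R mu nu =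
  (\sum_(i <- s | P i) c i * hat2 (f i) mu nu)%R.
Proof.
rewrite /hat2; under eq_bigr => x _ do under eq_bigr => y _ do rewrite !mulr_sumr.
under eq_bigr => x _ do rewrite exchange_big.
rewrite exchange_big; apply: eq_bigr => i _; rewrite mulr_sumr.
apply: eq_bigr => x _; rewrite mulr_sumr; apply: eq_bigr => y _.
by rewrite (mulrCA _ (c i)) (mulrCA _ (c i)).
Qed.

Lemma hat2_expand (f : vec M -> int) (mu : shp m D) (nu : vec n) :
    symmetric_fun f -> (forall v, f v != 0%R -> exists e : shp M D, v = tovec e) ->
    dominant mu -> strict_dec (nu + @delta n)%R ->
  hat2 f (tovec mu) nu =
  (\sum_(la : shp M D | dominant la) hat f (tovec la) * Posz (lr_count la (widen M mu) nu))%R.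
Proof.
move=> sf bf dmu dnu.
have -> : f = (fun al => \sum_(la : shp M D | dominant la)
    hat f (tovec la) * kostka la empty_shp al)%R.
  by apply: funext => al; apply: inversion.
rewrite hat2_lin; apply: eq_bigr => la dla; rewrite hat2_kostka //; congr (_ * _)%R.
by rewrite /hat; apply: eq_bigr => s _; congr (_ * _)%R; apply: inversion.
Qed.

(** The coproduct h_k(x,y) = sum of h_i(x) h_(k-i)(y), and likewise for e_k and for inverted
    variables: cut an exponent vector in two and sort by the degree of its first half. *)
Lemma xop_catv neg o k (F1 : vec m -> int) (F2 : vec n -> int) a b :
  xop D (neg, o, k) (fun v => F1 [ffun i => v (lshift n i)] * F2 [ffun i => v (rshift m i)])%R (catv a b) =
  (\sum_(i < k.+1) xop D (neg, o, nat_of_ord i) F1 a * xop D (neg, o, k - i)%N F2 b)%R.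
Proof.
pose join (x : shp m D * shp n D) : shp M D :=
  [ffun i : 'I_(m + n) => match fintype.split i with inl j => x.1 j | inr j => x.2 j end].
pose cut (e : shp M D) : shp m D * shp n D :=
  ([ffun i => e (lshift n i)], [ffun i => e (rshift m i)]).
have joinl x i : join x (lshift n i) = x.1 i.
  by rewrite ffunE; case: (split_ordP (lshift n i)) => j /eqP; rewrite ?eq_shift // => /eqP->.
have joinr x i : join x (rshift m i) = x.2 i.
  by rewrite ffunE; case: (split_ordP (rshift m i)) => j /eqP; rewrite ?eq_shift // => /eqP->.
have joinK : cancel join cut.
  by case=> x y; congr (_, _); apply/ffunP => i; rewrite ffunE ?joinl ?joinr.
have cutK : cancel cut join.
  by move=> e; apply/ffunP => i; case: (split_ordP i) => j ->; rewrite ?joinl ?joinr ffunE.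
have wE x : weigh (join x) = weigh x.1 + weigh x.2.
  rewrite /weigh big_split_ord /=; congr (_ + _); apply: eq_bigr => i _.
    by rewrite -[i : nat]/(nat_of_ord (lshift n i)) !entE joinl.
  by rewrite -[m + i]/(nat_of_ord (rshift m i)) !entE joinr.
rewrite /xop (reindex join) /=; last by exists cut => x _; [exact: joinK|exact: cutK].
have vecB r (g v : vec r) i : (g - sgv neg v)%R i = (g i - if neg then - v i else v i)%R.
  by rewrite /sgv; case: neg; rewrite !ffunE.
have F1E x : [ffun i => (catv a b - sgv neg (tovec (join x)))%R (lshift n i)] = (a - sgv neg (tovec x.1))%R.
  by apply/ffunP => i; rewrite ffunE !vecB catv_l [tovec (join x) _]ffunE joinl [tovec x.1 _]ffunE.
have F2E x : [ffun i => (catv a b - sgv neg (tovec (join x)))%R (rshift m i)] = (b - sgv neg (tovec x.2))%R.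
  by apply/ffunP => i; rewrite ffunE !vecB catv_r [tovec (join x) _]ffunE joinr [tovec x.2 _]ffunE.
under eq_bigr => x _ do rewrite F1E F2E.
rewrite (partition_big (fun x : shp m D * shp n D => inord (weigh x.1) : 'I_k.+1) predT) //=.
apply: eq_bigr => i _; rewrite mulr_suml; under [RHS]eq_bigr => x _ do rewrite mulr_sumr.
rewrite pair_big_dep; apply: eq_bigl => -[x y] /=.
have oE : (o ==> [forall j, join (x, y) j <= 1]) =
    (o ==> [forall j, x j <= 1]) && (o ==> [forall j, y j <= 1]).
  case: o => //=; apply/forallP/andP => [h|[/forallP hx /forallP hy] j].
    by split; apply/forallP => j; [have := h (lshift n j)|have := h (rshift m j)]; rewrite ?joinl ?joinr.
  by case: (split_ordP j) => l ->; rewrite ?joinl ?joinr /=.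
rewrite /incr wE oE /= -!andbA; case: (o ==> _); rewrite ?andbF //=.
case: (o ==> _); rewrite ?andbF //= !andbT.
have ik := ltn_ord i.
apply/andP/andP => [[/eqP wk /eqP e]|[/eqP e1 /eqP e2]].
  have : nat_of_ord (inord (weigh x) : 'I_k.+1) = i by rewrite e.
  rewrite inordK ?ltnS => [wi|]; last by lia.
  by split; apply/eqP; lia.
rewrite e1 e2 subnKC // eqxx; split=> //.
by apply/eqP/val_inj; rewrite /= inordK.
Qed.

End Branching.

(** * Transposition of Littlewood-Richardson numbers *)

Lemma count_antitone (p : nat -> bool) n :
  (forall i, p i.+1 -> p i) -> (forall i, n <= i -> ~~ p i) ->
  forall i, (i < \sum_(j < n) (p j : nat)) = p i.
Proof.
move=> anti out.
have down i j : i <= j -> p j -> p i.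
  by move=> ij; rewrite -(subnKC ij); elim: (j - i) => [|d IH]; rewrite ?addn0 // addnS => /anti.
have h N : forall i, (i < \sum_(j < N) (p j : nat)) = (i < N) && p i.
  elim: N => [|N IH] i; first by rewrite big_ord0 ltn0.
  have le : \sum_(j < N) (p j : nat) <= N.
    by rewrite -[X in _ <= X]card_ord -sum1_card; apply: leq_sum => j _; case: (p j).
  rewrite big_ord_recr /= ltnS; have := IH i.
  case pN : (p N); rewrite ?addn0 ?addn1.
    have full : \sum_(j < N) (p j : nat) = N.
      rewrite -[RHS]card_ord -sum1_card; apply: eq_bigr => j _.
      by rewrite (down j N) // ltnW.
    by rewrite full ltnS => _; case: leqP => //= /down ->.
  move=> ->; have [->|ne] := eqVneq i N; first by rewrite ltnn leqnn pN.
  by rewrite [i <= N]leq_eqVlt (negPf ne).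
by move=> i; rewrite h; case: ltnP => //= /out/negPf.
Qed.

Definition conj_shp n D (e : shp n D) : shp D n :=
  mkshp D n (fun j => \sum_(i < n) (j < ent e i : nat)).

Section Conjugate.
Variables n D : nat.
Implicit Types (e la ka mu : shp n D).

Lemma conj_shpE e j : ent (conj_shp e) j = \sum_(i < n) (j < ent e i : nat).
Proof.
have [lt|ge] := ltnP j D.
  rewrite ent_mkshp // -[X in _ <= X]card_ord -sum1_card.
  by apply: leq_sum => i _; case: (_ < _).
rewrite ent_ge // big1 // => i _; rewrite ltnNge (leq_trans _ ge) //.
exact: ent_le.
Qed.

Lemma conj_shp_lt e : dominant e -> forall i j, (i < ent (conj_shp e) j) = (j < ent e i).
Proof.
move=> /dominantP de i j; rewrite conj_shpE (@count_antitone (fun i => j < ent e i)) //.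
  by move=> k h; exact: leq_trans h (de k).
by move=> k nk; rewrite ent_ge.
Qed.

Lemma conj_shp_dominant e : dominant (conj_shp e).
Proof.
apply/dominantP => j; rewrite !conj_shpE; apply: leq_sum => i _.
by case: (ltnP j.+1) => // /ltnW ->.
Qed.

Lemma weigh_conj e : weigh (conj_shp e) = weigh e.
Proof.
rewrite /weigh; under eq_bigr => j _ do rewrite conj_shpE.
rewrite exchange_big; apply: eq_bigr => i _ /=.
rewrite -[RHS](@card_ord (ent e i)) -sum1_card.
rewrite (big_ord_widen _ (fun=> 1) (ent_le e i)) [RHS]big_mkcond.
by apply: eq_bigr => j _; case: (_ < _).
Qed.

End Conjugate.

Lemma ltn_inj a b : (forall j, (j < a) = (j < b)) -> a = b.
Proof.
by move=> h; have := h a; have := h b; rewrite !ltnn; lia.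
Qed.

Lemma conj_shpK n D (e : shp n D) : dominant e -> conj_shp (conj_shp e) = e.
Proof.
move=> de; apply: shp_ext => i _; apply: ltn_inj => j.
by rewrite !conj_shp_lt // conj_shp_dominant.
Qed.

Lemma conj_shp_empty n D : conj_shp empty_shp = @empty_shp D n.
Proof.
by apply: shp_ext => i _; rewrite conj_shpE ent_empty big1 // => j _; rewrite ent_empty.
Qed.

Lemma strip_conj n D (la ka : shp n D) : dominant la -> dominant ka ->
  strip true la ka = strip false (conj_shp la) (conj_shp ka).
Proof.
move=> dla dka; apply/stripP/stripP => h i; apply/andP; split.
- rewrite !conj_shpE; apply: leq_sum => j _; have /andP[le _] := h j.
  by case: (ltnP i (ent ka j)) => // lt; rewrite (leq_trans lt le).
- rewrite !conj_shpE; apply: leq_sum => j _; have /andP[_ /andP[le _]] := h j.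
  by case: (ltnP i.+1 (ent la j)) => // lt; rewrite (_ : i < ent ka j) //; lia.
- rewrite leqNgt; apply/negP; rewrite -(conj_shp_lt dka) => lt.
  have /andP[le _] := h (ent la i).
  by have := leq_trans lt le; rewrite conj_shp_lt // ltnn.
- rewrite (dominantP _ dka) andbT leqNgt; apply/negP; rewrite -(conj_shp_lt dla) => lt.
  have /andP[_ le] := h (ent ka i).
  by have := leq_trans lt le; rewrite conj_shp_lt // ltnn.
Qed.

Definition vertical (t : nat) := true.

Lemma chains_conj n D a r (F : shp n D -> int) la : dominant la ->
  chains (word vertical a r) F la =
  chains (word horizontal a r) (fun ka => F (conj_shp ka)) (conj_shp la).
Proof.
elim: r la => [|r IH] la dla; first by rewrite /= conj_shpK.
rewrite !wordS /= (reindex_onto (@conj_shp D n) (@conj_shp n D)) /=; last first.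
  by move=> ka /andP[st _]; apply: conj_shpK; exact: strip_dominant st.
apply: eq_big => [ka|ka /andP[/andP[st _] /eqP e]].
  rewrite !weigh_conj; apply/idP/idP => [/andP[/andP[st ->] /eqP e]|/andP[st ->]].
    by rewrite andbT -e -strip_conj ?conj_shp_dominant.
  have dka : dominant ka by apply: strip_dominant st; exact: conj_shp_dominant.
  by rewrite andbT strip_conj ?conj_shp_dominant // conj_shpK // st eqxx.
by rewrite IH ?conj_shp_dominant // e.
Qed.

(** Bounds exponents by the total degree and, if every factor is some e_k, also by the number of
    factors. Either bound can supply the box that [inversion] asks for. *)
Lemma kernel_support n D (w : seq (bool * nat)) (v : vec n) : kernel D (poslet w) v != 0%R ->
  (forall i, (0 <= v i)%R /\ (all (fun l => l.1) w -> (v i <= Posz (size w))%R)) /\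
  (\sum_i v i = Posz (sumn (unzip2 w)))%R.
Proof.
elim: w v => [|[o k] w IH] v.
  rewrite /kernel /= /dirac; have [-> _|//] := eqVneq v 0%R.
  split=> [i|]; first by rewrite ffunE.
  by rewrite big1 // => i _; rewrite ffunE.
rewrite /kernel /= -/(kernel D (poslet w)) /xop /= => nz.
have [e /andP[/eqP we /implyP eo] /IH[h1 h2]] : exists2 e : shp n D, incr o k e &
    kernel D (poslet w) (v - sgv false (tovec e))%R != 0%R.
  apply: contrapT => no; case/negP: nz; apply/eqP; apply: big1 => e ie.
  by apply/eqP; apply: contrapT => /negP h; apply: no; exists e.
have vE i : (v - sgv false (tovec e))%R i = (v i - Posz (e i))%R by rewrite !ffunE.
split=> [i|].
  have [] := h1 i; rewrite vE => p q; split; first by move: p; case: (v i) => x; lia.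
  case/andP=> o1 /q; have /forallP/(_ i) := eo o1; move: (nat_of_ord (e i)) => y.
  by rewrite /= ; case: (v i) => x; lia.
rewrite /= PoszD -h2; under [X in (_ + X)%R]eq_bigr => i _ do rewrite vE -entE.
by rewrite sumrB -we /weigh (big_morph Posz PoszD (erefl 0%R)) addrC subrK.
Qed.

Lemma bracket_lin n (I : Type) (s : seq I) (P : pred I) (c : I -> int) (f : I -> vec n -> int) la mu :
  bracket (fun al => \sum_(i <- s | P i) c i * f i al)%R la mu = (\sum_(i <- s | P i) c i * bracket (f i) la mu)%R.
Proof.
rewrite /bracket; under eq_bigr => t _ do rewrite mulr_sumr.
rewrite exchange_big; apply: eq_bigr => i _; rewrite mulr_sumr.
by apply: eq_bigr => t _; rewrite mulrCA.
Qed.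

Section ConjugateSymmetry.
Variables n D : nat.
Implicit Types (la ka mu : shp n D).

Lemma tovec_empty : tovec (@empty_shp n D) = 0%R.
Proof. by apply/ffunP => i; rewrite !ffunE. Qed.

Lemma hat_bracket (f : vec n -> int) (la : vec n) : hat f la = bracket f la 0%R.
Proof. by rewrite /hat /bracket add0r. Qed.

Lemma tovec_box (v : vec n) : (forall i, (0 <= v i)%R && (v i <= Posz D)%R) ->
  exists e : shp n D, v = tovec e.
Proof.
move=> h; exists [ffun t => inord `|v t|%N]; apply/ffunP => t.
by rewrite !ffunE inordK; move: (h t); case: (v t) => x; lia.
Qed.

Lemma sum_pact s (g : vec n) : (\sum_i pact s g i = \sum_i g i)%R.
Proof.
by rewrite [RHS](reindex_inj (@perm_inj _ s)); apply: eq_bigr => i _; rewrite ffunE.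
Qed.

Lemma sumn_word o a r : sumn (unzip2 (word o a r)) = \sum_(t < r) a t.
Proof.
elim: r => [|r IH]; first by rewrite big_ord0.
by rewrite wordS /= IH big_ord_recr addnC.
Qed.

(* The coefficient of s_la in s_mu * s_ka, read off from alternants. *)
Definition prod_coef la mu ka : int :=
  bracket (kostka ka empty_shp) (tovec la) (tovec mu).

Lemma bracket_expand (w : seq (bool * nat)) la mu :
    dominant la -> dominant mu -> all (fun l => l.2 <= D) w ->
    (forall v : vec n, kernel D (poslet w) v != 0%R -> exists e : shp n D, v = tovec e) ->
  chains w (single mu) la =
  (\sum_(ka : shp n D | dominant ka) prod_coef la mu ka * chains w (single empty_shp) ka)%R.
Proof.
move=> dla dmu wD box; rewrite -chains_bracket //.
rewrite [X in bracket X _ _](_ : _ = fun al => \sum_(ka : shp n D | dominant ka)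
   hat (kernel D (poslet w)) (tovec ka) * kostka ka empty_shp al)%R; last first.
  by apply: funext => al; apply: inversion => //; exact: kernel_sym.
rewrite bracket_lin; apply: eq_bigr => ka dka; rewrite mulrC; congr (_ * _)%R.
by rewrite hat_bracket -tovec_empty chains_bracket ?dominant_empty.
Qed.

(** A skew Kostka number of la/mu is the coefficient of s_la in s_mu h_al. Expanding h_al in Schur
    functions writes it through [prod_coef] and straight Kostka numbers, and [hat] isolates the term
    of ka. *)
Lemma lr_count_prod la mu ka : dominant la -> dominant mu -> dominant ka -> weigh ka <= D ->
  Posz (lr_count la mu (tovec ka)) = prod_coef la mu ka.
Proof.
move=> dla dmu dka kaD; rewrite -hat_kostka //; last exact: dominant_strict.
have key s : let al := (tovec ka + @delta n - pact s (@delta n))%R in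
    kostka la mu al = (\sum_(x : shp n D | dominant x) prod_coef la mu x * kostka x empty_shp al)%R.
  move=> al; have [/forallP h|] := boolP [forall t, (0 <= al t)%R]; last first.
    rewrite negb_forall => /existsP[t ht]; rewrite (kostka_neg _ _ ht) big1 // => x _.
    by rewrite (kostka_neg _ _ ht) mulr0.
  pose a t := oapp (fun i => `|al i|%N) 0 (insub t).
  have aE (t : 'I_n) : al t = Posz (a t).
    by rewrite /a valK /=; move: (h t); case: (al t) => x; lia.
  have suma : \sum_(t < n) a t = weigh ka.
    apply/eqP; rewrite -eqz_nat; apply/eqP.
    rewrite /weigh !(big_morph Posz PoszD (erefl 0%R)); under eq_bigr => i _ do rewrite -aE.
    have vec_subE (u v : vec n) i : (u - v)%R i = (u i - v i)%R by rewrite !ffunE.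
    under eq_bigr => i _ do rewrite vec_subE.
    rewrite sumrB sum_pact; under [X in (X - _)%R]eq_bigr => i _ do rewrite ffunE.
    by rewrite big_split /= addrK; apply: eq_bigr => i _; rewrite tovecE.
  have aD t : t < n -> a t <= D.
    move=> lt; rewrite (leq_trans _ kaD) // -suma (bigD1 (Ordinal lt)) //= leq_addr //.
  rewrite (kostka_chains _ _ aE) bracket_expand //; last first.
  (* Here the total degree, the weight of ka, is at most D. *)
  - move=> v /kernel_support[v0]; rewrite sumn_word suma => vs; apply: tovec_box => i.
    have [vi _] := v0 i; rewrite vi /=.
    have kaD' : (Posz (weigh ka) <= Posz D)%R by rewrite lez_nat.
    apply: le_trans kaD'; rewrite -vs (bigD1 i) //= lerDl sumr_ge0 // => j _.
    by have [] := v0 j.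
  - exact: word_all.
  by apply: eq_bigr => x _; rewrite -(kostka_chains _ _ aE).
transitivity (hat (fun al => \sum_(x : shp n D | dominant x) prod_coef la mu x * kostka x empty_shp al)%R (tovec ka)).
  by apply: eq_bigr => s _; rewrite key.
rewrite hat_lin (bigD1 ka) //= big1 ?addr0 => [|x /andP[dx ne]].
  rewrite hat_kostka ?dominant_empty //; last exact: dominant_strict.
  by rewrite lr_count_straight // widen_id eqxx mulr1.
rewrite hat_kostka ?dominant_empty //; last exact: dominant_strict.
by rewrite lr_count_straight // widen_id (negPf ne) mulr0.
Qed.

(** The same computation after transposition, which turns horizontal strips into vertical ones and
    h_al into e_al. The product coefficients are still those of the untransposed shapes, so both
    Littlewood-Richardson numbers equal the same quantity. *)
Lemma lr_count_conj_prod la mu ka : n <= D -> dominant la -> dominant mu -> dominant ka ->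
  Posz (lr_count (conj_shp la) (conj_shp mu) (tovec (conj_shp ka))) = prod_coef la mu ka.
Proof.
move=> nD dla dmu dka.
rewrite -hat_kostka ?conj_shp_dominant //; last exact/dominant_strict/conj_shp_dominant.
have key (al : vec D) : kostka (conj_shp la) (conj_shp mu) al =
    (\sum_(x : shp n D | dominant x) prod_coef la mu x * kostka (conj_shp x) empty_shp al)%R.
  have [/forallP h|] := boolP [forall t, (0 <= al t)%R && (al t <= Posz n)%R]; last first.
    rewrite negb_forall => /existsP[t ht]; rewrite (kostka_eq0 _ _ ht) big1 // => x _.
    by rewrite (kostka_eq0 _ _ ht) mulr0.
  pose a t := oapp (fun i => `|al i|%N) 0 (insub t).
  have aE (t : 'I_D) : al t = Posz (a t).
    by rewrite /a valK /=; move: (h t); case: (al t) => x; lia.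
  have conv x y : dominant x -> dominant y ->
      kostka (conj_shp x) (conj_shp y) al = chains (word vertical a D) (single y) x.
    move=> dx dy; rewrite (kostka_chains _ _ aE) chains_conj //.
    apply: chains_ext => [|z dz]; first exact: conj_shp_dominant.
    rewrite /single; congr (nat_of_bool _)%:R%R; by apply/eqP/eqP => [->|<-]; rewrite conj_shpK.
  rewrite conv // bracket_expand //; last first.
  (* Here the product has D factors e_k, each of degree at most 1 in every variable. *)
  - move=> v /kernel_support[v0 _]; apply: tovec_box => i; have [-> /=] := v0 i.
    rewrite /word size_rev size_mkseq; apply; rewrite all_rev; apply/allP => l.
    by case/mapP => t _ ->.
  - apply: word_all => t lt; rewrite (leq_trans _ nD) //.
    have := h (Ordinal lt); rewrite (aE (Ordinal lt)) /=; lia.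
  by apply: eq_bigr => x dx; rewrite -(conj_shp_empty n D) conv // dominant_empty.
transitivity (hat (fun al => \sum_(x : shp n D | dominant x) prod_coef la mu x * kostka (conj_shp x) empty_shp al)%R (tovec (conj_shp ka))).
  by apply: eq_bigr => s _; rewrite key.
rewrite hat_lin (bigD1 ka) //= big1 ?addr0 => [|x /andP[dx ne]].
  rewrite hat_kostka ?dominant_empty ?conj_shp_dominant //; last exact/dominant_strict/conj_shp_dominant.
  by rewrite lr_count_straight ?conj_shp_dominant // widen_id eqxx mulr1.
rewrite hat_kostka ?dominant_empty ?conj_shp_dominant //; last exact/dominant_strict/conj_shp_dominant.
rewrite lr_count_straight ?conj_shp_dominant // widen_id (can_in_eq (@conj_shpK n D)) //.
by rewrite (negPf ne) mulr0.
Qed.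

Lemma lr_count_conj la mu ka : n <= D -> dominant la -> dominant mu -> dominant ka ->
    weigh ka <= D ->
  lr_count (conj_shp la) (conj_shp mu) (tovec (conj_shp ka)) = lr_count la mu (tovec ka).
Proof.
move=> nD dla dmu dka kaD; apply/eqP; rewrite -eqz_nat.
by rewrite lr_count_prod // lr_count_conj_prod.
Qed.

End ConjugateSymmetry.

Lemma psum_recl f i : psum f i.+1 = f 0 + psum (fun t => f t.+1) i.
Proof. by rewrite /psum big_ord_recl. Qed.

Lemma psum_le f i j : i <= j -> psum f i <= psum f j.
Proof.
by move=> ij; rewrite -(subnKC ij); elim: (j - i) => [|d IH];
   rewrite ?addn0 // addnS psumS (leq_trans IH) ?leq_addr.
Qed.

Lemma psum_locate f r q : q < psum f r -> exists2 t, t < r & psum f t <= q < psum f t.+1.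
Proof.
elim: r => [|r IH]; first by rewrite /psum big_ord0.
have [lt _|ge lt] := ltnP q (psum f r); last by exists r; rewrite ?ge.
by have [t tr h] := IH lt; exists t; rewrite // ltnW.
Qed.

(** * Tableaux as chains of diagrams *)

Section Rows.
Context {d : Order.disp_t} {A : orderType d}.
Implicit Types (s r : seq A) (f : nat -> nat).

Fixpoint row_of f s : seq A :=
  if s is x :: s' then nseq (f 0) x ++ row_of (fun t => f t.+1) s' else [::].

Lemma row_of_eq f h s : (forall t, t < size s -> f t = h t) -> row_of f s = row_of h s.
Proof.
elim: s f h => //= x s IH f h e; rewrite e // (IH _ (fun t => h t.+1)) // => t ts.
exact: e.
Qed.

Lemma size_row_of f s : size (row_of f s) = psum f (size s).
Proof.
elim: s f => [|x s IH] f; first by rewrite /psum big_ord0.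
by rewrite /= size_cat size_nseq IH psum_recl.
Qed.

Lemma mem_row_of f s : all (mem s) (row_of f s).
Proof.
elim: s f => //= x s IH f; rewrite all_cat; apply/andP; split.
  by apply/allP => y /nseqP[-> _]; exact: mem_head.
by apply: sub_all (IH _) => y ys; rewrite /= inE; apply/orP; right.
Qed.

Lemma count_row_of f s x : uniq s -> x \in s -> count_mem x (row_of f s) = f (index x s).
Proof.
elim: s f => //= y s IH f /andP[ys us]; rewrite inE count_cat count_nseq /=.
have [->|ne] /= := eqVneq x y => [_|xs]; rewrite ?eqxx ?mul1n.
  rewrite (count_memPn _) ?addn0 //; apply: contra ys => h.
  exact: (allP (mem_row_of _ _) _ h).
by rewrite mul0n IH.
Qed.

Lemma sorted_row_of f s : sorted <%O s -> sorted <=%O (row_of f s).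
Proof.
rewrite lt_sorted_pairwise le_sorted_pairwise; elim: s f => //= x s IH f /andP[xs ps].
rewrite pairwise_cat IH // andbT; apply/andP; split.
  apply/allrelP => y z /nseqP[-> _] /(allP (mem_row_of _ _)) zs.
  exact: ltW (allP xs _ zs).
by elim: (f 0) => //= k ->; rewrite andbT; apply/allP => y /nseqP[-> _].
Qed.

Lemma row_ofE s r : sorted <%O s -> sorted <=%O r -> all (mem s) r ->
  r = row_of (fun t => nth 0 [seq count_mem x r | x <- s] t) s.
Proof.
move=> ss sr rs; apply: le_sorted_eq => //; first exact: sorted_row_of.
have us := lt_sorted_uniq ss.
apply/allP => x _ /=; have [xs|xs] := boolP (x \in s).
  rewrite count_row_of // (nth_map x) ?index_mem // nth_index //.
have xr : x \notin r by apply: contra xs; exact: (allP rs).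
rewrite (count_memPn xr) (count_memPn _) //.
by apply: contra xs; exact: (allP (mem_row_of _ _)).
Qed.

Lemma onth_row_of f s q x : uniq s ->
  (onth (row_of f s) q == Some x) =
  (x \in s) && (psum f (index x s) <= q < psum f (index x s).+1).
Proof.
elim: s f q x => [|y s IH] f q x /=; first by rewrite onth0n.
case/andP=> ys us; rewrite onth_cat size_nseq onth_nseq inE [y == x]eq_sym.
have [->|ne] /= := eqVneq x y.
  rewrite psumS /psum !big_ord0 leq0n add0n /=; case: ltnP => h; first by rewrite eqxx.
  by rewrite IH // (negPf ys).
rewrite !(psum_recl f); case: ltnP => h.
  rewrite -[LHS]/(y == x) eq_sym (negPf ne) leqNgt ltn_addr //= ?andbF //.
by rewrite IH // leq_subRL // ltn_subLR //.
Qed.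

Lemma index_lt s x y : sorted <%O s -> x \in s -> y \in s ->
  (index x s < index y s) = (x < y)%O.
Proof.
move=> ss xs ys; apply/idP/idP => [|lt]; first exact: (sorted_ltn_index lt_trans ss).
rewrite ltnNge; apply/negP => ge.
have := sorted_leq_index le_trans (@lexx _ _) (sub_sorted (@ltW _ _) ss) _ _ ys xs ge.
by rewrite leNgt lt.
Qed.

End Rows.

Section ColumnCondition.
Context {d : Order.disp_t} {A : orderType d}.
Variables (odd_deg : A -> bool) (mu : seq nat).
Implicit Types (T : seq (seq A)) (c r : seq A).

Definition col_lt (x y : A) := (x < y)%O || (x == y) && odd_deg x.

Lemma column_okE c : column_ok odd_deg c = pairwise col_lt c.
Proof.
rewrite /column_ok le_sorted_pairwise lt_sorted_pairwise.
elim: c => //= x c <-; rewrite /col_lt.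
have [ox|ex] /= := boolP (odd_deg x).
  rewrite andbA; congr (_ && _ && _); apply: eq_all => y.
  by rewrite le_eqVlt andbT orbC.
rewrite andbACA; congr (_ && _); apply/andP/allP => [[/allP h1 /allP h2] y yc|h].
  have := h1 y yc; rewrite le_eqVlt => /orP[/eqP e|->//].
  by have := h2 y; rewrite mem_filter -e ex e yc => /(_ isT); rewrite -e ltxx.
split; apply/allP => y; last by rewrite mem_filter => /andP[_ /h]; rewrite andbF orbF.
by move=> /h; rewrite andbF orbF => /ltW.
Qed.

Lemma row_okE r : row_ok odd_deg r <->
  sorted <=%O r /\ forall x, odd_deg x -> count_mem x r <= 1.
Proof.
rewrite /row_ok lt_sorted_uniq_le; split.
  move=> /andP[sr /andP[ur _]]; split=> // x ox.
  have := count_uniq_mem x ur; rewrite count_filter => e.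
  rewrite (eq_count (a2 := predI (pred1 x) odd_deg)) ?e ?leq_b1 //.
  by move=> y /=; case: eqP => //= ->.
case=> sr h; rewrite sr (sorted_filter le_trans) // andbT.
apply: count_mem_uniq => x; rewrite mem_filter count_filter.
have [ox|ex] /= := boolP (odd_deg x); last first.
  by apply/eqP; rewrite -leqn0 leqNgt -has_count; apply/hasPn => y _ /=; case: eqP => //= ->.
rewrite (eq_count (a2 := pred1 x)) ; last by move=> y /=; case: eqP => //= ->.
have := h x ox; have := has_pred1 x r; rewrite has_count.
by case: (x \in r) => /=; case: (count_mem x r) => [|[|]].
Qed.

Lemma pairwise_pmap (I B : Type) (r : rel B) (f : I -> option B) (l : seq I) :
  pairwise r (pmap f l) =
  pairwise (fun a b => if f a is Some x then if f b is Some y then r x y else true else true) l.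
Proof.
elim: l => //= a l IH; case fa : (f a) => [x|] /=; rewrite IH ?all_predT //.
  congr (_ && _); elim: l {IH} => //= b l IH; case fb : (f b) => [y|] /=; rewrite IH //.
Qed.

Lemma columnP T j : column_ok odd_deg (column mu T j) <->
  forall i i' x y, i < i' -> i' < size T ->
    entry mu T i j = Some x -> entry mu T i' j = Some y -> col_lt x y.
Proof.
rewrite column_okE /column pairwise_pmap; split.
  move=> /(pairwiseP 0) h i i' x y ii' iT e e'.
  have iT' := ltn_trans ii' iT; have := h i i'.
  by rewrite !inE size_iota !nth_iota // !add0n e e'; apply.
move=> h; apply/(pairwiseP 0) => i i'; rewrite !inE size_iota => iT iT' ii'.
rewrite !nth_iota // !add0n; case e : entry => [x|] //; case e' : entry => [y|] //.
exact: (h i i').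
Qed.

Variables (s : seq A) (f : nat -> nat -> nat) (T : seq (seq A)).
Hypothesis ss : sorted <%O s.
Hypothesis rowE : forall i, nth [::] T i = row_of (f i) s.
Hypothesis f0 : forall i t, size T <= i -> f i t = 0.
Hypothesis mu_dec : forall i, nth 0 mu i.+1 <= nth 0 mu i.

(** The column of row i at which the first t letters of s end, that is, the length of row i in the
    t-th layer. *)
Definition bound i t := nth 0 mu i + psum (f i) t.

Hypothesis la_dec : forall i, bound i.+1 (size s) <= bound i (size s).

Let o t := nth false [seq odd_deg x | x <- s] t.

Lemma bound_le i t u : t <= u -> bound i t <= bound i u.
Proof. by move=> tu; rewrite leq_add2l psum_le. Qed.

Lemma entryE i j x : (entry mu T i j == Some x) =
  (x \in s) && (bound i (index x s) <= j < bound i (index x s).+1).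
Proof.
have us := lt_sorted_uniq ss; rewrite /entry /bound; case: (leqP (nth 0 mu i) j) => h.
  rewrite rowE onth_row_of //; congr (_ && _).
  by rewrite leq_subRL // ltn_subLR.
by rewrite [_ + _ <= j]leqNgt ltn_addr ?andbF.
Qed.

Lemma oE x : x \in s -> o (index x s) = odd_deg x.
Proof. by move=> xs; rewrite /o (nth_map x) ?index_mem // nth_index. Qed.

Lemma ex_letter t : t < size s -> exists2 x, x \in s & index x s = t.
Proof.
case: s ss => // x0 s0 ss0 lt; exists (nth x0 (x0 :: s0) t); first exact: mem_nth.
by rewrite index_uniq // lt_sorted_uniq.
Qed.

(** It suffices to compare adjacent rows: the letters up to t in row i+1 must lie below letters up
    to t, or strictly before t if t is even. Summed over t these are the strip conditions on
    layers. *)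
Lemma columns_ok_bound : (forall j, column_ok odd_deg (column mu T j)) <->
  (forall i t, t < size s -> bound i.+1 t.+1 <= if o t then bound i t.+1 else bound i t).
Proof.
split=> [h i t ts|h j].
  have [iT|Ti] := ltnP i.+1 (size T); last first.
    rewrite {1}/bound {1}/psum big1 ?addn0 => [|k _]; last exact: f0.
    have le u : nth 0 mu i.+1 <= bound i u by rewrite (leq_trans (mu_dec i)) ?leq_addr.
    by case: ifP.
  rewrite leqNgt; apply/negP => lt; set B := (X in X < _) in lt.
  have itB : bound i t <= B by rewrite /B; case: ifP => // _; apply: bound_le.
  (* The last cell of row i+1 filled with a letter up to t. If the inequality fails, the letter
     above it is too large. *)
  pose j := (bound i.+1 t.+1).-1.
  have jB : B <= j by rewrite /j; lia.
  have j1 : j < bound i.+1 t.+1 by rewrite /j; lia.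
  have ji : nth 0 mu i <= j by apply: leq_trans jB; apply: leq_trans itB; exact: leq_addr.
  have ji' : nth 0 mu i.+1 <= j by apply: leq_trans ji.
  have jr : j < bound i (size s).
    by rewrite (leq_trans j1) // (leq_trans _ (la_dec i)) // bound_le.
  have [t1 t1s h1] : exists2 t1, t1 < size s & bound i t1 <= j < bound i t1.+1.
    have [|t1 t1s] := @psum_locate (f i) (size s) (j - nth 0 mu i).
      by rewrite ltn_subLR.
    by rewrite leq_subRL // ltn_subLR //; exists t1.
  have [u ut h2] : exists2 u, u < t.+1 & bound i.+1 u <= j < bound i.+1 u.+1.
    have [|u ut] := @psum_locate (f i.+1) t.+1 (j - nth 0 mu i.+1).
      by rewrite ltn_subLR.
    by rewrite leq_subRL // ltn_subLR //; exists u.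
  have [x xs xt] := ex_letter t1s.
  have [y ys yu] := ex_letter (leq_trans ut ts).
  have ex : entry mu T i j = Some x by apply/eqP; rewrite entryE xs xt.
  have ey : entry mu T i.+1 j = Some y by apply/eqP; rewrite entryE ys yu.
  have tt1 : t <= t1.
    rewrite leqNgt; apply/negP => lt1; have := bound_le i lt1; lia.
  have := (columnP T j).1 (h j) _ _ _ _ (ltnSn i) iT ex ey.
  rewrite /col_lt -(index_lt ss) // xt yu ltnNge (leq_trans _ tt1) //=.
  case/andP=> /eqP xy ox; have tu : t1 = u by rewrite -xt -yu xy.
  have et : t = t1 by lia.
  have ot : o t by rewrite et -xt oE.
  by move: jB h1; rewrite /B ot et; lia.
apply/columnP => i i' x y ii' iT /eqP; rewrite entryE => /andP[xs hx] /eqP.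
rewrite entryE => /andP[ys hy].
have step k t : t < size s -> bound k.+1 t.+1 <= bound k t.+1.
  by move=> ts; apply: leq_trans (h k t ts) _; case: ifP => // _; apply: bound_le.
have mono k t e : t < size s -> bound (k + e) t.+1 <= bound k t.+1.
  move=> ts; elim: e => [|e IH]; rewrite ?addn0 // addnS.
  exact: leq_trans (step _ _ ts) IH.
have us : index y s < size s by rewrite index_mem.
have key : bound i' (index y s).+1 <= if odd_deg y then bound i (index y s).+1 else bound i (index y s).
  rewrite -(subnKC ii'); apply: leq_trans (mono _ _ _ us) _.
  by rewrite -oE //; apply: h.
have tu : index x s <= index y s.
  rewrite leqNgt; apply/negP => lt; have := bound_le i lt.
  have := bound_le i (leqnSn (index y s)); move: key; case: ifP => _; lia.
rewrite /col_lt -(index_lt ss) //; move: tu; rewrite leq_eqVlt => /orP[/eqP e|->//].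
have exy : x = y by rewrite -(nth_index x xs) e nth_index.
rewrite exy ltnn eqxx /=; apply: contraT => /negPf ey; move: key; rewrite ey.
by rewrite exy in hx; lia.
Qed.

End ColumnCondition.

(** Finiteness and cardinality in one: the list is the witness, and its size is what gets compared
    with a coefficient. *)
Definition enumerates (T : eqType) (S : set T) (l : seq T) : Prop :=
  uniq l /\ forall x, S x <-> x \in l.

Section TableauxOfChains.
Context {d : Order.disp_t} {A : orderType d}.
Variables (odd_deg : A -> bool) (s : seq A) (la mu : seq nat) (n D : nat).
Hypotheses (ss : sorted <%O s) (dla : is_part la) (dmu : is_part mu).
Hypotheses (la_n : size la <= n) (mu_n : size mu <= n).
Hypotheses (la_D : forall i, nth 0 la i <= D) (mu_la : part_sub mu la).
Let r := size s.
Let o t := nth false [seq odd_deg x | x <- s] t.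

Definition shp_of n D (p : seq nat) : shp n D := mkshp n D (nth 0 p).

Lemma ent_shp_of p i : size p <= n -> (forall i, nth 0 p i <= D) ->
  ent (shp_of n D p) i = nth 0 p i.
Proof.
move=> pn pD; have [lt|ge] := ltnP i n; first by rewrite ent_mkshp.
by rewrite ent_ge // nth_default // (leq_trans pn).
Qed.

Lemma part_dec p i : is_part p -> nth 0 p i.+1 <= nth 0 p i.
Proof.
move=> dp; have [lt|ge] := ltnP i.+1 (size p); last by rewrite nth_default.
have /(sortedP 0) := dp; exact.
Qed.

Lemma dominant_shp_of p : size p <= n -> (forall i, nth 0 p i <= D) -> is_part p ->
  dominant (shp_of n D p).
Proof.
by move=> pn pD dp; apply/dominantP => i; rewrite !ent_shp_of // part_dec.
Qed.

Let mu_D i : nth 0 mu i <= D. Proof. exact: leq_trans (mu_la i) (la_D i). Qed.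

Let LA := shp_of n D la.
Let MU := shp_of n D mu.
Implicit Types (c : shps r n D) (T : seq (seq A)).

Let cells c i t := ent (layer LA c t.+1) i - ent (layer LA c t) i.

Definition tab c : seq (seq A) :=
  mkseq (fun i => row_of (cells c i) s) (size la).

Definition good_chain c := chain_ok o LA c && (layer LA c 0 == MU).

Lemma psum_cells c i t : good_chain c -> nth 0 mu i + psum (cells c i) t = ent (layer LA c t) i.
Proof.
case/andP=> ok /eqP l0; elim: t => [|t IH].
  by rewrite /psum big_ord0 addn0 l0 ent_shp_of.
by rewrite psumS addnA IH subnKC // (layer_le _ ok).
Qed.

Lemma layer_out c i t : good_chain c -> size la <= i -> ent (layer LA c t) i = 0.
Proof.
case/andP=> ok _ ge; apply/eqP; rewrite -leqn0.
have -> : 0 = ent (layer LA c (maxn r t)) i.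
  by rewrite layer_ge ?leq_maxl // ent_shp_of // nth_default.
by apply: (layer_le _ ok); rewrite leq_maxr.
Qed.

Lemma nth_tab c i : good_chain c -> nth [::] (tab c) i = row_of (cells c i) s.
Proof.
move=> gc; have [lt|ge] := ltnP i (size la); first by rewrite nth_mkseq.
rewrite nth_default ?size_mkseq //; apply/esym/size0nil; rewrite size_row_of.
by rewrite /psum big1 // => t _; rewrite /cells !layer_out.
Qed.

Lemma all_tab c : all (all (mem s)) (tab c).
Proof. by apply/allP => _ /mapP[i _ ->]; apply: mem_row_of. Qed.

Lemma tab_SST c : good_chain c -> SST odd_deg la mu (tab c).
Proof.
move=> gc; have [ok l0] := andP gc; have okP := chain_okP _ _ _ ok.
have bE i t : bound mu (cells c) i t = ent (layer LA c t) i by exact: psum_cells.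
have lr i : ent (layer LA c r) i = nth 0 la i by rewrite layer_ge // ent_shp_of.
have st t i : t < r -> _ := fun tr => stripP _ _ _ (okP t tr) i.
split.
- rewrite /shape /tab /mkseq -map_comp; apply: eq_map => i /=.
  by rewrite size_row_of -lr -(psum_cells i r gc) addKn.
- apply/allP => _ /mapP[i _ ->]; apply/row_okE; split; first exact: sorted_row_of.
  move=> x ox; have [xs|xs] := boolP (x \in s); last first.
    by rewrite (count_memPn _) //; apply: contra xs; apply/allP/mem_row_of.
  rewrite count_row_of ?lt_sorted_uniq //.
  have ot : o (index x s) = true by rewrite /o -ox; exact: oE.
  have := st (index x s) i; rewrite index_mem ot => /(_ xs).
  by rewrite /cells; lia.
- apply: (columns_ok_bound odd_deg ss (fun i => nth_tab i gc) _ _ _).2.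
  + by move=> i t; rewrite size_mkseq => ge; rewrite /cells !layer_out.
  + by move=> i; apply: part_dec.
  + by move=> i; rewrite !bE !lr; apply: part_dec.
  + move=> i t tr; rewrite !bE -/(o t); have := st t i tr; case: (o t).
      by move=> _; apply/dominantP/(layer_dominant _ _ ok)/dominant_shp_of.
    by case/andP.
Qed.

Lemma count_tab c x : good_chain c -> x \in s ->
  weigh (layer LA c (index x s)) + count_mem x (flatten (tab c)) = weigh (layer LA c (index x s).+1).
Proof.
move=> gc xs; have [ok _] := andP gc.
rewrite count_flatten sumnE !big_map.
rewrite [iota 0 _](_ : _ = index_iota 0 (size la)) ?big_mkord; last by rewrite /index_iota subn0.
have -> : \sum_(i < size la) count_mem x (row_of (cells c i) s) = \sum_(i < n) cells c i (index x s).
  rewrite (big_ord_widen n (fun i => count_mem x (row_of (cells c i) s))) // big_mkcond.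
  apply: eq_bigr => i _; rewrite count_row_of ?lt_sorted_uniq //.
  by case: ltnP => // ge; rewrite /cells !layer_out.
rewrite /weigh -big_split; apply: eq_bigr => i _; rewrite /= /cells subnKC //.
exact: (layer_le _ ok).
Qed.

Lemma tab_inj c c' : good_chain c -> good_chain c' -> tab c = tab c' -> c = c'.
Proof.
move=> gc gc' e; have us := lt_sorted_uniq ss.
have ce i t : t < r -> cells c i t = cells c' i t.
  move=> tr; have [x xs <-] := ex_letter ss tr.
  by rewrite -!(count_row_of _ us xs) -!nth_tab // e.
apply/ffunP => t; rewrite -!(layer_ord LA); apply: shp_ext => i _.
rewrite -!psum_cells //; congr (_ + _); apply: psum_eq => u ut.
by apply: ce; apply: ltn_trans ut _.
Qed.

(** The chain is recovered from the multiplicities in the rows: row i of layer t ends where the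
    letters from t on begin. *)
Lemma SST_tab T : SST odd_deg la mu T -> all (all (mem s)) T ->
  exists2 c, good_chain c & T = tab c.
Proof.
case=> shT rowT colT memT; have us := lt_sorted_uniq ss.
have szT : size T = size la by have := congr1 size shT; rewrite size_map size_mkseq.
pose f i t := nth 0 [seq count_mem x (nth [::] T i) | x <- s] t.
have f0 i t : size T <= i -> f i t = 0.
  move=> ge; rewrite /f (nth_default [::] ge); have [lt|ge'] := ltnP t (size s).
    by have [x _ _] := ex_letter ss lt; rewrite (nth_map x).
  by rewrite nth_default // size_map.
have rowE i : nth [::] T i = row_of (f i) s.
  have [lt|ge] := ltnP i (size T).
    apply: row_ofE => //; last by apply: (allP memT); apply: mem_nth.
    by have /row_okE[] := allP rowT _ (mem_nth [::] lt).
  rewrite {1}nth_default //; apply/esym/size0nil; rewrite size_row_of /psum big1 // => t _.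
  exact: f0.
have fr i : bound mu f i r = nth 0 la i.
  rewrite /bound -size_row_of -rowE; have [lt|ge] := ltnP i (size la); last first.
    rewrite (nth_default [::]) ?szT // addn0; apply/eqP; rewrite (nth_default 0 ge) -leqn0.
    by have := mu_la i; rewrite (nth_default 0 ge).
  have := congr1 (fun p => nth 0 p i) shT; rewrite /shape (nth_map [::]) ?szT // nth_mkseq // => ->.
  by rewrite subnKC.
have /(columns_ok_bound odd_deg ss rowE f0) cb := colT.
have {}cb i t : t < r -> bound mu f i.+1 t.+1 <= if o t then bound mu f i t.+1 else bound mu f i t.
  by apply: cb => [j|j]; rewrite ?fr; apply: part_dec.
pose c : shps r n D := [ffun t : 'I_r => mkshp n D (fun i => bound mu f i t)].
have lE t i : t <= r -> ent (layer LA c t) i = bound mu f i t.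
  rewrite leq_eqVlt => /orP[/eqP ->|lt]; first by rewrite layer_ge // ent_shp_of // fr.
  rewrite -[t]/(val (Ordinal lt)) layer_ord ffunE /=.
  have bD : bound mu f i t <= nth 0 la i by rewrite -fr; apply: bound_le; exact: ltnW.
  have [iln|nli] := ltnP i n; first by rewrite ent_mkshp // (leq_trans bD).
  by apply/esym/eqP; rewrite ent_ge // -leqn0 (leq_trans bD) // nth_default // (leq_trans la_n).
have bdec i t : t <= r -> bound mu f i.+1 t <= bound mu f i t.
  case: t => [|t] tr; first by rewrite /bound /psum !big_ord0 !addn0 part_dec.
  apply: leq_trans (cb i t tr) _; case: ifP => // _; exact: bound_le.
exists c.
  apply/andP; split; last by apply/eqP/shp_ext => i _; rewrite lE // ent_shp_of // /bound /psum big_ord0 addn0.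
  apply/chain_okP => t tr; apply/stripP => i; rewrite !lE ?(ltnW tr) // bound_le //=.
  have := cb i t tr; have ot : o t = nth false [seq odd_deg x | x <- s] t by [].
  case oo: (o t) => // _; rewrite bdec ?(ltnW tr) // andbT /bound psumS addnA -addn1 leq_add2l.
  have [x xs xt] := ex_letter ss tr; rewrite -xt -(count_row_of (f i) us xs) -rowE.
  have ox : odd_deg x by rewrite -(oE odd_deg xs) xt.
  have [lt|ge] := ltnP i (size T); last by rewrite nth_default.
  by have /row_okE[_] := allP rowT _ (mem_nth [::] lt); apply.
apply: (@eq_from_nth _ [::]); first by rewrite size_mkseq.
move=> i lt; rewrite nth_mkseq -?szT // rowE; apply: row_of_eq => t tr.
by rewrite /cells !lE ?(ltnW tr) // /bound psumS addnA addKn.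
Qed.

Lemma enumerates_tab (Q : set (seq (seq A))) (Q' : pred (shps r n D)) :
    (forall T, Q T -> SST odd_deg la mu T /\ all (all (mem s)) T) ->
    (forall c, good_chain c -> Q (tab c) <-> Q' c) ->
  enumerates Q [seq tab c | c in [pred c | good_chain c && Q' c]].
Proof.
move=> QS QQ'; split.
  rewrite map_inj_in_uniq ?enum_uniq // => c c'; rewrite !mem_enum !inE.
  by case/andP=> gc _ /andP[gc' _]; apply: tab_inj.
move=> T; split.
  move=> QT; have [ST mT] := QS T QT; have [c gc e] := SST_tab ST mT.
  apply/mapP; exists c => //; rewrite mem_enum inE gc /=; apply/(QQ' c gc).
  by rewrite -e.
by case/mapP => c; rewrite mem_enum inE => /andP[gc Qc] ->; apply/(QQ' c gc).
Qed.

End TableauxOfChains.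

Section TableauCount.
Context {d : Order.disp_t} {A : orderType d}.
Variables (odd_deg : A -> bool) (s : seq A) (la mu : seq nat) (n D : nat).
Hypotheses (ss : sorted <%O s) (dla : is_part la) (dmu : is_part mu).
Hypotheses (la_n : size la <= n) (mu_n : size mu <= n).
Hypotheses (la_D : forall i, nth 0 la i <= D) (mu_la : part_sub mu la).

(** Multiplicities that vanish off s confine the entries to the finite list s, although A may be
    infinite. *)
Lemma SST_enum (k : A -> nat) : (forall x, x \notin s -> k x = 0) ->
  exists2 l, enumerates [set T | SST odd_deg la mu T /\
                           forall x, count_mem x (flatten T) = k x] l
    & Posz (size l) = chains (word (fun t => nth false [seq odd_deg x | x <- s] t)
                                   (fun t => nth 0 [seq k x | x <- s] t) (size s))
                             (single (shp_of n D mu)) (shp_of n D la).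
Proof.
move=> k0; pose a t := nth 0 [seq k x | x <- s] t.
pose Q' (c : {ffun 'I_(size s) -> shp n D}) := [forall t : 'I_(size s),
  weigh (layer (shp_of n D la) c t) + a t == weigh (layer (shp_of n D la) c t.+1)].
have aE x : x \in s -> a (index x s) = k x.
  by move=> xs; rewrite /a (nth_map x) ?index_mem // nth_index.
have us := lt_sorted_uniq ss.
exists [seq @tab _ _ s la n D c | c in [pred c | good_chain odd_deg la mu c && Q' c]].
  apply: enumerates_tab => // [T [ST cT]|c gc].
    split=> //; apply/allP => p pT; apply/allP => x xp; apply: contraT => xs.
    have : x \in flatten T by apply/flattenP; exists p.
    by rewrite -has_pred1 has_count cT k0.
  split=> [[_ cT]|/forallP h].
    apply/forallP => t; have [x xs xt] := ex_letter ss (ltn_ord t).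
    by rewrite -xt aE // -cT (count_tab ss la_n la_D gc xs).
  split; first exact: tab_SST.
  move=> x; have [xs|xs] := boolP (x \in s); last first.
    rewrite k0 //; apply/count_memPn; apply: contra xs => /flattenP[p pT].
    by apply: allP; apply: (allP (all_tab _ _)) pT.
  have xi : index x s < size s by rewrite index_mem.
  have := h (Ordinal xi) => /= /eqP; rewrite aE // => e.
  by apply/eqP; rewrite -(eqn_add2l (weigh (layer (shp_of n D la) c (index x s)))) e (count_tab ss la_n la_D gc xs).
rewrite size_map -cardE chains_layers -sum1_card (big_morph Posz PoszD (erefl 0%R)).
rewrite big_mkcond [RHS]big_mkcond; apply: eq_bigr => c _.
rewrite inE /good_chain /single -/a -/(Q' c).
by case: (chain_ok _ _ _); case: (Q' c); case: eqP.
Qed.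

End TableauCount.

(** * Littlewood-Richardson tableaux *)

Section LatticeConditions.
Variable n : nat.
Implicit Types f : nat -> nat.

Lemma psum_tail f a J : a <= n -> (forall i, a <= i -> f i = J) ->
  psum f n = psum f a + (n - a) * J.
Proof.
move=> an h; rewrite -{1}(subnKC an); elim: (n - a) => [|e IH]; first by rewrite addn0 mul0n addn0.
by rewrite addnS psumS IH h ?leq_addr // mulSn; lia.
Qed.

(** Up to the constant n J this counts the cells of f in the columns from J on, those already read
    when columns are read from the right down to J. *)
Definition colsum J f := psum (fun i => maxn (f i) J) n.

Lemma colsumE J f a : a <= n -> (forall i, i < a -> J <= f i) ->
  (forall i, a <= i -> f i <= J) -> colsum J f = psum f a + (n - a) * J.
Proof.
move=> an h1 h2; rewrite /colsum (psum_tail an (J := J)) => [|i ai].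
  by congr (_ + _); apply: psum_eq => i /h1 /maxn_idPl.
by apply/maxn_idPr/h2.
Qed.

Variables B X T : nat -> nat.
Hypothesis TX : forall j, (X j <= T j) && (T j.+1 <= X j).
Hypothesis XB : forall j, (B j <= X j) && (X j.+1 <= B j).
Hypothesis Tn : forall j, n <= j -> T j = 0.

Lemma antitone_le f i j : (forall j, f j.+1 <= f j) -> i <= j -> f j <= f i.
Proof.
move=> h ij; rewrite -(subnKC ij); elim: (j - i) => [|k IH]; first by rewrite addn0.
by rewrite addnS (leq_trans (h _)).
Qed.

Let Tdec j : T j.+1 <= T j. Proof. by have := TX j; lia. Qed.
Let Xdec j : X j.+1 <= X j. Proof. by have := TX j; have := TX j.+1; lia. Qed.
Let Bdec j : B j.+1 <= B j. Proof. by have := XB j; have := XB j.+1; lia. Qed.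

(* Reading columns from right to left or rows from top to bottom gives the same
   lattice condition for a pair of consecutive letters. *)
Lemma lattice_rows_columns : (forall i, i < n -> ~~ is_bad B T X i) <->
  (forall J, colsum J T + colsum J B <= colsum J X + colsum J X).
Proof.
rewrite /is_bad; split=> [row J|col i iN]; last first.
  (* Column X i is where the letters k+1 of row i begin. Reading down to it takes in these letters
     but none of the letters k of row i. *)
  rewrite -leqNgt; have := col (X i).
  rewrite (@colsumE _ T i.+1) ?(@colsumE _ X i.+1) ?(@colsumE _ B i) //.
  - rewrite !psumS; have -> : n - i = (n - i.+1).+1 by lia.
    by rewrite mulSn; lia.
  - exact: ltnW.
  - by move=> j ji; have := antitone_le Xdec ji; have := XB j; lia.
  - by move=> j ij; have := antitone_le Xdec ij; have := XB j; lia.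
  - by move=> j; rewrite ltnS => /(antitone_le Xdec).
  - by move=> j /ltnW /(antitone_le Xdec).
  - by move=> j; rewrite ltnS => /(antitone_le Tdec); have := TX i; lia.
  - by move=> j /(antitone_le Tdec); have := TX i; lia.
have [[a aT]|no] := pselect (exists a, J < T a); last first.
  have TJ i : T i <= J by rewrite leqNgt; apply/negP => lt; apply: no; exists i.
  have e f : (forall i, f i <= J) -> colsum J f = psum (fun=> J) n.
    by move=> h; apply: psum_eq => i _; apply/maxn_idPr.
  by rewrite !e // => i; have := TJ i; have := TX i; have := XB i; lia.
have ub x : J < T x -> x <= n.
  by move=> lt; rewrite leqNgt; apply/negP => /ltnW /Tn T0; rewrite T0 in lt.
have ex : exists x, J < T x by exists a.
(* The last row of T that reaches beyond column J: below it all the maxima are J, and the row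
   condition at i gives the claim. *)
case: (ex_maxnP ex ub) => i iT max.
have out j : i < j -> T j <= J.
  by move=> ij; rewrite leqNgt; apply/negP => /max; lia.
have iN : i < n by rewrite ltnNge; apply/negP => /Tn T0; rewrite T0 in iT.
have big_T j : j <= i -> J < T j by move=> /(antitone_le Tdec); lia.
have big_X j : j < i -> J <= X j by move=> ji; have := big_T _ ji; have := TX j; lia.
have big_B j : j.+1 < i -> J <= B j by move=> ji; have := big_X _ ji; have := XB j; lia.
rewrite (@colsumE _ T i.+1) //; last by move=> j; rewrite ltnS => /big_T /ltnW.
have tail f : (forall j, f j <= T j) ->
    colsum J f = psum (fun j => maxn (f j) J) i.+1 + (n - i.+1) * J.
  move=> fT; apply: psum_tail => // j ij; apply/maxn_idPr.
  exact: leq_trans (fT j) (out j ij).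
rewrite !tail => [|j|j]; try by have := TX j; have := XB j; lia.
rewrite !psumS (psum_eq (f := fun j => maxn (X j) J) (h := X)); last first.
  by move=> j /big_X /maxn_idPl.
(* Only row i-1 of B can fall short of J, and it is at least X i. *)
have leB : psum (fun j => maxn (B j) J) i <= psum B i + (J - X i).
  case: i big_B {iT max out iN big_T big_X tail} => [|i] big_B; first by rewrite /psum !big_ord0.
  rewrite !psumS (psum_eq (f := fun j => maxn (B j) J) (h := B)).
    by have := XB i; lia.
  by move=> j ji; apply/maxn_idPl/big_B.
by have := row i iN; have := XB i; rewrite -leqNgt !psumS; lia.
Qed.

End LatticeConditions.

(** Columns increase strictly, so a letter k of a column is read before its k+1. Once k+1 has been
    read in a column, both counts already have their values at the end of that column; checking
    whole columns suffices. *)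
Lemma lattice_flatten (cs : seq (seq nat)) : all (sorted ltn) cs ->
  lattice_permutation (flatten cs) <->
  forall m k, count_mem k.+1 (flatten (take m cs)) <= count_mem k (flatten (take m cs)).
Proof.
move=> scs; split=> [lat m k|].
  have := lat (size (flatten (take m cs))) k.
  have -> // : take (size (flatten (take m cs))) (flatten cs) = flatten (take m cs).
  by rewrite -{2}(cat_take_drop m cs) flatten_cat take_size_cat.
move=> h i k; pose b (_ : nat) := 0.
(* The induction on columns needs the counts of the columns already read as an offset. *)
suff gen (b0 : nat -> nat) : (forall m k, b0 k.+1 + count_mem k.+1 (flatten (take m cs)) <=
    b0 k + count_mem k (flatten (take m cs))) ->
    forall i k, b0 k.+1 + count_mem k.+1 (take i (flatten cs)) <=
                b0 k + count_mem k (take i (flatten cs)).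
  exact: (gen b).
elim: cs b0 scs {h} => [|c cs IH] b0 /= => [_ h i' k'|/andP[sc sc'] h i' k'].
  exact: (h 0).
rewrite take_cat; case: ltnP => ic; last first.
  have := IH (fun k => b0 k + count_mem k c) sc' _ (i' - size c) k'.
  rewrite !count_cat !addnA; apply => m k0 /=.
  by have := h m.+1 k0; rewrite /= !count_cat -!addnA.
have h0 := h 0 k'; rewrite /= !addn0 in h0.
have h1 := h 1 k'; rewrite /= take0 cats0 in h1.
have uc : uniq c := sorted_uniq ltn_trans ltnn sc.
have le : count_mem k' (take i' c) + count_mem k' (drop i' c) = count_mem k' c.
  by rewrite -count_cat cat_take_drop.
have [kin|kout] := boolP (k'.+1 \in take i' c); last first.
  by rewrite (count_memPn kout) addn0 (leq_trans h0) ?leq_addr.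
have e1 : count_mem k'.+1 (take i' c) = count_mem k'.+1 c.
  by rewrite !count_uniq_mem ?take_uniq // kin (mem_take kin).
have e2 : count_mem k' (take i' c) = count_mem k' c.
  rewrite -le [X in _ + X](count_memPn _) ?addn0 //; apply/negP => kd.
  have := sc; rewrite (sorted_pairwise ltn_trans) -{1}(cat_take_drop i' c) pairwise_cat.
  by case/and3P=> /allrelP/(_ _ _ kin kd) /=; rewrite ltnNge leqnSn.
by rewrite e1 e2.
Qed.

Lemma sum_interval J W a b : J <= W -> a <= b -> b <= W ->
  \sum_(J <= j < W) ((a <= j < b) : nat) + maxn a J = maxn b J.
Proof.
move=> JW ab bW; rewrite -{1}(subKn JW); move: (leq_subr J W).
have -> : maxn a J = maxn a (W - (W - J)) by rewrite subKn.
have -> : maxn b J = maxn b (W - (W - J)) by rewrite subKn.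
elim: (W - J) => [|e IH] eW; first by rewrite subn0 big_geq //; lia.
rewrite big_ltn; last by lia.
have -> : (W - e.+1).+1 = W - e by lia.
have := IH (ltnW eW); case: leqP => h1; case: ltnP => h2 /=; lia.
Qed.

Lemma count_mem_pmap (I : Type) (T : eqType) (f : I -> option T) (x : T) (l : seq I) :
  count_mem x (pmap f l) = count (fun i => f i == Some x) l.
Proof. by elim: l => //= i l <-; case: (f i). Qed.

Section LRCount.
Variables (la mu nu : seq nat) (n D r : nat).
Hypotheses (dla : is_part la) (dmu : is_part mu) (dnu : is_part nu).
Hypotheses (la_n : size la <= n) (mu_n : size mu <= n).
Hypotheses (la_D : forall i, nth 0 la i <= D) (mu_D : forall i, nth 0 mu i <= D).
Hypothesis nu_r : forall k, r <= k -> nth 0 nu k = 0.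

Lemma sumn_weigh p : size p <= n -> (forall i, nth 0 p i <= D) ->
  sumn p = weigh (shp_of n D p).
Proof.
move=> pn pD; rewrite sumnE (big_nth 0) big_mkord (big_ord_widen n (nth 0 p)) //.
rewrite big_mkcond; apply: eq_bigr => i _; rewrite ent_shp_of //.
by case: ltnP => // h; rewrite nth_default.
Qed.

Let even (x : nat) := false.
Let LA := shp_of n D la.
Let MU := shp_of n D mu.
Let s := iota 0 r.
Let nuv : vec (size s) := [ffun t : 'I_(size s) => Posz (nth 0 nu t)].

Let ss : sorted <%O s. Proof. exact: iota_ltn_sorted. Qed.

Section FixedChain.
Hypothesis mu_la : part_sub mu la.
Variable c : {ffun 'I_(size s) -> shp n D}.
Hypothesis gc : good_chain even la mu c.

Let L t := ent (layer LA c t).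

Let idx k : k < r -> index k s = k.
Proof.
move=> kr; have e : nth 0 s k = k by rewrite nth_iota.
by rewrite -{1}e index_uniq ?size_iota ?iota_uniq.
Qed.

Let chainE : chain_ok horizontal LA c.
Proof.
case/andP: gc => ok _; apply/chain_okP => t tr; have := chain_okP _ _ _ ok t tr.
rewrite /horizontal (_ : nth _ _ _ = false) //.
by rewrite (nth_map 0).
Qed.

Let LW k i : L k i <= head 0 la.
Proof.
have ge : size s <= maxn (size s) k by rewrite leq_maxl.
rewrite (leq_trans (layer_le i chainE (leq_maxr (size s) k))) // layer_ge //.
rewrite ent_shp_of // -nth0; elim: i => // i; apply: leq_trans; exact: part_dec.
Qed.

Lemma count_column k j :
  count_mem k (column mu (tab la c) j) = \sum_(i < n) ((L k i <= j < L k.+1 i) : nat).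
Proof.
have out i : size la <= i -> (L k i <= j < L k.+1 i) = false.
  by move=> h; rewrite /L !(layer_out la_n la_D _ gc h) ltn0 andbF.
rewrite /column count_mem_pmap -(big_mkord predT (fun i => ((L k i <= j < L k.+1 i) : nat))).
rewrite size_mkseq -sum1_count.
rewrite (big_cat_nat (n := size la)) //= [X in _ + X]big1_seq ?addn0; last first.
  by move=> i; rewrite mem_index_iota => /andP[_ /andP[h _]]; rewrite out.
rewrite /index_iota subn0 big_mkcond; apply: eq_bigr => i _ /=.
rewrite (entryE mu ss (fun i => nth_tab la_n la_D i gc)) /bound.
rewrite !(psum_cells mu_n la_D mu_la _ _ gc) mem_iota /= add0n.
have [kr|rk] := ltnP k r; first by rewrite idx //; case: (_ && _).
suff -> : (L k i <= j < L k.+1 i) = false by [].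
by rewrite /L !layer_ge ?size_iota ?leqW //; apply/negP => /andP[h]; rewrite ltnNge h.
Qed.

Lemma lattice_word : lattice_permutation (LR_word la mu (tab la c)) <-> lattice LA c.
Proof.
have [_ _ cols] := tab_SST ss dla dmu la_n mu_n la_D mu_la gc.
pose w m : seq nat := flatten (take m [seq column mu (tab la c) j | j <- rev (iota 0 (head 0 la))]).
(* The number of letters k in the m rightmost columns is a difference of column sums of consecutive
   layers, so the condition after m columns is the one of [lattice_rows_columns]. *)
have sw m (k : nat) : count_mem k (w m) + colsum n (head 0 la - m) (L k) = colsum n (head 0 la - m) (L k.+1).
  rewrite /w -map_take take_rev drop_iota size_iota add0n count_flatten sumnE !big_map.
  rewrite (perm_big (index_iota (head 0 la - m) (head 0 la))) /=; last by rewrite perm_rev.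
  under eq_bigr => j _ do rewrite count_column.
  rewrite exchange_big /= /colsum /psum -big_split; apply: eq_bigr => i _ /=.
  by rewrite sum_interval ?leq_subr ?LW // (layer_le _ chainE).
rewrite /LR_word lattice_flatten; last first.
  apply/allP => _ /mapP[j _ ->]; have /andP[_] := cols j.
  by rewrite filter_predT.
have st t i : t < size s -> (L t i <= L t.+1 i) && (L t.+1 i.+1 <= L t i).
  by move=> tr; exact: (stripP _ _ _ (chain_okP _ _ _ chainE t tr) i).
have rc k : k.+1 < size s -> (forall i, i < n -> ~~ is_bad (L k) (L k.+2) (L k.+1) i) <->
    (forall J, colsum n J (L k.+2) + colsum n J (L k) <= colsum n J (L k.+1) + colsum n J (L k.+1)).
  move=> kr; apply: lattice_rows_columns => j; [exact: st|exact/st/ltnW|exact: ent_ge].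
split=> [h|/forallP lat m k].
  apply/forallP => i; apply/forallP => k; rewrite /violation; case: ltnP => //= kr.
  apply: (rc k kr).2 (ltn_ord i) => J.
  have [JW|WJ] := leqP J (head 0 la).
    have hk : count_mem k.+1 (w (head 0 la - J)) <= count_mem (nat_of_ord k) (w (head 0 la - J)) by exact: h.
    have := sw (head 0 la - J) k; have := sw (head 0 la - J) k.+1.
    by move: hk; rewrite subKn //; clear; lia.
  suff e t : colsum n J (L t) = psum (fun=> J) n by rewrite !e.
  by apply: psum_eq => j _; apply/maxn_idPr; rewrite (leq_trans (LW _ _)) // ltnW.
suff : count_mem k.+1 (w m) <= count_mem k (w m) by [].
have := sw m k; have := sw m k.+1.
have [kr|rk] := ltnP k.+1 (size s).
  have /(rc k kr).1/(_ (head 0 la - m)) : forall i, i < n -> ~~ is_bad (L k) (L k.+2) (L k.+1) i.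
    move=> i iN; have := lat (Ordinal iN) => /forallP/(_ (Ordinal (ltnW kr))).
    by rewrite /violation kr.
  by lia.
have -> : L k.+2 = L k.+1 by rewrite /L !layer_ge // leqW.
lia.
Qed.

Lemma content_count : (forall k, count_mem k (flatten (tab la c)) = nth 0 nu k) <->
  content LA c = nuv.
Proof.
split=> [h|/ffunP h k].
  apply/ffunP => t; rewrite !ffunE -h; have tr : t < r by rewrite -[r](size_iota 0).
  have ts : (t : nat) \in s by rewrite mem_iota.
  have := count_tab ss la_n la_D gc ts; rewrite idx // -/LA => <-.
  by rewrite PoszD addrAC subrr add0r.
have [kr|rk] := ltnP k r; last first.
  rewrite nu_r //; apply/count_memPn/negP => /flattenP[p pT kp].
  have := allP (all_tab la c) p pT => /allP/(_ k kp).
  by rewrite /= mem_iota ltnNge rk.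
have ks : k < size s by rewrite size_iota.
have kin : k \in s by rewrite mem_iota.
have := h (Ordinal ks); rewrite !ffunE /=.
have := count_tab ss la_n la_D gc kin; rewrite idx // -/LA => <-.
by rewrite PoszD addrAC subrr add0r => -[].
Qed.

Lemma content_sum : content LA c = nuv -> sumn la = sumn mu + sumn nu.
Proof.
move=> /ffunP h; rewrite (sumn_weigh la_n la_D) (sumn_weigh mu_n mu_D).
have [_ /eqP l0] := andP gc.
have e t : t <= size s -> weigh (layer LA c t) = weigh MU + psum (nth 0 nu) t.
  elim: t => [|t IH] tr; first by rewrite l0 /psum big_ord0 addn0.
  by have := h (Ordinal tr); rewrite !ffunE psumS /= addnA -IH ?(ltnW tr) //; lia.
have := e _ (leqnn _); rewrite layer_ge // -/LA => ->; congr (_ + _).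
rewrite size_iota sumnE (big_nth 0) big_mkord.
have [rn|nr] := leqP r (size nu).
  rewrite /psum (big_ord_widen _ (nth 0 nu) rn) big_mkcond; apply: eq_bigr => i _.
  by case: ltnP => // /nu_r.
rewrite (big_ord_widen _ (nth 0 nu) (ltnW nr)) [RHS]big_mkcond; apply: eq_bigr => i _.
by case: ltnP => // /(nth_default 0).
Qed.

End FixedChain.

Lemma LR_enum : exists2 l, enumerates (LR la mu nu) l &
  size l = lr_count LA MU ([ffun t : 'I_r => Posz (nth 0 nu t)] : vec r).
Proof.
suff : exists2 l, enumerates (LR la mu nu) l & size l = lr_count LA MU nuv.
  by rewrite /nuv /s size_iota.
have [mu_la|nsub] := pselect (part_sub mu la); last first.
  exists [::]; first by split=> // T; split=> // -[_ [/nsub]].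
  apply/esym/eqP; rewrite cards_eq0; apply/eqP/setP => c; rewrite !inE.
  apply/negP => /and4P[ok /eqP l0 _ _]; apply: nsub => i.
  have := layer_le i ok (leq0n (size s)); rewrite l0 layer_ge // !ent_shp_of //.
exists [seq tab la c | c in [pred c : {ffun 'I_(size s) -> shp n D} |
    good_chain even la mu c & lattice LA c && (content LA c == nuv)]].
  apply: enumerates_tab => // [T [_ [_ _ ST cT _]]|c gc].
    split=> //; apply/allP => p pT; apply/allP => k kp; rewrite /= mem_iota /= add0n.
    rewrite ltnNge; apply/negP => /nu_r; rewrite -cT => /count_memPn/negP; apply.
    by apply/flattenP; exists p.
  split=> [[_ [_ _ _ cT lat]]|/andP[lat /eqP ct]].
    by apply/andP; split; [apply/(lattice_word mu_la gc)|apply/eqP/(content_count gc)].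
  split; first by split.
  split=> //; first exact: content_sum ct.
  - exact: tab_SST.
  - exact/(content_count gc).
  - exact/(lattice_word mu_la gc).
have eo : (fun t => nth false [seq even x | x <- s] t) = horizontal.
  apply: funext => t; rewrite /horizontal.
  have [lt|ge] := ltnP t (size s); first by rewrite (nth_map 0).
  by rewrite nth_default // size_map.
rewrite size_map -cardE; apply: eq_card => c.
by rewrite !inE /good_chain eo -!andbA.
Qed.

End LRCount.

(** * Finite unions, column shifts and brackets with rectangles *)

Lemma mset_out (C : choiceType) (s : seq C) (X : {mset C}%mset) x :
  {subset finsupp X <= s} -> x \notin s -> X x = 0.
Proof. by move=> h xs; apply/eqP; rewrite mset_eq0 -msuppE; apply: contra xs; apply: h. Qed.

Lemma nth_leq_sumn (q : seq nat) i : nth 0 q i <= sumn q.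
Proof. by elim: q i => [|y q IH] [|i] //=; rewrite ?leq_addr // (leq_trans (IH i)) ?leq_addl. Qed.

Lemma enumerates_ext (T : eqType) (S S' : set T) l :
  (forall x, S x <-> S' x) -> enumerates S l -> enumerates S' l.
Proof. by move=> e [ul h]; split=> // x; rewrite -e. Qed.

Lemma enumerates_prod (T T' : eqType) (S : set T) (S' : set T') l l' :
  enumerates S l -> enumerates S' l' ->
  enumerates [set x : T * T' | S x.1 /\ S' x.2] [seq (x, y) | x <- l, y <- l'].
Proof.
move=> [ul h] [ul' h']; split; first by apply: allpairs_uniq => // -[a b] [c e] _ _ [-> ->].
case=> a b /=; rewrite h h'; split=> [[al bl]|/allpairsP[[c e] [/= cl el [-> ->]]]] //.
by apply/allpairsP; exists (a, b).
Qed.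

Lemma enumerates_union (I T : eqType) (e : seq I) (S : I -> set T) (c : I -> int) :
    uniq e -> (forall i j x, i \in e -> j \in e -> S i x -> S j x -> i = j) ->
    (forall i, i \in e -> exists2 l, enumerates (S i) l & Posz (size l) = c i) ->
  exists2 l, enumerates [set x | exists2 i, i \in e & S i x] l &
    Posz (size l) = (\sum_(i <- e) c i)%R.
Proof.
elim: e => [|i e IH] /= => [_ _ _|/andP[ie ue] disj h].
  by exists [::]; rewrite ?big_nil //; split=> // x; split=> // -[].
have [l [ul lS] lc] := h i (mem_head _ _).
have [l' [ul' lS'] lc'] := IH ue
  (fun a b x ha hb => disj a b x (mem_behead (s := i :: e) ha) (mem_behead (s := i :: e) hb))
  (fun a ha => h a (mem_behead (s := i :: e) ha)).
exists (l ++ l'); last by rewrite size_cat PoszD lc lc' big_cons.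
split; last first.
  move=> x; rewrite mem_cat; split=> [[j]|/orP[/lS xi|/lS' [j je Sj]]].
  - rewrite inE => /orP[/eqP -> /lS ->//|je Sj].
    by apply/orP; right; apply/lS'; exists j.
  - by exists i; rewrite ?mem_head.
  - by exists j; rewrite // inE je orbT.
rewrite cat_uniq ul ul' andbT /=; apply/hasPn => x /lS' [j je Sj].
apply/negP => /lS Si; case/negP: ie.
by rewrite (disj i j x) ?mem_head // inE je orbT.
Qed.

Section SSTShift.
Context {d : Order.disp_t} {A : orderType d}.
Variable odd_deg : A -> bool.

Lemma SST_shift (la la' mu mu' : seq nat) (e : nat) (T : seq (seq A)) :
    size la' = size la -> (forall i, i < size la -> nth 0 la' i = nth 0 la i + e) ->
    (forall i, i < size la -> nth 0 mu' i = nth 0 mu i + e) ->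
  SST odd_deg la mu T <-> SST odd_deg la' mu' T.
Proof.
move=> szE laE muE.
have shE : mkseq (fun i => nth 0 la' i - nth 0 mu' i) (size la') =
           mkseq (fun i => nth 0 la i - nth 0 mu i) (size la).
  rewrite szE; apply/eq_in_map => i; rewrite mem_iota => /andP[_ lt].
  by rewrite laE // muE // subnDr.
have colE j : size T = size la -> column mu' T (j + e) = column mu T j.
  move=> szT; rewrite /column; apply: eq_in_pmap => i; rewrite mem_iota szT => /andP[_ lt].
  by rewrite /entry muE // leq_add2r subnDr.
have col0 j : size T = size la -> j < e -> column mu' T j = [::].
  move=> szT je; rewrite /column (eq_in_pmap (f2 := fun=> None)); first by elim: iota.
  move=> i; rewrite mem_iota szT => /andP[_ lt]; rewrite /entry muE // leqNgt.
  by rewrite (leq_trans je) ?leq_addl.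
have szT (p q : seq nat) : shape T = mkseq (fun i => nth 0 p i - nth 0 q i) (size p) -> size T = size p.
  by move=> /(congr1 size); rewrite size_map size_mkseq.
split=> -[sh rw cl]; split=> //; try by rewrite sh shE.
- move=> j; have [lt|ge] := ltnP j e; first by rewrite col0 // (szT _ _ sh).
  by rewrite -(subnK ge) colE ?(szT _ _ sh).
- by move=> j; rewrite -colE ?(szT _ _ sh) ?szE.
Qed.

End SSTShift.

Lemma chains_support n D w (la mu : shp n D) : dominant la -> chains w (single mu) la != 0%R ->
  dominant mu /\ forall i, ent mu i <= ent la i.
Proof.
elim: w la => [|l w IH] la dla /=.
  by rewrite /single; have [<-|//] := eqVneq la mu.
move=> nz; have [ka /andP[st _] nzk] : exists2 ka : shp n D,
    strip l.1 la ka && (weigh ka + l.2 == weigh la) & chains w (single mu) ka != 0%R.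
  apply: contrapT => no; case/negP: nz; apply/eqP; apply: big1 => ka h.
  by apply/eqP; apply: contrapT => /negP nz'; apply: no; exists ka.
have [dm le] := IH ka (strip_dominant dla st) nzk; split=> // i.
by apply: leq_trans (le i) _; case/andP: (stripP _ _ _ st i).
Qed.

Section RationalBracket.
Variables n D : nat.
Implicit Types la mu : shp n D.

Definition negpos (wA wB : seq (bool * nat)) : seq letter :=
  poslet wA ++ map flip (poslet wB).

Definition rect p : shp n D := mkshp n D (fun=> p).

Lemma ent_rect p i : p <= D -> i < n -> ent (rect p) i = p.
Proof. by move=> pD iN; rewrite ent_mkshp. Qed.

Lemma dominant_rect p : p <= D -> dominant (rect p).
Proof.
move=> pD; apply/dominantP => i; have [lt|ge] := ltnP i.+1 n; last by rewrite ent_ge.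
by rewrite !ent_rect // ltnW.
Qed.

Lemma chains_sum w w' la ka :
  chains w (fun mu => chains w' (single mu) ka) la =
  (\sum_mu chains w (single mu) la * chains w' (single mu) ka)%R.
Proof.
rewrite (eq_bigr (fun mu => chains w' (single mu) ka * chains w (single mu) la)%R); last first.
  by move=> mu _; rewrite mulrC.
rewrite -chains_lin; congr (chains _ _ _); apply: funext => nu.
rewrite (bigD1 nu) //= /single eqxx mulr1 big1 ?addr0 // => mu ne.
by rewrite eq_sym (negPf ne) mulr0.
Qed.

(** The Pieri rule for the letters of A leads from la down to some mu. The letters of B act by
    inverse variables, and [bracket_flip] turns this into chains from the rectangle down to the same
    mu. The sum thus counts pairs of tableaux at level p. *)
Lemma bracket_negpos wA wB p la : dominant la -> p <= D ->
    all (fun l => l.2 <= D) wA -> sumn (unzip2 wB) <= p ->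
  bracket (kernel D (negpos wA wB)) (tovec la) (tovec (rect p)) =
  (\sum_mu chains wA (single mu) la * chains wB (single mu) (rect p))%R.
Proof.
move=> dla pD aA sB; rewrite -chains_sum bracket_kernel /negpos Xop_cat.
have aB : all (fun l => l.2 <= D) wB.
  apply/allP => l lw; apply: leq_trans pD; apply: leq_trans sB.
  elim: wB lw => //= l' w IH; rewrite inE => /orP[/eqP ->|/IH h]; first exact: leq_addr.
  by rewrite (leq_trans h) ?leq_addl.
rewrite pieri //; last 2 first.
- exact/Xop_antisym/alternant_antisym.
(* The alternant of the rectangle has exponents at least p, and a letter of degree k lowers them by
   at most k; total degree at most p keeps them non-negative, as the Pieri rule requires. *)
- have h (w : seq (bool * nat)) c : sumn (unzip2 w) <= c <= p ->
      vanish_below (Posz c - Posz (sumn (unzip2 w)))%R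
        (Xop D (map flip (poslet w)) (alternant (tovec (rect p) + @delta n)%R)).
    elim: w => [|[o k] w IH] /= h.
      move=> g i; rewrite subr0 => gi; rewrite /Xop /=; apply: big1 => s _; case: eqP => [e|_]; last by rewrite mulr0.
      by move: gi; rewrite e !ffunE inordK //; lia.
    rewrite /Xop /= PoszD opprD addrA -[foldr _ _ _]/(Xop D (map flip (poslet w)) _) addrAC.
    by apply: xop_vanish_neg; apply: IH; lia.
  move=> g i gi; apply: (h wB p _ g i); first by rewrite sB leqnn.
  by apply: lt_le_trans gi _; rewrite subr_ge0 lez_nat.
apply: chains_ext => // mu dmu.
by rewrite -bracket_kernel bracket_flip chains_bracket // dominant_rect.
Qed.

End RationalBracket.

(** * Rational tableaux *)

Section ShiftParts.
Variables (n : nat) (lam : n.-tuple int).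

Lemma nth_shift_part p i : shiftable p lam -> i < n ->
  Posz (nth 0 (shift_part p lam) i) = (nth 0 lam i + Posz p)%R.
Proof.
move=> /allP sh lt; rewrite /shift_part (nth_map 0%R) ?size_tuple // gez0_abs //.
by apply: sh; rewrite mem_nth // size_tuple.
Qed.

Lemma size_shift_part p : size (shift_part p lam) = n.
Proof. by rewrite size_map size_tuple. Qed.

Lemma gen_part_nth i : gen_part lam -> i.+1 < n -> (nth 0 lam i.+1 <= nth 0 lam i :> int)%R.
Proof. by move=> /(sortedP 0%R) h lt; apply: h; rewrite size_tuple. Qed.

Lemma is_part_shift p : gen_part lam -> shiftable p lam -> is_part (shift_part p lam).
Proof.
move=> gl sh; apply/(sortedP 0) => i; rewrite size_shift_part => lt.
have := gen_part_nth gl lt; have := nth_shift_part sh lt.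
have := nth_shift_part sh (ltnW lt); rewrite /geq /=; lia.
Qed.

Lemma dominant_shift p D : gen_part lam -> shiftable p lam ->
  (forall i, nth 0 (shift_part p lam) i <= D) -> dominant (shp_of n D (shift_part p lam)).
Proof. by move=> gl sh lD; apply: dominant_shp_of; rewrite ?size_shift_part ?is_part_shift. Qed.

Lemma is_part_mkseq (f : nat -> nat) k : (forall i, i.+1 < k -> f i.+1 <= f i) ->
  is_part (mkseq f k).
Proof.
move=> h; apply/(sortedP 0) => i; rewrite size_mkseq => lt.
by rewrite !nth_mkseq ?(ltnW lt) //; apply: h.
Qed.

Lemma shiftable_le p q : p <= q -> shiftable p lam -> shiftable q lam.
Proof.
move=> pq /allP sh; apply/allP => x /sh h; apply: le_trans h _.
by rewrite lerD2l lez_nat.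
Qed.

End ShiftParts.

Section Rational.
Context {dA dB : Order.disp_t} {A : orderType dA} {B : orderType dB}.
Variables (oddA : A -> bool) (oddB : B -> bool).

(** A row of the second tableau has length p0 - mu0_i, at most the number of all its entries, so p
    columns to the left of the vertical line are enough for every row. *)
Lemma ratSST_level (n p : nat) (lam : n.-tuple int) (T : seq (seq A) * seq (seq B)) :
    size (flatten T.2) <= p -> ratSST oddA oddB lam T ->
  shiftable p lam /\ exists mu : seq nat,
    [/\ size mu = n, is_part mu, part_sub mu (nseq n p) & part_sub mu (shift_part p lam)] /\
    SST oddA (shift_part p lam) mu T.1 /\ SST oddB (nseq n p) mu T.2.
Proof.
move=> T2p [gl [p0 [mu0 [[sh0 dmu0 sub1 sub2] [S1 S2]]]]].
have mu0p i : i < n -> nth 0 mu0 i <= p0.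
  by move=> lt; have := sub1 i; rewrite nth_nseq lt.
have row i : i < n -> p0 - nth 0 mu0 i <= p.
  move=> lt; have [sh _ _] := S2; apply: leq_trans T2p.
  rewrite size_flatten sh; apply: leq_trans (nth_leq_sumn _ i).
  by rewrite nth_mkseq ?size_nseq // nth_nseq lt.
have lam0 i : i < n -> nth 0 mu0 i <= nth 0 (shift_part p0 lam) i by move=> _; apply: sub2.
have shp : shiftable p lam.
  apply/(all_nthP 0%R) => i; rewrite size_tuple => lt.
  have := lam0 i lt; have := nth_shift_part sh0 lt; have := row i lt; have := mu0p i lt; lia.
(* The truncated subtraction is exact because p0 - mu0_i <= p. *)
split=> //; pose mu := mkseq (fun i => p + nth 0 mu0 i - p0) n.
have muE i : i < n -> nth 0 mu i = p + nth 0 mu0 i - p0 by move=> lt; rewrite nth_mkseq.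
have mu_out i : n <= i -> nth 0 mu i = 0 by move=> ge; rewrite nth_default ?size_mkseq.
exists mu; split.
  split; first by rewrite size_mkseq.
  - by apply: is_part_mkseq => i lt; have := part_dec i dmu0; lia.
  - move=> i; have [lt|ge] := ltnP i n; last by rewrite mu_out.
    by rewrite muE // nth_nseq lt; have := mu0p i lt; lia.
  - move=> i; have [lt|ge] := ltnP i n; last by rewrite mu_out.
    rewrite muE //; have := lam0 i lt; have := nth_shift_part sh0 lt.
    by have := nth_shift_part shp lt; have := row i lt; lia.
have la_e i : i < n -> nth 0 (shift_part p lam) i + p0 = nth 0 (shift_part p0 lam) i + p.
  by move=> lt; have := nth_shift_part sh0 lt; have := nth_shift_part shp lt; lia.
have mu_e i : i < n -> nth 0 mu i + p0 = nth 0 mu0 i + p.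
  by move=> lt; rewrite muE //; have := row i lt; have := mu0p i lt; lia.
have [le|ge] := leqP p0 p; split.
- apply/(SST_shift oddA (la := shift_part p0 lam) (mu := mu0) (e := p - p0)) => //;
    rewrite ?size_shift_part // => i; [move/la_e|move/mu_e]; lia.
- apply/(SST_shift oddB (la := nseq n p0) (mu := mu0) (e := p - p0)) => //;
    rewrite ?size_nseq // => i lt; [rewrite !nth_nseq lt|have := mu_e i lt]; lia.
- apply/(SST_shift oddA (la' := shift_part p0 lam) (mu' := mu0) (e := p0 - p)) => //;
    rewrite ?size_shift_part // => i; [move/la_e|move/mu_e]; lia.
- apply/(SST_shift oddB (la' := nseq n p0) (mu' := mu0) (e := p0 - p)) => //;
    rewrite ?size_nseq // => i lt; [rewrite !nth_nseq lt|have := mu_e i lt]; lia.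
Qed.

Definition letters (C : Type) (odd : C -> bool) (s : seq C) (k : C -> nat) : seq (bool * nat) :=
  rev [seq (odd x, k x) | x <- s].

Lemma word_letters (C : Type) (odd : C -> bool) (s : seq C) (k : C -> nat) :
  word (fun t => nth false [seq odd x | x <- s] t) (fun t => nth 0 [seq k x | x <- s] t) (size s)
  = letters odd s k.
Proof.
rewrite /word /letters; congr rev; apply: (@eq_from_nth _ (false, 0)).
  by rewrite size_mkseq size_map.
move=> i; rewrite size_mkseq => lt; rewrite nth_mkseq //.
by case: s lt => // x s lt; rewrite !(nth_map x).
Qed.

Lemma size_letters (C : eqType) (odd : C -> bool) (s : seq C) (k : C -> nat) (w : seq C) :
  uniq s -> {subset w <= s} -> (forall x, count_mem x w = k x) ->
  sumn (unzip2 (letters odd s k)) = size w.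
Proof.
move=> us ws kE; rewrite /letters /unzip2 map_rev sumn_rev -map_comp sumnE big_map /=.
under eq_bigr => x _ do rewrite -kE -sum1_count.
rewrite -sum1_size (exchange_big_dep predT) //= big_seq [RHS]big_seq.
apply: eq_bigr => x xw; rewrite sum1_count -(eq_count (a1 := pred1 x)).
  by rewrite count_uniq_mem // (ws x xw).
by move=> y; rewrite /= eq_sym.
Qed.

(** By [ratSST_level] every pair of weight w occurs at the fixed level p, so the existential choice
    of level disappears and only mu varies. *)
Lemma rat_enum (n p D : nat) (lam : n.-tuple int) (w : @monom dA dB A B) (sA : seq A) (sB : seq B) :
    gen_part lam -> shiftable p lam ->
    sorted <%O sA -> sorted <%O sB ->
    {subset finsupp w.1 <= sA} -> {subset finsupp w.2 <= sB} ->
    sumn (unzip2 (letters oddB sB w.2)) <= p -> p <= D ->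
    (forall i, nth 0 (shift_part p lam) i <= D) ->
  exists2 l, enumerates [set T | ratSST oddA oddB lam T /\ weight T = w] l &
    Posz (size l) = (\sum_mu chains (letters oddA sA w.1) (single mu) (shp_of n D (shift_part p lam))
      * chains (letters oddB sB w.2) (single mu) (rect n D p))%R.
Proof.
move=> gl shL ssA ssB sAw sBw Np pD laD.
have uA := lt_sorted_uniq ssA; have uB := lt_sorted_uniq ssB.
set LA := shp_of n D (shift_part p lam).
have dla := is_part_shift gl shL.
pose msq (mu : shp n D) := mkseq (ent mu) n.
pose SA (mu : shp n D) : set (seq (seq A)) := [set T |
  SST oddA (shift_part p lam) (msq mu) T /\ forall x, count_mem x (flatten T) = w.1 x]%classic.
pose SB (mu : shp n D) : set (seq (seq B)) := [set T |
  SST oddB (nseq n p) (msq mu) T /\ forall x, count_mem x (flatten T) = w.2 x]%classic.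
pose P := [pred mu : shp n D | [&& dominant mu, [forall i : 'I_n, ent mu i <= ent LA i]
  & [forall i : 'I_n, ent mu i <= p]]].
have msqE (mu : shp n D) i : nth 0 (msq mu) i = ent mu i.
  by have [lt|ge] := ltnP i n; [rewrite nth_mkseq|rewrite nth_default ?size_mkseq // ent_ge].
have msq_shp (mu : shp n D) : shp_of n D (msq mu) = mu.
  by apply: shp_ext => i lt; rewrite ent_mkshp ?msqE // ent_le.
have rect_shp : shp_of n D (nseq n p) = rect n D p.
  by apply: shp_ext => i lt; rewrite !ent_mkshp // ?nth_nseq ?lt.
have LAE i : ent LA i = nth 0 (shift_part p lam) i by rewrite ent_shp_of ?size_shift_part.
have partP (mu : shp n D) : P mu -> [/\ is_part (msq mu), part_sub (msq mu) (shift_part p lam)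
    & part_sub (msq mu) (nseq n p)].
  case/and3P=> /dominantP dm /forallP h1 /forallP h2; split.
  - by apply: is_part_mkseq => i _.
  - by move=> i; rewrite msqE -LAE; have [lt|ge] := ltnP i n; [exact: (h1 (Ordinal lt))|rewrite !ent_ge].
  - move=> i; rewrite msqE nth_nseq; have [lt|ge] := ltnP i n; last by rewrite ent_ge.
    exact: (h2 (Ordinal lt)).
have rectD i : nth 0 (nseq n p) i <= D by rewrite nth_nseq; case: ifP.
have part_rect : is_part (nseq n p).
  by apply/(sortedP 0) => i; rewrite size_nseq => lt; rewrite !nth_nseq lt (ltnW lt) /geq /=.
have [|i j x|mu|l el sl] := @enumerates_union _ _ (enum P) (fun mu : shp n D =>
    [set x : seq (seq A) * seq (seq B) | SA mu x.1 /\ SB mu x.2]%classic)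
    (fun mu => chains (letters oddA sA w.1) (single mu) LA *
               chains (letters oddB sB w.2) (single mu) (rect n D p))%R.
- exact: enum_uniq.
(* The rows of the second tableau have lengths p - mu_i, so different mu give disjoint sets. *)
- rewrite !mem_enum => Pi Pj [_ [[sh1 _ _] _]] [_ [[sh2 _ _] _]].
  apply: shp_ext => k lt; rewrite sh1 in sh2.
  have := congr1 (fun q => nth 0 q k) sh2; rewrite !nth_mkseq ?size_nseq // nth_nseq lt ?msqE.
  case/and3P: Pi => _ _ /forallP/(_ (Ordinal lt)) /= h1.
  by case/and3P: Pj => _ _ /forallP/(_ (Ordinal lt)) /= h2; lia.
- rewrite mem_enum => Pm; have [dm s1 s2] := partP mu Pm.
  have wA0 x := mset_out (x := x) sAw; have wB0 x := mset_out (x := x) sBw.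
  have szA : size (shift_part p lam) <= n by rewrite size_shift_part.
  have szB : size (nseq n p) <= n by rewrite size_nseq.
  have szm : size (msq mu) <= n by rewrite size_mkseq.
  have [lA eA cA] := SST_enum oddA ssA dla dm szA szm laD s1 wA0.
  have [lB eB cB] := SST_enum oddB ssB part_rect dm szB szm rectD s2 wB0.
  exists [seq (x, y) | x <- lA, y <- lB]; first exact: enumerates_prod eA eB.
  by rewrite size_allpairs PoszM cA cB !word_letters msq_shp rect_shp.
exists l; last first.
  (* A shape outside P cannot be reached by strips from both la and the rectangle. *)
  rewrite sl big_enum /= [RHS](bigID P) /= [X in (_ + X)%R]big1 ?addr0 // => mu nP.
  have [->|nzA] := eqVneq (chains (letters oddA sA w.1) (single mu) LA) 0%R; first by rewrite mul0r.
  have [->|nzB] := eqVneq (chains (letters oddB sB w.2) (single mu) (rect n D p)) 0%R; first by rewrite mulr0.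
  have dLA : dominant LA by apply: dominant_shp_of; rewrite ?size_shift_part.
  have [dm leA] := chains_support dLA nzA.
  have [_ leB] := chains_support (dominant_rect n pD) nzB.
  case/negP: nP; apply/and3P; split=> //; first by apply/forallP.
  by apply/forallP => i; rewrite (leq_trans (leB i)) // ent_rect.
have weightP (T : seq (seq A) * seq (seq B)) : weight T = w <->
    (forall x, count_mem x (flatten T.1) = w.1 x) /\ (forall x, count_mem x (flatten T.2) = w.2 x).
  case: T => T1 T2; case: w {sAw sBw Np SA SB el sl} => M N; rewrite /weight /=; split.
    by case=> <- <-; split=> x; rewrite mset_seqE.
  by case=> h1 h2; congr (_, _); apply/msetP => x; rewrite mset_seqE.
apply: enumerates_ext el => T; split.
  case=> mu; rewrite mem_enum => Pm [[S1 c1] [S2 c2]]; split; last by apply/weightP.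
  split=> //; have [dm s1 s2] := partP mu Pm.
  have szm : size (msq mu) == n by rewrite size_mkseq.
  by exists p, (Tuple szm).
case=> rT /weightP [c1 c2].
have T2p : size (flatten T.2) <= p.
  apply: leq_trans Np; rewrite (size_letters oddB uB (w := flatten T.2)) // => x xT.
  by apply: sBw; rewrite msuppE in_mset -c2 -has_count has_pred1.
have [_ [mu [[szm dm s1 s2] [S1 S2]]]] := ratSST_level T2p rT.
have muE : msq (shp_of n D mu) = mu.
  apply: (@eq_from_nth _ 0); rewrite size_mkseq // => i lt.
  by rewrite msqE ent_shp_of ?szm // => k; apply: leq_trans (s2 k) (laD k).
exists (shp_of n D mu); last by rewrite /= /SA /SB /= muE.
rewrite mem_enum; have muD k : nth 0 mu k <= D by apply: leq_trans (s2 k) (laD k).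
have szm' : size mu <= n by rewrite szm.
apply/and3P; split; first exact: dominant_shp_of.
  by apply/forallP => i; rewrite LAE ent_shp_of.
by apply/forallP => i; rewrite ent_shp_of //; have := s1 i; rewrite nth_nseq ltn_ord.
Qed.

End Rational.

(** * Splitting a product over two groups of variables *)

Section Splitting.
Variable D : nat.

Fixpoint splits (w : seq letter) : seq (seq letter * seq letter) :=
  if w is l :: w' then
    [seq ((l.1, i) :: q.1, (l.1, l.2 - i) :: q.2) | i <- iota 0 l.2.+1, q <- splits w']
  else [:: ([::], [::])].

#[local] Arguments splits : simpl never.

Lemma splits_cons l w : splits (l :: w) =
  [seq ((l.1, i) :: q.1, (l.1, l.2 - i) :: q.2) | i <- iota 0 l.2.+1, q <- splits w].
Proof. by []. Qed.

(** The coproduct of one letter, multiplied out: every letter of degree k is split as i + (k - i)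
    between the two groups. *)
Lemma kernel_catv m n (w : seq letter) (a : vec m) (b : vec n) :
  kernel D w (catv a b) = (\sum_(q <- splits w) kernel D q.1 a * kernel D q.2 b)%R.
Proof.
elim: w a b => [|[[s o] k] w IH] a b.
  rewrite big_seq1 /kernel /Xop /= /dirac -natrM mulnb; congr (nat_of_bool _)%:R%R.
  apply/eqP/andP => [e|[/eqP -> /eqP ->]].
    by split; apply/eqP/ffunP => i; rewrite -?(catv_l a b i) -?(catv_r a b i) e !ffunE.
  by apply/ffunP => i; rewrite !ffunE; case: (fintype.split i) => j; rewrite ffunE.
rewrite [splits _](_ : _ = [seq ((s, o, i) :: q.1, (s, o, k - i) :: q.2) |
  i <- index_iota 0 k.+1, q <- splits w]) // big_allpairs_dep big_mkord.
have step F F' : (forall v, F v = F' v) -> xop D (s, o, k) F (catv a b) = xop D (s, o, k) F' (catv a b).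
  by move=> e; apply: eq_bigr => x _.
rewrite [LHS](step _ (fun v => \sum_(q <- splits w) 1 *
   (kernel D q.1 [ffun i => v (lshift n i)] * kernel D q.2 [ffun i => v (rshift m i)]))%R); last first.
  move=> v; have ve : v = catv [ffun i => v (lshift n i)] [ffun i => v (rshift m i)].
    by apply/ffunP => i; case: (split_ordP i) => j ->; rewrite ?catv_l ?catv_r ffunE.
  transitivity (kernel D w (catv [ffun i => v (lshift n i)] [ffun i => v (rshift m i)])).
    by rewrite -ve.
  by rewrite IH; apply: eq_bigr => q _; rewrite mul1r.
have lin := @Xop_lin D (m + n) _ (splits w) (fun=> 1%R) (fun q v =>
   kernel D q.1 [ffun i => v (lshift n i)] * kernel D q.2 [ffun i => v (rshift m i)])%R
   [:: (s, o, k)] (catv a b).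
rewrite [LHS]lin exchange_big /=; apply: eq_bigr => q _; rewrite mul1r.
exact: xop_catv.
Qed.

Lemma hat2_kernel m n (w : seq letter) (mu : vec m) (nu : vec n) :
  hat2 (kernel D w) mu nu =
  (\sum_(q <- splits w) hat (kernel D q.1) mu * hat (kernel D q.2) nu)%R.
Proof.
rewrite /hat2; under eq_bigr => s _ do under eq_bigr => t _ do
  rewrite kernel_catv mulr_sumr mulr_sumr.
under eq_bigr => s _ do rewrite exchange_big.
rewrite exchange_big; apply: eq_bigr => q _ /=.
rewrite /hat mulr_suml; apply: eq_bigr => s _; rewrite mulr_sumr.
by apply: eq_bigr => t _; rewrite -!mulrA; congr (_ * _)%R; rewrite mulrCA.
Qed.

Lemma kernel_range n (w : seq letter) (v : vec n) i : kernel D w v != 0%R ->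
  (- Posz (\sum_(l <- w | l.1.1) l.2) <= v i <= Posz (\sum_(l <- w | ~~ l.1.1) l.2))%R.
Proof.
elim: w v => [|[[s o] k] w IH] v.
  by rewrite /kernel /Xop /= /dirac !big_nil; have [->|//] := eqVneq v 0%R; rewrite ffunE.
rewrite /kernel Xop_cons -/(kernel D w) /xop /= => nz.
have [e /andP[/eqP we _] /IH h] : exists2 e : shp n D, incr o k e &
    kernel D w (v - sgv s (tovec e))%R != 0%R.
  apply: contrapT => no; case/negP: nz; apply/eqP; apply: big1 => e ie.
  by apply/eqP; apply: contrapT => /negP h; apply: no; exists e.
have ei : ent e i <= k by rewrite -we /weigh (bigD1 i) //= leq_addr.
have vE : (v - sgv s (tovec e))%R i = (v i - if s then - Posz (ent e i) else Posz (ent e i))%R.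
  by rewrite /sgv; case: s {nz h}; rewrite !ffunE entE.
move: h ei; rewrite vE !big_cons /=; case: s {nz vE} => /=;
  move: (\sum_(l <- w | l.1.1) l.2) (\sum_(l <- w | ~~ l.1.1) l.2) (ent e i) => x y z;
  case: (v i) => t; lia.
Qed.

End Splitting.

Section WordSplits.
#[local] Arguments splits : simpl never.

Variables (K : eqType) (c : K -> bool * bool).
Implicit Types (ks : seq K) (k : K -> nat).

Definition kword ks k : seq letter := [seq (c x, k x) | x <- ks].

Lemma kword_eq ks k k' : kword ks k = kword ks k' -> {in ks, k =1 k'}.
Proof.
elim: ks => //= x ks IH [e /IH h] y; rewrite inE => /orP[/eqP ->|/h] //.
Qed.

Lemma splits_uniq w : uniq (splits w).
Proof.
elim: w => // -[cc k] w IH; rewrite splits_cons; apply: allpairs_uniq; rewrite ?iota_uniq //.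
by case=> [i [q1 q2]] [j [q3 q4]] _ _ /= [-> -> _ ->].
Qed.

Lemma kword_splits ks k k1 k2 : (forall x, x \in ks -> k1 x + k2 x = k x) ->
  (kword ks k1, kword ks k2) \in splits (kword ks k).
Proof.
elim: ks => // x ks IH h; have hx := h x (mem_head _ _).
rewrite /= splits_cons; apply/allpairsP; exists (k1 x, (kword ks k1, kword ks k2)); split=> /=.
- by rewrite -[X in _ \in X]/(iota 0 (k x).+1) mem_iota /= add0n ltnS -hx leq_addr.
- by apply: IH => y ys; apply: h; rewrite inE ys orbT.
- by rewrite -hx addKn.
Qed.

Lemma splits_kword ks k q : uniq ks -> q \in splits (kword ks k) ->
  exists k1 k2, (forall x, x \in ks -> k1 x + k2 x = k x) /\ q = (kword ks k1, kword ks k2).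
Proof.
elim: ks q => [|x ks IH] q /=; first by rewrite inE => _ /eqP ->; exists k, k.
rewrite splits_cons => /andP[xks uks] /allpairsP[[i q'] [/=]].
rewrite -[X in _ \in X]/(iota 0 (k x).+1) mem_iota /= add0n ltnS => ik /(IH _ uks)[k1 [k2 [h ->]]] ->.
have ext kk j : kword ks kk = kword ks (fun y => if y == x then j else kk y).
  by apply/eq_in_map => y ys; case: eqP ys xks => // -> ->.
exists (fun y => if y == x then i else k1 y), (fun y => if y == x then k x - i else k2 y).
split; last by rewrite /= eqxx -!ext.
move=> y; rewrite inE; case: eqP => [->|_ /= /h //]; by rewrite subnKC.
Qed.

End WordSplits.

Lemma enumerates_fset_set (T : choiceType) (S : set T) l :
  enumerates S l -> finite_set S /\ #|` fset_set S|%fset = size l.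
Proof.
case=> ul h; have SE : S = [set` l]%classic by apply/seteqP; split=> x; rewrite /= h.
have fS : finite_set S by rewrite SE; exact: finite_seq.
split=> //.
have -> : fset_set S = seq_fset tt l.
  by apply/fsetP => x; rewrite in_fset_set // seq_fsetE; apply/idP/idP; rewrite inE h.
by rewrite size_seq_fset undup_id.
Qed.

Section ShapesOfParts.
Implicit Types (p : seq nat).

Lemma shp_of_conj n D p : is_part p -> size p <= n -> (forall i, nth 0 p i <= D) ->
  shp_of D n (conj_part p) = conj_shp (shp_of n D p).
Proof.
move=> dp pn pD; apply: shp_ext => j jD; rewrite conj_shpE.
have cE k : nth 0 (conj_part p) k = \sum_(i < n) ((k < nth 0 p i) : nat).
  have -> : \sum_(i < n) ((k < nth 0 p i) : nat) = count (fun x => k < x) p.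
    rewrite -sum1_count (big_nth 0) big_mkord (big_ord_widen_cond n (fun i => k < nth 0 p i) (fun=> 1)) //.
    rewrite [RHS]big_mkcond; apply: eq_bigr => i _.
    by case: (ltnP i (size p)) => [lt|ge]; rewrite ?andbT ?andbF ?(nth_default 0 ge) //; case: (_ < _).
  rewrite /conj_part; have [lt|ge] := ltnP k (head 0 p); first by rewrite nth_mkseq.
  rewrite nth_default ?size_mkseq //; apply/esym/eqP; rewrite -leqn0 leqNgt -has_count.
  apply/hasPn => x /(nthP 0)[i _ <-]; rewrite -leqNgt (leq_trans _ ge) // -nth0.
  by elim: i => // i; apply: leq_trans; apply: part_dec.
rewrite ent_mkshp // cE; last first.
  rewrite -[X in _ <= X]card_ord -sum1_card; apply: leq_sum => i _; by case: (_ < _).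
by apply: eq_bigr => i _; rewrite ent_shp_of.
Qed.

Lemma is_part_conj p : is_part (conj_part p).
Proof.
apply: is_part_mkseq => j _; apply: sub_count => x; exact: ltnW.
Qed.

Lemma part_le_head p i : is_part p -> nth 0 p i <= head 0 p.
Proof. by move=> dp; rewrite -nth0; elim: i => // i; apply: leq_trans; apply: part_dec. Qed.

Lemma conj_part_le p k : nth 0 (conj_part p) k <= size p.
Proof.
rewrite /conj_part; have [lt|ge] := ltnP k (head 0 p); last by rewrite nth_default ?size_mkseq.
by rewrite nth_mkseq // count_size.
Qed.

Lemma LR_number_lr la mu nu n D r : is_part la -> is_part mu -> is_part nu ->
    size la <= n -> size mu <= n -> (forall i, nth 0 la i <= D) -> (forall i, nth 0 mu i <= D) ->
    (forall k, r <= k -> nth 0 nu k = 0) ->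
  LR_number la mu nu =
  lr_count (shp_of n D la) (shp_of n D mu) ([ffun t : 'I_r => Posz (nth 0 nu t)] : vec r).
Proof.
move=> h1 h2 h3 h4 h5 h6 h7 h8; have [l el sl] := LR_enum h1 h2 h3 h4 h5 h6 h7 h8.
by rewrite -sl; have [_] := enumerates_fset_set el.
Qed.

Lemma tovec_shp_of n D p : size p <= n -> (forall i, nth 0 p i <= D) ->
  ([ffun t : 'I_n => Posz (nth 0 p t)] : vec n) = tovec (shp_of n D p).
Proof. by move=> pn pD; apply/ffunP => i; rewrite ffunE tovecE ent_shp_of. Qed.

(** The classes are defined through transposed shapes and [hatc] through untransposed ones; here the
    two counts meet. *)
Lemma LR_enum_conj la mu nu n : is_part la -> is_part mu -> is_part nu ->
    size la <= n -> size mu <= n -> size nu <= n ->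
  exists2 l, enumerates (LR (conj_part la) (conj_part mu) (conj_part nu)) l &
    size l = LR_number la mu nu.
Proof.
move=> dla dmu dnu lan mun nun.
(* The transposition lemma asks for n <= D and for the weight of nu to be at most D; the first parts
   make all three diagrams fit. *)
pose D := n + head 0 la + head 0 mu + head 0 nu + sumn nu.
have laD i : nth 0 la i <= D by apply: leq_trans (part_le_head _ dla) _; rewrite /D; lia.
have muD i : nth 0 mu i <= D by apply: leq_trans (part_le_head _ dmu) _; rewrite /D; lia.
have nuD i : nth 0 nu i <= D by apply: leq_trans (part_le_head _ dnu) _; rewrite /D; lia.
have nu_out k : D <= k -> nth 0 (conj_part nu) k = 0.
  by move=> Dk; rewrite nth_default // size_mkseq (leq_trans _ Dk) // /D; lia.
have cn p k : size p <= n -> nth 0 (conj_part p) k <= n by apply: leq_trans; exact: conj_part_le.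
have csz p : head 0 p <= D -> size (conj_part p) <= D by rewrite size_mkseq.
have [l el sl] := @LR_enum (conj_part la) (conj_part mu) (conj_part nu) D n D
  (is_part_conj la) (is_part_conj mu) (is_part_conj nu) (csz la ltac:(rewrite /D; lia))
  (csz mu ltac:(rewrite /D; lia)) (fun k => cn la k lan) (fun k => cn mu k mun) nu_out.
exists l => //; rewrite {}sl.
rewrite (LR_number_lr dla dmu dnu lan mun laD muD (r := n)); last first.
  by move=> k nk; rewrite nth_default // (leq_trans nun).
rewrite (tovec_shp_of nun nuD) (@tovec_shp_of D n (conj_part nu)); last 2 first.
- by apply: csz; rewrite /D; lia.
- by move=> k; apply: cn.
rewrite !shp_of_conj // lr_count_conj //; try exact: dominant_shp_of.
  by rewrite /D; lia.
by rewrite -sumn_weigh // /D; lia.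
Qed.

End ShapesOfParts.

(** * Stability under shifts of the level *)

Lemma vec_subE n (g v : vec n) i : (g - v)%R i = (g i - v i)%R.
Proof. by rewrite !ffunE. Qed.

Lemma vec_addE n (g v : vec n) i : (g + v)%R i = (g i + v i)%R.
Proof. by rewrite !ffunE. Qed.

Definition const_vec n (e : nat) : vec n := [ffun=> Posz e].

Lemma pact_cst n s e : pact s (const_vec n e) = const_vec n e.
Proof. by apply/ffunP => i; rewrite !ffunE. Qed.

(** Translation by a constant vector is multiplication by a power of the product of the variables, a
    symmetric factor; it simply shifts Schur functions. *)
Lemma hat_cst n (F : vec n -> int) e a :
  hat (fun v => F (v - const_vec n e)%R) a = hat F (a - const_vec n e)%R.
Proof.
apply: eq_bigr => s _; congr (_ * F _)%R.
by rewrite addrAC [(a + _ - _)%R]addrAC.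
Qed.

Lemma hat2_cst m n (F : vec (m + n) -> int) e (a : vec m) (b : vec n) :
  hat2 (fun v => F (v - const_vec (m + n) e)%R) a b = hat2 F (a - const_vec m e)%R (b - const_vec n e)%R.
Proof.
apply: eq_bigr => s _; apply: eq_bigr => t _; congr (_ * (_ * F _))%R.
have cE r i : const_vec r e i = Posz e by rewrite ffunE.
apply/ffunP => i; rewrite vec_subE; case: (split_ordP i) => j ->.
  by rewrite !catv_l !(vec_subE, vec_addE, cE); lia.
by rewrite !catv_r !(vec_subE, vec_addE, cE); lia.
Qed.

Definition shift_vec (k : nat) (x : k.-tuple int) p : vec k := [ffun i => (tnth x i + Posz p)%R].

Lemma shift_vecE k (x : k.-tuple int) p : shiftable p x ->
  shift_vec x p = [ffun t : 'I_k => Posz (nth 0 (shift_part p x) t)].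
Proof.
by move=> sx; apply/ffunP => i; rewrite !ffunE nth_shift_part // (tnth_nth 0%R).
Qed.

Lemma shift_vec_tovec k (x : k.-tuple int) p D : shiftable p x ->
  (forall i, nth 0 (shift_part p x) i <= D) -> shift_vec x p = tovec (shp_of k D (shift_part p x)).
Proof. by move=> sx xD; rewrite shift_vecE //; apply: tovec_shp_of; rewrite ?size_shift_part. Qed.

Lemma shift_vecB k (x : k.-tuple int) p q : p <= q ->
  (shift_vec x q - const_vec k (q - p))%R = shift_vec x p.
Proof.
move=> pq;by apply/ffunP => i; rewrite vec_subE !ffunE; lia.
Qed.

Lemma gen_part_mono k (x : k.-tuple int) i j : gen_part x -> i <= j -> j < k ->
  (nth 0 x j <= nth 0 x i :> int)%R.
Proof.
move=> gx ij; rewrite -(subnKC ij); elim: (j - i) => [|d IH] lt; rewrite ?addn0 //.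
rewrite addnS in lt *; apply: le_trans (gen_part_nth gx lt) (IH (ltnW lt)).
Qed.

Lemma shift_vec_strict k (x : k.-tuple int) p : gen_part x ->
  strict_dec (shift_vec x p + @delta k)%R.
Proof.
move=> gx i j ij; rewrite !ffunE !(tnth_nth 0%R).
rewrite -!addrA ler_ltD ?(gen_part_mono gx (ltnW ij)) // ltrD2l ltz_nat.
by have := ltn_ord j; lia.
Qed.

Lemma content_box r N D (la : shp N D) (c : shps r N D) i : chain_ok horizontal la c ->
  (0 <= content la c i)%R && (content la c i <= Posz D)%R &&
  (content la c i <= Posz (weigh la))%R.
Proof.
move=> ok; have st := chain_okP _ _ _ ok _ (ltn_ord i); rewrite !ffunE.
have := strip_weigh st; have := hstrip_le st.
have : weigh (layer la c i.+1) <= weigh la.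
  apply: leq_sum => j _; have le : i.+1 <= maxn r i.+1 by exact: leq_maxr.
  by have := layer_le j ok le; rewrite [layer la c (maxn _ _)]layer_ge // leq_maxl.
lia.
Qed.

Section Stability.
Variables (m n : nat) (lam : (m + n).-tuple int) (mu : m.-tuple int) (nu : n.-tuple int).
Hypotheses (gl : gen_part lam) (gm : gen_part mu) (gn : gen_part nu).
Let M := m + n.

Definition all_shiftable p := [&& shiftable p lam, shiftable p mu & shiftable p nu].

Definition shifted_LR p :=
  LR_number (shift_part p lam) (shift_part p mu) (shift_part p nu).

Lemma shifted_LR_hat2 p D : all_shiftable p ->
    (forall i, nth 0 (shift_part p lam) i <= D) -> (forall i, nth 0 (shift_part p mu) i <= D) ->
  let la := shp_of M D (shift_part p lam) in
  Posz (shifted_LR p) = Posz (lr_count la (widen M (shp_of m D (shift_part p mu))) (shift_vec nu p)) /\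
  Posz (shifted_LR p) = hat2 (kostka la empty_shp) (shift_vec mu p) (shift_vec nu p).
Proof.
case/and3P=> sl sm sn lD mD la.
have wE : widen M (shp_of m D (shift_part p mu)) = shp_of M D (shift_part p mu).
  apply: shp_ext => i lt; rewrite ent_widen ?leq_addr // !ent_shp_of ?size_shift_part ?leq_addr //.
have dla : dominant la by exact: dominant_shift.
have dmu : dominant (shp_of m D (shift_part p mu)).
  exact: dominant_shift.
have e : Posz (shifted_LR p) = Posz (lr_count la (widen M (shp_of m D (shift_part p mu))) (shift_vec nu p)).
  rewrite wE shift_vecE // /shifted_LR (@LR_number_lr _ _ _ M D n) ?is_part_shift ?size_shift_part ?leq_addr //.
  by move=> k nk; rewrite nth_default // size_shift_part.
split=> //; rewrite e (shift_vec_tovec sm mD) hat2_kostka //.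
exact: shift_vec_strict.
Qed.

(** Both numbers are branching coefficients. Multiplying by the product of the variables to the
    power q - p turns the Schur function of la + (p^(m+n)) into that of la + (q^(m+n)), and the
    restriction to two groups of variables splits this factor. *)
Lemma shifted_LR_stable p q : p <= q -> all_shiftable p -> shifted_LR p = shifted_LR q.
Proof.
move=> pq sp; have sq : all_shiftable q.
  by case/and3P: sp => *; apply/and3P; split; apply: shiftable_le pq _.
pose D := head 0 (shift_part q lam) + head 0 (shift_part q mu) +
          head 0 (shift_part p lam) + head 0 (shift_part p mu) + sumn (shift_part p lam) + q.
case/and3P: (sp) => slp smp snp; case/and3P: (sq) => slq smq snq.
have lqD i : nth 0 (shift_part q lam) i <= D.
  by apply: leq_trans (part_le_head _ (is_part_shift gl slq)) _; rewrite /D; lia.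
have mqD i : nth 0 (shift_part q mu) i <= D.
  by apply: leq_trans (part_le_head _ (is_part_shift gm smq)) _; rewrite /D; lia.
have lpD i : nth 0 (shift_part p lam) i <= D.
  by apply: leq_trans (part_le_head _ (is_part_shift gl slp)) _; rewrite /D; lia.
have mpD i : nth 0 (shift_part p mu) i <= D.
  by apply: leq_trans (part_le_head _ (is_part_shift gm smp)) _; rewrite /D; lia.
have [_ ep] := shifted_LR_hat2 sp lpD mpD; have [eq _] := shifted_LR_hat2 sq lqD mqD.
set lap := shp_of M D (shift_part p lam) in ep.
set laq := shp_of M D (shift_part q lam) in eq.
have dlap : dominant lap by exact: dominant_shift.
have dlaq : dominant laq by exact: dominant_shift.
have wlap : weigh lap = sumn (shift_part p lam) by rewrite -sumn_weigh ?size_shift_part.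
have e1 : tovec laq = shift_vec lam q by apply/esym/shift_vec_tovec.
have e2 : tovec lap = shift_vec lam p by apply/esym/shift_vec_tovec.
apply/eqP; rewrite -eqz_nat; apply/eqP; rewrite ep eq.
rewrite -!(shift_vecB _ pq) -hat2_cst (shift_vec_tovec smq mqD) hat2_expand; first last.
- exact: shift_vec_strict.
- exact: dominant_shift.
- move=> v nz; apply: tovec_box => i; move: nz.
  rewrite /kostka; case: (pickP (fun c : shps M M D => chain_ok horizontal lap c &&
      (content lap c == (v - const_vec (m + n) (q - p))%R))) => [c /andP[ok /eqP ce] _|none]; last first.
    rewrite big1 ?eqxx // => c /andP[ok _]; have := none c; rewrite ok /= => ->.
    by [].
  have wD : sumn (shift_part p lam) + (q - p) <= D by rewrite /D leq_add ?leq_addl ?leq_subr.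
  have := content_box i ok; rewrite ce vec_subE [const_vec _ _ _]ffunE wlap.
  by move: (D) (sumn _) (q - p) wD => a b e; case: (v i) => x; clear; lia.
- move=> s v; rewrite -[in RHS](kostka_perm dlap (dominant_empty _ _) s) pactB pact_cst //.
(* In the Schur expansion of the translated function only the term [laq] survives, with coefficient
   1. *)
rewrite (bigD1 laq) //= hat_cst e1 shift_vecB // -e2 big1 ?addr0.
  by rewrite hat_kostka ?dominant_empty ?lr_count_straight ?widen_id ?eqxx ?mul1r //; apply: dominant_strict.
move=> ka /andP[dka ne]; rewrite hat_cst.
have sk : strict_dec (tovec ka - const_vec (m + n) (q - p) + @delta (m + n))%R.
  have e k : (tovec ka - const_vec (m + n) (q - p) + @delta (m + n))%R k =
             ((tovec ka + @delta (m + n))%R k - Posz (q - p))%R.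
    by rewrite vec_addE vec_subE [in RHS]vec_addE [const_vec _ _ _]ffunE addrAC.
  by move=> i j ij; rewrite !e ltrD2r; exact: (dominant_strict dka ij).
rewrite hat_kostka ?dominant_empty //.
(* The translate of ka may have negative entries. A lattice chain with that content would make it a
   diagram, which must then be [lap], and ka would be [laq]. *)
suff -> : lr_count lap empty_shp (tovec ka - const_vec (m + n) (q - p))%R = 0 by rewrite mul0r.
apply/eqP; rewrite cards_eq0; apply/eqP/setP => c; rewrite !inE.
apply/negP => /and4P[ok l0 lat /eqP ce].
have [x xe] : exists x : shp M D, (tovec ka - const_vec (m + n) (q - p))%R = tovec x.
  by apply: tovec_box => i; rewrite -ce; case/andP: (content_box i ok).
have := lr_count_straight x (leqnn M) dlap; rewrite -xe widen_id.
have : 0 < lr_count lap empty_shp (tovec ka - const_vec (m + n) (q - p))%R.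
  by rewrite card_gt0; apply/set0Pn; exists c; rewrite inE ok l0 lat ce eqxx.
case: (eqVneq lap x) => [lx _ _|_ h1 h2]; last by rewrite h2 in h1.
case/negP: ne; apply/eqP/tovec_inj; rewrite e1; apply/ffunP => i.
have /ffunP/(_ i) := xe; rewrite -lx e2 vec_subE [const_vec _ _ _]ffunE => /eqP; rewrite subr_eq => /eqP ->.
by rewrite !ffunE -addrA -PoszD subnKC.
Qed.

Lemma shifted_LR_const p q : all_shiftable p -> all_shiftable q -> shifted_LR p = shifted_LR q.
Proof.
by move=> sp sq; case: (leqP p q) => [|/ltnW] h; [|symmetry]; apply: shifted_LR_stable.
Qed.

(** [xget] returns some eventual value; it agrees with the level-p number at any level beyond both
    thresholds. *)
Lemma hatcE p : all_shiftable p -> hatc lam mu nu = shifted_LR p.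
Proof.
move=> sp; have mono q : p <= q -> shifted_LR q = shifted_LR p.
  by move=> pq; rewrite (shifted_LR_stable pq).
have : [set c | exists p0, forall q, p0 <= q ->
    LR_number (shift_part q lam) (shift_part q mu) (shift_part q nu) = c]%classic (hatc lam mu nu).
  by apply: xgetPex; exists (shifted_LR p), p.
case=> p0 h; rewrite -(h (maxn p0 p)) ?leq_maxl //.
by apply: mono; rewrite leq_maxr.
Qed.

Lemma LR_pi0 T : LR_pi 0 T = T.
Proof.
rewrite /LR_pi drop0 -[RHS]map_id; apply: eq_map => r.
by rewrite -[RHS]map_id; apply: eq_map => x; rewrite subn0.
Qed.

Lemma LR_classes_enum p : 0 < m + n -> all_shiftable p ->
  exists2 l, enumerates (LR_classes lam mu nu) l & size l = shifted_LR p.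
Proof.
move=> M0 sp.
have ex : exists q, all_shiftable q by exists p.
case: (ex_minnP ex) => q sq min.
have mq : minimal_shift lam mu nu q by case/and3P: (sq).
have uniq_q q' : minimal_shift lam mu nu q' -> q' = q.
  case=> h1 h2 h3 h4; apply/eqP; rewrite eqn_leq h4 // min //.
  by rewrite /all_shiftable h1 h2 h3.
case/and3P: (sq) => slq smq snq.
have [l [ul lE] sl] := @LR_enum_conj _ _ _ (m + n) (is_part_shift gl slq) (is_part_shift gm smq)
  (is_part_shift gn snq) (eq_leq (size_shift_part _ _))
  (leq_trans (eq_leq (size_shift_part _ _)) (leq_addr _ _))
  (leq_trans (eq_leq (size_shift_part _ _)) (leq_addl _ _)).
have inC Q : LR_conj lam mu nu q Q -> LR_class lam mu nu q Q Q.
  move=> QC; by exists 0; rewrite addn0 LR_pi0.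
(* The number of rows at shift k is the first part of lam plus k, so a class contains just one
   tableau at the minimal level. This reads the first entry of lam, hence the hypothesis 0 < m +
   n. *)
have szQ k Q : shiftable k lam -> LR_conj lam mu nu k Q -> Posz (size Q) = (nth 0 lam 0 + Posz k)%R.
  move=> sk [_ [_ _ [sh _ _] _ _]]; have := congr1 size sh.
  rewrite size_map !size_mkseq => ->; rewrite -nth0; exact: nth_shift_part.
have inj Q Q' : LR_conj lam mu nu q Q -> LR_conj lam mu nu q Q' ->
    LR_class lam mu nu q Q = LR_class lam mu nu q Q' -> Q = Q'.
  move=> QC QC' e; have := inC Q QC; rewrite e => -[k [Qk <-]].
  have k0 : k = 0.
    have := szQ _ _ slq QC; rewrite (szQ _ _ _ Qk); last by apply: shiftable_le slq; exact: leq_addr.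
    lia.
  by rewrite k0 LR_pi0.
exists [seq LR_class lam mu nu q Q | Q <- l]; last first.
  by rewrite size_map sl -(shifted_LR_const sq sp).
split.
  by rewrite map_inj_in_uniq // => Q Q' /lE QC /lE QC'; apply: inj.
move=> C; split.
  by case=> q' [/uniq_q -> [Q QC ->]]; apply/map_f/lE.
by case/mapP => Q /lE QC ->; exists q; split=> //; exists Q.
Qed.

End Stability.

(** * Weight-preserving bijections and finite sums *)

(** Within each weight the i-th listed element is sent to the i-th listed element. *)
Lemma graded_bijection (X Y : eqType) (W : Type) (P : set X) (Q : set Y)
    (f : X -> W) (g : Y -> W) (y0 : Y) (lX : W -> seq X) (lY : W -> seq Y) :
    (forall w, enumerates [set x | P x /\ f x = w] (lX w)) ->
    (forall w, enumerates [set y | Q y /\ g y = w] (lY w)) ->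
    (forall w, size (lX w) = size (lY w)) ->
  exists rho, set_bij P Q rho /\ forall x, P x -> g (rho x) = f x.
Proof.
move=> eX eY sXY; pose rho x := nth y0 (lY (f x)) (index x (lX (f x))).
have memX x : P x -> x \in lX (f x) by move=> Px; apply/(eX (f x)).2.
have memY x : P x -> rho x \in lY (f x).
  by move=> /memX xl; rewrite mem_nth // -sXY index_mem.
have rhoP x : P x -> Q (rho x) /\ g (rho x) = f x by move=> /memY /(eY (f x)).2.
exists rho; split=> [|x /rhoP[]//]; split.
- by move=> x /rhoP[].
- move=> x x'; rewrite !inE => Px Px' e.
  have fx : f x = f x' by rewrite -(rhoP x Px).2 -(rhoP x' Px').2 e.
  move: e; rewrite /rho fx => /eqP; rewrite nth_uniq; last exact: (eY _).1.
  + by move=> /eqP; rewrite -fx; apply: (@index_inj _ _ _ x); rewrite ?memX // fx memX.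
  + by rewrite -sXY index_mem -fx memX.
  + by rewrite -sXY index_mem memX.
- move=> y Qy; have yl : y \in lY (g y) by apply/(eY (g y)).2.
  have ylt : index y (lY (g y)) < size (lX (g y)) by rewrite sXY index_mem.
  case el : (lX (g y)) ylt => [//|x0 l0] ylt; rewrite -el in ylt.
  have /(eX (g y)).2 [Px fx] := mem_nth x0 ylt.
  by exists (nth x0 (lX (g y)) (index y (lY (g y)))) => //; rewrite /rho fx index_uniq ?nth_index //; exact: (eX _).1.
Qed.

Lemma fsbig_indicator (T : choiceType) (S : set T) (P : pred T) l :
    enumerates [set x | S x /\ P x] l ->
  (\sum_(x \in S) ((P x)%:R : int) = Posz (size l))%R.
Proof.
case=> ul lE; rewrite fsbig_supp.
rewrite (eq_fsbigl _ _ _ (Q := [set` l]%classic)).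
  rewrite -fsbig_seq // big_seq (eq_bigr (fun=> 1%R)); last first.
    by move=> x xl; have /= [_ ->] := (lE x).2 xl.
  by rewrite -big_seq -sum1_size (big_morph Posz PoszD (erefl 0%R)).
apply/seteqP; split=> x /=.
  by case=> Sx nz; apply/lE; split=> //; move: nz; rewrite /preimage /=; case: (P x).
by move=> xl; have /= [Sx Px] := (lE x).2 xl; split=> //; rewrite /preimage /= Px.
Qed.

Lemma fsbig_list (T : choiceType) (S : set T) (F : T -> int) l : uniq l ->
    (forall x, S x -> F x != 0%R -> x \in l) -> (forall x, x \in l -> ~ S x -> F x = 0%R) ->
  (\sum_(x \in S) F x = \sum_(x <- l) F x)%R.
Proof.
move=> ul h1 h2; rewrite (fsbig_seq _ F ul) (fsbig_supp _ S) (fsbig_supp _ [set` l]%classic).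
apply: eq_fsbigl; apply/seteqP; split=> x; rewrite /preimage /= => -[h nz]; split=> //.
  by apply: h1 => //; apply/eqP.
by apply: contrapT => /(h2 x h).
Qed.

Lemma ex_shiftable k (x : k.-tuple int) : exists p, shiftable p x.
Proof.
exists (\max_(i < k) `|tnth x i|%N); apply/(all_nthP 0%R) => i; rewrite size_tuple => lt.
have := @leq_bigmax _ (fun i : 'I_k => `|tnth x i|%N) (Ordinal lt).
by rewrite (tnth_nth 0%R) /=; move: (\max_(_ < _) _) => z; case: (nth _ _ _) => y; lia.
Qed.

(** * Monomials and their words *)

Section Monomials.
Context {dA dB : Order.disp_t} {A : orderType dA} {B : orderType dB}.
Variables (oddA : A -> bool) (oddB : B -> bool) (sA : seq A) (sB : seq B).
Hypotheses (uA : uniq sA) (uB : uniq sB).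
Implicit Types u v w : @monom dA dB A B.

Definition mult u (z : A + B) : nat :=
  match z with inl x => u.1 x | inr y => u.2 y end.

Lemma mult_inj u v : mult u =1 mult v -> u = v.
Proof.
case: u v => [M N] [M' N'] e; congr pair; apply/msetP => x; first exact: (e (inl x)).
exact: (e (inr x)).
Qed.

Definition supported u := {subset finsupp u.1 <= sA} /\ {subset finsupp u.2 <= sB}.

Definition keys : seq (A + B) := [seq inl x | x <- rev sA] ++ [seq inr y | y <- rev sB].

Definition mword u : seq letter := negpos (letters oddA sA u.1) (letters oddB sB u.2).

Definition letter_kind (z : A + B) : bool * bool :=
  match z with inl x => (false, oddA x) | inr y => (true, oddB y) end.

Lemma mwordE u : mword u = kword letter_kind keys (mult u).
Proof.
rewrite /mword /negpos /letters /poslet /kword /keys map_cat -!map_rev -!map_comp.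
by congr (_ ++ _); apply: eq_map.
Qed.

Lemma keys_uniq : uniq keys.
Proof.
rewrite cat_uniq !map_inj_uniq ?rev_uniq ?uA ?uB /= ?andbT; try by move=> x y [].
by apply/hasPn => _ /mapP[y _ ->]; apply/mapP => -[].
Qed.

Lemma mem_keys z : (z \in keys) = match z with inl x => x \in sA | inr y => y \in sB end.
Proof.
rewrite mem_cat; case: z => z.
  rewrite mem_map ?mem_rev; last by move=> x y [].
  by rewrite orbC; case: mapP => // -[].
rewrite [X in _ || X]mem_map ?mem_rev; last by move=> x y [].
by case: mapP => // -[].
Qed.

Lemma mword_inj u v : supported u -> supported v -> mword u = mword v -> u = v.
Proof.
move=> [u1 u2] [v1 v2]; rewrite !mwordE => /kword_eq h.
case: u v u1 u2 v1 v2 h => [a b] [a' b'] /= u1 u2 v1 v2 h.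
congr (_, _); apply/msetP => x.
  have [xs|xs] := boolP (x \in sA); last by rewrite (mset_out u1) ?(mset_out v1).
  by apply: (h (inl x)); rewrite mem_keys.
have [xs|xs] := boolP (x \in sB); last by rewrite (mset_out u2) ?(mset_out v2).
by apply: (h (inr x)); rewrite mem_keys.
Qed.

Lemma monom_mul_supported u v w : supported w -> monom_mul u v = w -> supported u /\ supported v.
Proof.
move=> [w1 w2] e; move: w1 w2; rewrite -e /monom_mul /= => w1 w2.
by split; split=> x; rewrite msuppE => xu; [apply: w1|apply: w2|apply: w1|apply: w2];
   rewrite msuppE in_msetD xu ?orbT.
Qed.

(** Each letter of the two alphabets has its own place in the word of w, so splitting all degrees in
    two is the same as factoring w. Support in sA and sB makes a monomial recoverable from its
    word. *)
Lemma factorisations w : supported w -> exists E : seq (monom * monom),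
  [/\ uniq E, forall uv, monom_mul uv.1 uv.2 = w <-> uv \in E
    & [seq (mword uv.1, mword uv.2) | uv <- E] = splits (mword w)].
Proof.
move=> sw; have ex q : exists uv : monom * monom, q \in splits (mword w) ->
    monom_mul uv.1 uv.2 = w /\ (mword uv.1, mword uv.2) = q.
  have [qs|] := boolP (q \in splits (mword w)); last by exists (w, w).
  move: (qs); rewrite mwordE => /(splits_kword keys_uniq)[k1 [k2 [h ->]]].
  (* The factor read off from a splitting; its multiplicities are at most those of w, so its support
     lies in that of w. *)
  pose part (C : choiceType) (X : {mset C}%mset) (k : C -> nat) : {mset C}%mset :=
    [fsfun x in finsupp X => k x].
  have partE (C : choiceType) (X : {mset C}%mset) (k : C -> nat) x : k x <= X x -> part C X k x = k x.
    move=> kX; rewrite fsfunE msuppE; case: ifP => // /negbT; rewrite -mset_eq0 => /eqP X0.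
    by move: kX; rewrite X0 leqn0 => /eqP ->.
  pose uv k : monom := (part _ w.1 (k \o inl), part _ w.2 (k \o inr)).
  have uvE k k' : (forall z, z \in keys -> k z + k' z = mult w z) ->
      forall z, z \in keys -> mult (uv k) z = k z.
    by move=> hk [x|y] zk /=; rewrite partE //=;
      have := hk _ zk => /= <-; rewrite leq_addr.
  have h' z : z \in keys -> k2 z + k1 z = mult w z by rewrite addnC; apply: h.
  exists (uv k1, uv k2) => _; split; last first.
    by rewrite !mwordE; congr pair; apply/eq_in_map => z zk; rewrite ?(uvE _ _ h) ?(uvE _ _ h').
  have part0 (C : choiceType) (X : {mset C}%mset) (k : C -> nat) x : X x = 0 -> part C X k x = 0.
    by move=> /eqP; rewrite mset_eq0 -msuppE fsfunE => /negPf ->.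
  have sum z : mult (uv k1) z + mult (uv k2) z = mult w z.
    have [zk|] := boolP (z \in keys); first by rewrite (uvE _ _ h) // (uvE _ _ h') // h.
    rewrite mem_keys; case: z => z zs /=.
      by rewrite !part0 ?(mset_out sw.1).
    by rewrite !part0 ?(mset_out sw.2).
  by apply: mult_inj => z; rewrite -sum; case: z => x /=; rewrite msetE2.
have [g gP] := choice ex.
exists [seq g q | q <- splits (mword w)]; split.
- rewrite map_inj_in_uniq ?splits_uniq // => q q' qs qs' e.
  by rewrite -(gP q qs).2 -(gP q' qs').2 e.
- case=> u v; split=> [e|/mapP[q qs ->]]; last exact: (gP q qs).1.
  have [su sv] := monom_mul_supported sw e; rewrite /= in e.
  have qs : (mword u, mword v) \in splits (mword w).
    rewrite !mwordE; apply: kword_splits => -[x|y] _ /=; by rewrite -e /monom_mul /= msetE2.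
  apply/mapP; exists (mword u, mword v) => //.
  have [] := gP _ qs; case: (g _) => u' v' /= e' [eu ev].
  have [su' sv'] := monom_mul_supported sw e'.
  by rewrite (mword_inj su' su eu) (mword_inj sv' sv ev).
- rewrite -map_comp -[RHS]map_id; apply/eq_in_map => q qs; exact: (gP q qs).2.
Qed.

End Monomials.

Lemma shift_vec0 k (x : k.-tuple int) p : (shift_vec x p - const_vec k p)%R = shift_vec x 0.
Proof. by have := shift_vecB x (leq0n p); rewrite subn0. Qed.

Lemma tovec_rect n D p : p <= D -> tovec (rect n D p) = const_vec n p.
Proof. by move=> pD; apply/ffunP => i; rewrite tovecE ent_rect // ffunE. Qed.

Lemma bracket_cst n (f : vec n -> int) la p : bracket f la (const_vec n p) = hat f (la - const_vec n p)%R.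
Proof.
apply: eq_bigr => s _; congr (_ * f _)%R.
by rewrite pactD pact_cst opprD addrA [(la - _ + _)%R]addrAC.
Qed.

Lemma sumn_letters (C : Type) (odd : C -> bool) (s : seq C) (k : C -> nat) :
  sumn (unzip2 (letters odd s k)) = \sum_(x <- s) k x.
Proof. by rewrite /letters /unzip2 map_rev sumn_rev -map_comp sumnE big_map. Qed.

Section RationalCount.
Context {dA dB : Order.disp_t} {A : orderType dA} {B : orderType dB}.
Variables (oddA : A -> bool) (oddB : B -> bool) (sA : seq A) (sB : seq B).
Hypotheses (ssA : sorted <%O sA) (ssB : sorted <%O sB).
Implicit Types u v w : @monom dA dB A B.
Let W u := mword oddA oddB sA sB u.

(** At level p the count is a bracket with the rectangle. Its alternant is that of the empty shape
    translated by p, so the level cancels and [hat] at la itself remains. *)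
Lemma rat_count k p D (la : k.-tuple int) u :
    gen_part la -> shiftable p la -> supported sA sB u ->
    \sum_(x <- sB) u.2 x <= p -> p <= D -> \sum_(x <- sA) u.1 x <= D ->
    (forall i, nth 0 (shift_part p la) i <= D) ->
  exists2 l, enumerates [set T | ratSST oddA oddB la T /\ weight T = u] l &
    Posz (size l) = hat (kernel D (W u)) (shift_vec la 0).
Proof.
move=> gl sl [uA uB] Bp pD AD lD.
have [|l el sE] := @rat_enum _ _ A B oddA oddB k p D la u sA sB gl sl ssA ssB uA uB _ pD lD.
  by rewrite sumn_letters.
exists l => //; rewrite sE -bracket_negpos ?sumn_letters //.
- by rewrite tovec_rect // bracket_cst -(shift_vec_tovec sl lD) shift_vec0.
- exact: dominant_shift.
- apply/allP => l' l'w; apply: leq_trans AD; rewrite -(sumn_letters oddA).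
  elim: (letters _ _ _) l'w => //= l1 s IH; rewrite inE => /orP[/eqP ->|/IH h]; first exact: leq_addr.
  by rewrite (leq_trans h) ?leq_addl.
Qed.

Lemma mword_neg u : \sum_(l <- W u | l.1.1) l.2 = \sum_(x <- sB) u.2 x.
Proof.
rewrite /W mwordE /kword big_map /keys big_cat !big_map /= big_pred0 // add0n.
by apply: perm_big; rewrite perm_rev.
Qed.

Lemma mword_pos u : \sum_(l <- W u | ~~ l.1.1) l.2 = \sum_(x <- sA) u.1 x.
Proof.
rewrite /W mwordE /kword big_map /keys big_cat !big_map /= [X in _ + X]big_pred0 // addn0.
by apply: perm_big; rewrite perm_rev.
Qed.

End RationalCount.

Section Unshift.
Variables (n D p : nat).
Implicit Types la : shp n D.

(** Lists generalized partitions by the diagrams of a finite box, so that sums over them become sums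
    over a finite type. *)
Definition unshift la : n.-tuple int := [tuple (Posz (ent la i) - Posz p)%R | i < n].

Lemma nth_unshift la i : i < n -> nth 0%R (unshift la) i = (Posz (ent la i) - Posz p)%R.
Proof. by move=> lt; rewrite -(tnth_nth 0%R _ (Ordinal lt)) tnth_mktuple. Qed.

Lemma shiftable_unshift la : shiftable p (unshift la).
Proof.
apply/(all_nthP 0%R) => i; rewrite size_tuple => lt.
by rewrite nth_unshift // subrK.
Qed.

Lemma gen_part_unshift la : dominant la -> gen_part (unshift la).
Proof.
move=> /dominantP dla; apply/(sortedP 0%R) => i; rewrite size_tuple => lt.
by rewrite !nth_unshift ?(ltnW lt) // lerD2r lez_nat.
Qed.

Lemma shift_unshift la i : nth 0 (shift_part p (unshift la)) i = ent la i.
Proof.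
have [lt|ge] := ltnP i n; last by rewrite nth_default ?size_shift_part // ent_ge.
apply/eqP; rewrite -eqz_nat nth_shift_part ?shiftable_unshift // nth_unshift //.
by rewrite subrK.
Qed.

Lemma shift_unshift_le la i : nth 0 (shift_part p (unshift la)) i <= D.
Proof. by rewrite shift_unshift ent_le. Qed.

Lemma shp_of_unshift la : shp_of n D (shift_part p (unshift la)) = la.
Proof.
by apply: shp_ext => i lt; rewrite ent_shp_of ?size_shift_part ?shift_unshift //; exact: shift_unshift_le.
Qed.

Lemma unshift_inj : injective unshift.
Proof. by move=> la ka e; rewrite -(shp_of_unshift la) e shp_of_unshift. Qed.

Lemma unshift_shp_of (x : n.-tuple int) : shiftable p x ->
  (forall i, nth 0 (shift_part p x) i <= D) -> unshift (shp_of n D (shift_part p x)) = x.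
Proof.
move=> sx xD; apply: eq_from_tnth => i; rewrite !(tnth_nth 0%R) nth_unshift //.
by rewrite ent_shp_of ?size_shift_part // nth_shift_part // addrK.
Qed.

Lemma shift_vec_unshift la : shift_vec (unshift la) p = tovec la.
Proof.
by rewrite (shift_vec_tovec (shiftable_unshift la) (@shift_unshift_le la)) shp_of_unshift.
Qed.

Lemma shift_vec0_unshift la : shift_vec (unshift la) 0 = (tovec la - const_vec n p)%R.
Proof. by rewrite -(shift_vec0 _ p) shift_vec_unshift. Qed.

End Unshift.

(** * The product of two rational characters *)

Section Product.
Context {dA dB : Order.disp_t} {A : orderType dA} {B : orderType dB}.
Variables (oddA : A -> bool) (oddB : B -> bool).
Variables (m n : nat) (mu : m.-tuple int) (nu : n.-tuple int).
Hypotheses (gm : gen_part mu) (gn : gen_part nu).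
Local Notation monom := (@monom dA dB A B).
Implicit Types u v w : monom.

Section FixedMonomial.
Variables (w : monom) (sA : seq A) (sB : seq B).
Hypotheses (ssA : sorted <%O sA) (ssB : sorted <%O sB) (sw : supported sA sB w).
Variables (p D : nat).
Hypotheses (sm : shiftable p mu) (sn : shiftable p nu).
Hypotheses (wB : \sum_(x <- sB) w.2 x <= p) (wA : p + \sum_(x <- sA) w.1 x <= D).
Hypotheses (mD : forall i, nth 0 (shift_part p mu) i <= D)
           (nD : forall i, nth 0 (shift_part p nu) i <= D).
Let M := m + n.
Let W u := mword oddA oddB sA sB u.
Let G := kernel D (W w) : vec M -> int.

Lemma le_pD : p <= D. Proof. by apply: leq_trans wA; exact: leq_addr. Qed.
Lemma le_AD : \sum_(x <- sA) w.1 x <= D. Proof. by apply: leq_trans wA; exact: leq_addl. Qed.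

Definition divides_w u := [/\ supported sA sB u,
  \sum_(x <- sA) u.1 x <= \sum_(x <- sA) w.1 x & \sum_(x <- sB) u.2 x <= \sum_(x <- sB) w.2 x].

Lemma factor_divides u v : monom_mul u v = w -> divides_w u /\ divides_w v.
Proof.
move=> e; have [su sv] := monom_mul_supported sw e; rewrite /divides_w -e.
have le1 (C : choiceType) (X Y : {mset C}%mset) (s : seq C) :
    \sum_(x <- s) X x <= \sum_(x <- s) (X `+` Y)%mset x /\
    \sum_(x <- s) Y x <= \sum_(x <- s) (X `+` Y)%mset x.
  by split; apply: leq_sum => x _; rewrite msetE2 ?leq_addr ?leq_addl.
have [A1 A2] := le1 _ u.1 v.1 sA; have [B1 B2] := le1 _ u.2 v.2 sB.
by split.
Qed.

Lemma fibre_count k (x : k.-tuple int) u : gen_part x -> shiftable p x ->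
    (forall i, nth 0 (shift_part p x) i <= D) -> divides_w u ->
  exists2 l, enumerates [set T | ratSST oddA oddB x T /\ weight T = u] l &
    Posz (size l) = hat (kernel D (W u)) (shift_vec x 0).
Proof.
move=> gx sx xD [su uA uB].
exact: (rat_count oddA oddB ssA ssB gx sx su (leq_trans uB wB) le_pD (leq_trans uA le_AD) xD).
Qed.

Lemma ratS_hat k (x : k.-tuple int) u : gen_part x -> shiftable p x ->
    (forall i, nth 0 (shift_part p x) i <= D) -> divides_w u ->
  ratS oddA oddB x u = hat (kernel D (W u)) (shift_vec x 0).
Proof.
move=> gx sx xD du; have [l el <-] := fibre_count gx sx xD du.
apply: fsbig_indicator; apply: enumerates_ext el => T.
by split=> -[rT /eqP wT]; split.
Qed.

Lemma pairs_count : exists2 l,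
    enumerates [set x | (ratSST oddA oddB mu x.1 /\ ratSST oddA oddB nu x.2) /\
                        monom_mul (weight x.1) (weight x.2) = w] l
  & Posz (size l) = hat2 G (shift_vec mu 0) (shift_vec nu 0).
Proof.
have [E [uE EP EW]] := factorisations oddA oddB (lt_sorted_uniq ssA) (lt_sorted_uniq ssB) sw.
rewrite /G hat2_kernel -EW big_map.
have [|uv uv' x|uv uvE|l el sE] := @enumerates_union _ _ E (fun uv => [set x |
    (ratSST oddA oddB mu x.1 /\ weight x.1 = uv.1) /\ (ratSST oddA oddB nu x.2 /\ weight x.2 = uv.2)]%classic)
    (fun uv => (hat (kernel D (W uv.1)) (shift_vec mu 0) * hat (kernel D (W uv.2)) (shift_vec nu 0))%R).
- by [].
- by case: uv uv' => u v [u' v'] _ _ [[_ /= <-] [_ /= <-]] [[_ /= ->] [_ /= ->]].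
- have /EP/factor_divides [d1 d2] := uvE.
  have [l1 e1 c1] := fibre_count gm sm mD d1.
  have [l2 e2 c2] := fibre_count gn sn nD d2.
  exists [seq (x, y) | x <- l1, y <- l2]; first exact: enumerates_prod e1 e2.
  by rewrite size_allpairs PoszM c1 c2.
exists l => //; apply: enumerates_ext el => x; split.
  by case=> uv /EP e [[S1 w1] [S2 w2]]; split=> //=; rewrite w1 w2.
by case=> -[S1 S2] e; exists (weight x.1, weight x.2) => //; apply/EP.
Qed.

Lemma series_mul_hat2 : series_mul (ratS oddA oddB mu) (ratS oddA oddB nu) w =
  hat2 G (shift_vec mu 0) (shift_vec nu 0).
Proof.
have [E [uE EP EW]] := factorisations oddA oddB (lt_sorted_uniq ssA) (lt_sorted_uniq ssB) sw.
rewrite /G hat2_kernel -EW big_map /series_mul (eq_fsbigl _ _ _ (Q := [set` E]%classic)); last first.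
  by apply/seteqP; split=> uv /EP.
rewrite -fsbig_seq // big_seq [RHS]big_seq; apply: eq_bigr => uv /EP/factor_divides [d1 d2].
by rewrite !ratS_hat.
Qed.

(** Exponents of G lie between minus the number of letters of B and the number of letters of A.
    Adding p moves them into the range from 0 to D. *)
Lemma kernel_box (v : vec M) : G (v - const_vec M p)%R != 0%R -> exists e : shp M D, v = tovec e.
Proof.
move=> nz; apply: tovec_box => i; have := kernel_range i nz.
rewrite mword_neg mword_pos => /andP[h1 h2].
have E : v i = ((v - const_vec M p)%R i + Posz p)%R by rewrite !ffunE subrK.
rewrite E; apply/andP; split.
  rewrite -lerBlDr sub0r; apply: le_trans h1; by rewrite lerN2 lez_nat.
apply: le_trans (_ : Posz (\sum_(x <- sA) w.1 x) + Posz p <= _)%R; first by rewrite lerD2r.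
by rewrite -PoszD lez_nat addnC.
Qed.

Definition structure_const (la : shp M D) : nat := shifted_LR (unshift p la) mu nu p.

(** Translate by p to leave the negative range, expand in Schur functions, restrict each of them to
    the two groups, and translate back. *)
Lemma pairs_expand : hat2 G (shift_vec mu 0) (shift_vec nu 0) =
  (\sum_(la : shp M D | dominant la)
      hat G (shift_vec (unshift p la) 0) * Posz (structure_const la))%R.
Proof.
rewrite -(shift_vec0 mu p) -(shift_vec0 nu p) -hat2_cst (shift_vec_tovec sm mD) hat2_expand.
- apply: eq_bigr => la dla; rewrite hat_cst shift_vec0_unshift; congr (_ * _)%R.
  have ash : all_shiftable (unshift p la) mu nu p by rewrite /all_shiftable shiftable_unshift sm sn.
  have [-> _] := shifted_LR_hat2 (gen_part_unshift p dla) gm gn ash (@shift_unshift_le _ _ _ _) mD.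
  by rewrite shp_of_unshift.
- by move=> s v; rewrite -[in LHS](pact_cst s p) -pactB; exact: kernel_sym.
- exact: kernel_box.
- exact: dominant_shift.
- exact: shift_vec_strict.
Qed.

(** Row i of the first tableau exceeds mu_i <= p by at most the number of letters of A in w, so the
    box contains every lam that carries a tableau of weight w. *)
Lemma ratSST_unshift (lam : M.-tuple int) T : ratSST oddA oddB lam T -> weight T = w ->
  exists2 la : shp M D, dominant la & lam = unshift p la.
Proof.
move=> rT wT; have [gl _] := rT; move: sw wB wA; rewrite -wT => -[/= w1 w2].
have cs (C : choiceType) (s t : seq C) : uniq s -> {subset finsupp (seq_mset t) <= s} ->
    \sum_(x <- s) seq_mset t x = size t.
  move=> us ts; rewrite -(sumn_letters xpredT) (@size_letters _ xpredT s _ t) // => [x xt|x]; last by rewrite mset_seqE.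
  by apply: ts; rewrite msuppE in_mset mset_seqE -has_count has_pred1.
rewrite !cs ?lt_sorted_uniq // => T2p T1D.
have [sl [ka [[szk dk subp sub] [[sh _ _] _]]]] := ratSST_level T2p rT.
have lD i : nth 0 (shift_part p lam) i <= D.
  have [lt|ge] := ltnP i M; last by rewrite nth_default ?size_shift_part.
  apply: leq_trans T1D; rewrite -leq_subLR (size_flatten T.1) sh.
  apply: leq_trans (nth_leq_sumn _ i); rewrite nth_mkseq ?size_shift_part //.
  by apply: leq_sub2l; have := subp i; rewrite nth_nseq; case: ifP => // _ /leq_trans; apply.
exists (shp_of M D (shift_part p lam)); last by rewrite unshift_shp_of.
exact: dominant_shift.
Qed.

Lemma hatc_unshift (la : shp M D) : dominant la -> hatc (unshift p la) mu nu = structure_const la.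
Proof.
move=> dla; apply: hatcE => //; first exact: gen_part_unshift.
by rewrite /all_shiftable shiftable_unshift sm sn.
Qed.

Lemma ratS_unshift (la : shp M D) : dominant la ->
  ratS oddA oddB (unshift p la) w = hat G (shift_vec (unshift p la) 0).
Proof.
move=> dla; apply: ratS_hat => //.
- exact: gen_part_unshift.
- exact: shiftable_unshift.
- exact: shift_unshift_le.
Qed.

Lemma triples_count : 0 < M -> exists2 l,
    enumerates [set z | [/\ ratParts oddA oddB z.1.1, ratSST oddA oddB z.1.1 z.1.2
                           & LR_classes z.1.1 mu nu z.2] /\ weight z.1.2 = w] l
  & Posz (size l) = hat2 G (shift_vec mu 0) (shift_vec nu 0).
Proof.
move=> M0; rewrite pairs_expand.
have [|la ka z|la|l el sE] := @enumerates_union _ _ (enum [pred la : shp M D | dominant la])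
    (fun la => [set z | [/\ z.1.1 = unshift p la, ratSST oddA oddB (unshift p la) z.1.2,
       weight z.1.2 = w & LR_classes (unshift p la) mu nu z.2]]%classic)
    (fun la => (hat G (shift_vec (unshift p la) 0) * Posz (structure_const la))%R).
- exact: enum_uniq.
(* The generalized partition is part of the triple, so the union over diagrams is disjoint. *)
- by move=> _ _ [e1 _ _ _] [e2 _ _ _]; apply: (@unshift_inj _ _ p); rewrite -e1 -e2.
- rewrite mem_enum => dla.
  have [lT eT cT] := fibre_count (gen_part_unshift p dla) (shiftable_unshift p la)
                       (@shift_unshift_le _ _ _ _) (And3 sw (leqnn _) (leqnn _)).
  have ash : all_shiftable (unshift p la) mu nu p by rewrite /all_shiftable shiftable_unshift sm sn.
  have [lC eC cC] := LR_classes_enum (gen_part_unshift p dla) gm gn M0 ash.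
  exists [seq ((unshift p la, x.1), x.2) | x <- [seq (T, C) | T <- lT, C <- lC]]; last first.
    by rewrite size_map size_allpairs PoszM cT cC.
  have [ul lE] := enumerates_prod eT eC; split.
    by rewrite map_inj_uniq // => -[T C] [T' C'] [-> ->].
  move=> [[x T] C]; split=> [[/= -> rT wT LC]|/mapP[[T' C'] /lE [[/= rT wT] LC] [-> -> ->]]] //.
  by apply/mapP; exists (T, C) => //; apply/lE.
exists l; last by rewrite sE big_enum.
apply: enumerates_ext el => -[[x T] C]; split.
  case=> la; rewrite mem_enum => dla [/= -> rT wT LC]; split=> //; split=> //.
  by split; [exact: gen_part_unshift | exists T].
case=> -[/= _ rT LC] wT; have [la dla e] := ratSST_unshift rT wT.
by exists la; rewrite ?mem_enum //= -e.
Qed.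

Lemma product_coefficient : series_mul (ratS oddA oddB mu) (ratS oddA oddB nu) w =
  (\sum_(la \in @ratParts _ _ A B oddA oddB M) ((hatc la mu nu)%:Z * ratS oddA oddB la w))%R.
Proof.
rewrite series_mul_hat2 pairs_expand.
rewrite (@fsbig_list _ _ _ [seq unshift p la | la <- enum [pred la : shp M D | dominant la]]).
- rewrite big_map big_enum; apply: eq_bigr => la dla.
  by rewrite ratS_unshift // hatc_unshift // mulrC.
- by rewrite map_inj_uniq ?enum_uniq //; exact: unshift_inj.
(* A non-zero coefficient at w yields a tableau of weight w, which places the index in the finite
   box. *)
- move=> x [gx _] nz; have [T [rT wT]] : exists T, ratSST oddA oddB x T /\ weight T = w.
    apply: contrapT => no; case/negP: nz; rewrite /ratS fsbig1 ?mulr0 // => T rT.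
    by case: eqP => // wT; case: no; exists T.
  have [la dla ->] := ratSST_unshift rT wT.
  by apply: map_f; rewrite mem_enum.
(* Diagrams of the box that carry no rational tableau at all contribute an empty sum. *)
- move=> x /mapP[la]; rewrite mem_enum => dla -> no.
  rewrite /ratS fsbig1 ?mulr0 // => T rT; case: no.
  by split; [exact: gen_part_unshift | exists T].
Qed.

End FixedMonomial.
End Product.

Lemma ex_bounds {dA dB : Order.disp_t} {A : orderType dA} {B : orderType dB} m n
    (mu : m.-tuple int) (nu : n.-tuple int) (w : @monom dA dB A B) :
  exists (sA : seq A) (sB : seq B) (p D : nat),
    [/\ sorted <%O sA, sorted <%O sB, supported sA sB w, shiftable p mu & shiftable p nu] /\
    [/\ \sum_(x <- sB) w.2 x <= p, p + \sum_(x <- sA) w.1 x <= D,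
        forall i, nth 0 (shift_part p mu) i <= D & forall i, nth 0 (shift_part p nu) i <= D].
Proof.
pose sA := sort <=%O (finsupp w.1); pose sB := sort <=%O (finsupp w.2).
have [p1 s1] := ex_shiftable mu; have [p2 s2] := ex_shiftable nu.
pose p := p1 + p2 + \sum_(x <- sB) w.2 x.
exists sA, sB, p, (p + \sum_(x <- sA) w.1 x + sumn (shift_part p mu) + sumn (shift_part p nu)).
split; split.
- by rewrite sort_lt_sorted fset_uniq.
- by rewrite sort_lt_sorted fset_uniq.
- by split=> x; rewrite mem_sort.
- by apply: shiftable_le s1; rewrite /p -addnA leq_addr.
- by apply: shiftable_le s2; rewrite /p addnAC leq_addl.
- exact: leq_addl.
- by rewrite -addnA leq_addr.
- by move=> i; apply: leq_trans (nth_leq_sumn _ _) _; rewrite addnAC leq_addl.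
- by move=> i; apply: leq_trans (nth_leq_sumn _ _) _; rewrite leq_addl.
Qed.

Local Open Scope classical_set_scope.
Local Open Scope nat_scope.

Theorem theorem4p7
  (dA dB : Order.disp_t) (A : orderType dA) (B : orderType dB)
  (oddA : A -> bool) (oddB : B -> bool)
  (countA : countable [set: A]) (countB : countable [set: B])
  (m n : nat) (m_gt0 : 0 < m) (n_gt0 : 0 < n)
  (mu : m.-tuple int) (nu : n.-tuple int)
  (Pmu : ratParts oddA oddB mu) (Pnu : ratParts oddA oddB nu) :
  (exists rho : (seq (seq A) * seq (seq B)) * (seq (seq A) * seq (seq B)) ->
        (m + n).-tuple int * (seq (seq A) * seq (seq B))
          * set (seq (seq nat)),
     set_bij (ratSST oddA oddB mu `*` ratSST oddA oddB nu)
             [set z | [/\ ratParts oddA oddB z.1.1,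
                          ratSST oddA oddB z.1.1 z.1.2
                        & LR_classes z.1.1 mu nu z.2]]
             rho
     /\ forall x, (ratSST oddA oddB mu `*` ratSST oddA oddB nu) x ->
          weight (rho x).1.2 = monom_mul (weight x.1) (weight x.2))
  /\
  series_mul (ratS oddA oddB mu) (ratS oddA oddB nu) =
    (fun w => \sum_(la \in @ratParts _ _ A B oddA oddB (m + n))
                ((hatc la mu nu)%:Z * ratS oddA oddB la w))%R.
Proof.
have gm : gen_part mu by case: Pmu.
have gn : gen_part nu by case: Pnu.
have mn_gt0 : 0 < m + n by rewrite addn_gt0 m_gt0.
split; last first.
  apply: funext => w; have [sA [sB [p [D [[ssA ssB sw sm sn] []]]]]] := ex_bounds mu nu w.
  exact: (product_coefficient oddA oddB gm gn ssA ssB sw sm sn).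
(* The bounds and alphabets depend on w, so each weight has its own pair of lists; [choice] then
   assembles them into functions of w. *)
have ex w : exists ll, [/\
    enumerates [set x | (ratSST oddA oddB mu `*` ratSST oddA oddB nu) x /\
                        monom_mul (weight x.1) (weight x.2) = w] ll.1,
    enumerates [set z | [/\ ratParts oddA oddB z.1.1, ratSST oddA oddB z.1.1 z.1.2
                          & LR_classes z.1.1 mu nu z.2] /\ weight z.1.2 = w] ll.2
  & size ll.1 = size ll.2].
  have [sA [sB [p [D [[ssA ssB sw sm sn] [wB wA mD nD]]]]]] := ex_bounds mu nu w.
  have [lX eX cX] := pairs_count oddA oddB gm gn ssA ssB sw sm sn wB wA mD nD.
  have [lY eY cY] := triples_count oddA oddB gm gn ssA ssB sw sm sn wB wA mD mn_gt0.
  by exists (lX, lY); split=> //; apply/eqP; rewrite -eqz_nat; apply/eqP; rewrite cX cY.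
have [ll llP] := choice ex.
(* Only a default for [nth]; on the domain the index is always within the list. *)
pose y0 : (m + n).-tuple int * (seq (seq A) * seq (seq B)) * set (seq (seq nat)) :=
  ([tuple 0%R | i < m + n], ([::], [::]), fun=> False).
apply: (@graded_bijection _ _ _ _ _ (fun x => monom_mul (weight x.1) (weight x.2))
  (fun z => weight z.1.2) y0 (fun w => (ll w).1) (fun w => (ll w).2)) => w.
- by have [] := llP w.
- by have [] := llP w.
- by have [] := llP w.
Qed.
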